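(* Let $\hat{\mathcal F}$ be a germ of (formal) singular foliation at $(\mathbb C^2,p)$, let $\hat F$ be a balanced equation of separatrices of $\hat{\mathcal F}$, and let $C$ be a subset (union of irreducible components) of $(\hat F)_0$. Then $$GSV_p(\hat{\mathcal F},C)=\Delta_p(\hat{\mathcal F},C)+(C,(\hat F)_0\setminus C)_p-(C,(\hat F)_\infty)_p .$$ In particular, if $\hat{\mathcal F}$ is a generalized curve foliation, then $$GSV_p(\hat{\mathcal F},(\hat F)_0)=-((\hat F)_0,(\hat F)_\infty)_p .$$
   Context: **Foliations and reduction.** Fix coordinates so that $p=0\in\mathbb C^2$. A germ of formal foliation $\hat{\mathcal F}$ is defined by a formal $1$-form $\hat\omega=\hat a\,dx+\hat b\,dy$, $\hat a,\hat b\in\mathbb C[[x,y]]$ without common factor. A separatrix is a germ of formal irreducible curve $\{f=0\}$ with $f$ dividing $\hat\omega\wedge df$. If $E$ is a composition of point blow-ups, $E^*\hat{\mathcal F}$ is the strict transform foliation. A singularity is reduced if, in suitable formal coordinates, its linear part is $y\,dx-\lambda x\,dy$ with $\lambda\neq0$, $\lambda\notin\mathbb Q^+$, or $x\,dy$ (saddle-node). The minimal reduction of singularities $E:(\mathcal M,\mathcal D)\to(\mathbb C^2,0)$, $\mathcal D=E^{-1}(0)$, is the minimal composition of point blow-ups ($E$ is the identity if $0$ is regular or reduced) such that all singularities of $E^*\hat{\mathcal F}$ on $\mathcal D$ are reduced and the strict transforms of all separatrices are smooth, pairwise disjoint, transverse to $\mathcal D$ and avoid the corners of $\mathcal D$.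 A foliation is a generalized curve if no saddle-node appears among the singularities after its reduction. **Balanced equations.** A component $D\subset\mathcal D$ is dicritical if it is not invariant by $E^*\hat{\mathcal F}$; $\mathrm{Dic}(\hat{\mathcal F})$ is the set of these. The valence $\mathrm v(D)$ is the number of other components of $\mathcal D$ meeting $D$. $\mathrm{Curv}(D)$ is the set of separatrices whose strict transform meets the dicritical component $D$; separatrices in no $\mathrm{Curv}(D)$ are isolated, and form the set $\mathcal I(\hat{\mathcal F})$. A balanced equation of separatrices is a formal meromorphic function $\hat F$ with divisor $$(\hat F)_0-(\hat F)_\infty=\sum_{C\in\mathcal I(\hat{\mathcal F})}(C)+\sum_{D\in\mathrm{Dic}(\hat{\mathcal F})}\ \sum_{C\in\mathrm{Curv}(D)}a_{D,C}\,(C),$$ where $a_{D,C}\in\mathbb Z$ vanish for all but finitely many $C$ and $\sum_{C\in\mathrm{Curv}(D)}a_{D,C}=2-\mathrm v(D)$ for each dicritical $D$. **Polar excess.** For a formal meromorphic $1$-form $\eta=(P\,dx+Q\,dy)/H$ and an irreducible $\eta$-invariant formal curve $B\not\subset (H)_0$ with Puiseux parametrization $\gamma(t)$, $(\mathcal P^{\eta},B)_p=\mathrm{ord}_{t=0}\big(\tfrac{aP+bQ}{H}\circ\gamma\big)$ for generic $(a:b)\in\mathbb P^1_{\mathbb C}$; put $(\mathcal P^{\hat{\mathcal F}},B)_p=(\mathcal P^{\hat\omega},B)_p$. If $C=\bigcup_i C_i\subset(\hat F)_0$, with each irreducible component $C_i$ a simple zero of $\hat F$, then $$\Delta_p(\hat{\mathcal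 F},C)=\sum_i\big((\mathcal P^{\hat{\mathcal F}},C_i)_p-(\mathcal P^{d\hat F},C_i)_p\big),$$ with $d\hat F$ regarded as a formal meromorphic $1$-form. **GSV-index.** For an irreducible separatrix $B$ with reduced equation $f$ and Puiseux parametrization $\gamma$, write $g\hat\omega=k\,df+f\hat\eta$ with $\hat\eta$ a formal $1$-form, $g,k\in\mathbb C[[x,y]]$, $g$ and $f$ relatively prime; then $GSV_p(\hat{\mathcal F},B)=\mathrm{ord}_{t=0}\,\tfrac{k}{g}\circ\gamma$. For a union of two disjoint sets of separatrices, $GSV_p(\hat{\mathcal F},C_0\cup C_1)=GSV_p(\hat{\mathcal F},C_0)+GSV_p(\hat{\mathcal F},C_1)-2(C_0,C_1)_p$. $(\cdot,\cdot)_p$ is the intersection number at $p$ (bilinear on divisors) and $(\hat F)_0\setminus C$ is what remains of $(\hat F)_0$ after removing $C$.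
   Formalization: All components of C are assumed simple zeros of the balanced equation (needed to define Δ); in the ''in particular'' part all zeros are assumed simple: for the radial foliation x dy − y dx and the balanced equation y², the GSV-index of (F)_0 as a set is 1, not 0. *)

(* Defs.v *)
From HB Require Import structures.
From mathcomp Require Import all_boot all_order all_algebra finmap.
From mathcomp Require Import boolp classical_sets functions cardinality fsbigop reals.
From mathcomp Require Import complex ring.

Set Implicit Arguments.
Unset Strict Implicit.
Unset Printing Implicit Defensive.
Import Order.TTheory GRing.Theory Num.Theory.
Local Open Scope classical_set_scope.
Local Open Scope ring_scope.

(** ** Formal power series2 *)

Record fps (K : Type) := Fps { coefs : nat -> K }.
HB.instance Definition _ (K : Type) := [isNew for @coefs K].
HB.instance Definition _ (K : choiceType) := [Choice of fps K by <:].

Section FpsRing.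
Variable K : comNzRingType.
Implicit Types f g h : fps K.

Lemma fpsP f g : (forall n, coefs f n = coefs g n) -> f = g.
Proof. by move=> fg; apply: val_inj; apply: funext. Qed.

Definition fps_add f g := Fps (fun n => coefs f n + coefs g n).
Definition fps_opp f := Fps (fun n => - coefs f n).
Definition fps_mul f g :=
  Fps (fun n => \sum_(i < n.+1) coefs f i * coefs g (n - i)%N).
Definition fps_const (c : K) := Fps (fun n => if n is 0 then c else 0).
Definition fps_X : fps K := Fps (fun n => (n == 1)%:R).

Fact fps_addA : associative fps_add.
Proof. by move=> f g h; apply: fpsP => n /=; rewrite addrA. Qed.
Fact fps_addC : commutative fps_add.
Proof. by move=> f g; apply: fpsP => n /=; rewrite addrC. Qed.
Fact fps_add0 : left_id (fps_const 0) fps_add.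
Proof. by move=> f; apply: fpsP => -[|n] /=; rewrite add0r. Qed.
Fact fps_addN : left_inverse (fps_const 0) fps_opp fps_add.
Proof. by move=> f; apply: fpsP => -[|n] /=; rewrite addNr. Qed.

HB.instance Definition _ :=
  GRing.isZmodule.Build (fps K) fps_addA fps_addC fps_add0 fps_addN.

Let tr n f := \poly_(i < n.+1) coefs f i.

Let fps_mul_tr n m f g : (n <= m)%N -> coefs (fps_mul f g) n = (tr m f * tr m g)`_n.
Proof.
move=> nm; rewrite coefM /=; apply: eq_bigr => i _; rewrite !coef_poly !ltnS.
have le_i : (i <= n)%N by rewrite -ltnS.
by rewrite (leq_trans le_i nm) (leq_trans (leq_subr _ _) nm).
Qed.

Fact fps_mulA : associative fps_mul.
Proof.
move=> f g h; apply: fpsP => n.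
transitivity ((tr n f * (tr n g * tr n h))`_n).
  rewrite coefM.
  change (\sum_(i < n.+1) coefs f i * coefs (fps_mul g h) (n - i)%N =
          \sum_(i < n.+1) (tr n f)`_i * (tr n g * tr n h)`_(n - i)).
  apply: eq_bigr => i _.
  by rewrite (fps_mul_tr g h (leq_subr i n)) coef_poly ltn_ord.
rewrite mulrA coefM.
change (\sum_(i < n.+1) (tr n f * tr n g)`_i * (tr n h)`_(n - i) =
        \sum_(i < n.+1) coefs (fps_mul f g) i * coefs h (n - i)%N).
apply: eq_bigr => i _.
have le_i : (i <= n)%N by rewrite -ltnS.
by rewrite -(fps_mul_tr f g le_i) coef_poly ltnS leq_subr.
Qed.
Fact fps_mulC : commutative fps_mul.
Proof.
by move=> f g; apply: fpsP => n; rewrite !(fps_mul_tr _ _ (leqnn n)) mulrC.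
Qed.
Fact fps_mul1 : left_id (fps_const 1) fps_mul.
Proof.
move=> f; apply: fpsP => n /=; rewrite big_ord_recl /= mul1r subn0.
by rewrite big1 ?addr0 // => i _; rewrite mul0r.
Qed.
Fact fps_mulD : left_distributive fps_mul fps_add.
Proof.
move=> f g h; apply: fpsP => n /=; rewrite -big_split /=.
by apply: eq_bigr => i _; rewrite mulrDl.
Qed.
Fact fps_1neq0 : fps_const 1 != 0 :> fps K.
Proof. by apply/eqP => /(congr1 (fun f => coefs f 0)) /= /eqP; rewrite oner_eq0. Qed.

HB.instance Definition _ := GRing.Zmodule_isComNzRing.Build (fps K)
  fps_mulA fps_mulC fps_mul1 fps_mulD fps_1neq0.

Definition fps_unit : pred (fps K) := [pred f | `[< exists g, g * f = 1 >]].
Definition fps_inv f : fps K :=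
  if `[< exists g, g * f = 1 >] then xget 0 [set g | g * f = 1] else f.

Fact fps_mulV : {in fps_unit, left_inverse 1 fps_inv *%R}.
Proof.
move=> f fu; have uf : `[< exists g, g * f = 1 >] := fu.
rewrite /fps_inv uf; exact: (@xgetPex _ 0 [set g | g * f = 1] (asboolW uf)).
Qed.
Fact fps_unitP f g : g * f = 1 -> fps_unit f.
Proof. by move=> gf; apply/asboolP; exists g. Qed.
Fact fps_inv_out : {in [predC fps_unit], fps_inv =1 id}.
Proof.
move=> f fu; have /negPf uf : ~~ `[< exists g, g * f = 1 >] := fu.
by rewrite /fps_inv uf.
Qed.

HB.instance Definition _ := GRing.ComNzRing_hasMulInverse.Build (fps K)
  fps_mulV fps_unitP fps_inv_out.

Definition fps_deriv f : fps K := Fps (fun n => coefs f n.+1 *+ n.+1).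

(* The order of vanishing at 0; the value at the zero series is junk. *)
Definition ord f : nat :=
  xget 0%N [set n | coefs f n != 0 /\ forall m, (m < n)%N -> coefs f m = 0].

End FpsRing.

Arguments fps_X {K}.

Definition divides (A : comUnitRingType) (f g : A) := exists h, g = h * f.
Definition coprime_elts (A : comUnitRingType) (f g : A) :=
  forall h, divides h f -> divides h g -> h \is a GRing.unit.
Definition irreducible (A : comUnitRingType) (f : A) :=
  [/\ f != 0, f \isn't a GRing.unit &
      forall g h, f = g * h -> (g \is a GRing.unit) \/ (h \is a GRing.unit)].
Definition associated (A : comUnitRingType) (f g : A) :=
  exists2 u, u \is a GRing.unit & g = u * f.

Section Associates.
Variable A : comUnitRingType.
Implicit Types f g h : A.

Lemma associated_refl f : associated f f.
Proof. by exists 1; rewrite ?unitr1 ?mul1r. Qed.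

Lemma associated_sym f g : associated f g -> associated g f.
Proof. by move=> [u uu ->]; exists u^-1; rewrite ?unitrV ?mulKr. Qed.

Lemma associated_trans f g h : associated f g -> associated g h -> associated f h.
Proof.
by move=> [u uu ->] [v vu ->]; exists (v * u); rewrite ?unitrM ?uu ?vu ?mulrA.
Qed.

Lemma irreducible_associated f g : associated f g -> irreducible f -> irreducible g.
Proof.
move=> fg [f0 fN fI]; have [v vu fE] := associated_sym fg; split.
- by apply: contra_neq f0 => g0; rewrite fE g0 mulr0.
- by apply: contra fN => gu; rewrite fE unitrM vu.
move=> h k gE; have [|hu|ku] := fI (v * h) k; first by rewrite fE gE mulrA.
  by left; move: hu; rewrite unitrM => /andP[].
by right.
Qed.

End Associates.

(* The exponent of [f] in [g], for [f] irreducible and [g <> 0]. *)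
Definition multiplicity (A : comUnitRingType) (f g : A) : nat :=
  xget 0%N [set n | divides (f ^+ n) g /\ ~ divides (f ^+ n.+1) g].

(* For [g <> 0]: the cofactor of the largest power of [e] dividing [g]. *)
Definition strict (A : comUnitRingType) (e g : A) : A :=
  xget 0 [set h | (exists m, g = e ^+ m * h) /\ ~ divides e h].

Definition strict_pair (A : comUnitRingType) (e : A) (w : A * A) : A * A :=
  xget (0, 0) [set z | (exists m, w = (e ^+ m * z.1, e ^+ m * z.2)) /\
                       ~ (divides e z.1 /\ divides e z.2)].

Section Foliations.
Variable R : realType.
Notation C := (complex R).

(** ** Plane formal geometry *)

(* C[[x]][[y]]: the coefficient of x^i y^j is [coefs (coefs f j) i]. *)
Definition series2 := fps (fps C).
HB.instance Definition _ := GRing.ComUnitRing.on series2.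
Implicit Types f g h u v : series2.

Definition coef2 f (i j : nat) : C := coefs (coefs f j) i.
Definition const2 (c : C) : series2 := fps_const (fps_const c).
Definition varX : series2 := fps_const fps_X.
Definition varY : series2 := fps_X.
Definition dx f : series2 := Fps (fun j => fps_deriv (coefs f j)).
Definition dy f : series2 := fps_deriv f.
Definition linear_part f : series2 :=
  const2 (coef2 f 1 0) * varX + const2 (coef2 f 0 1) * varY.

(* f(u, v) for u, v without constant term, so that only the monomials of
   degree at most i + j contribute to the coefficient of x^i y^j. *)
Definition subst2 f u v : series2 :=
  Fps (fun j => Fps (fun i =>
    \sum_(k < (i + j).+1) \sum_(l < (i + j).+1)
      coef2 f k l * coef2 (u ^+ k * v ^+ l) i j)).

(* f(p(t), q(t)) for p, q without constant term. *)
Definition pull f (gam : fps C * fps C) : fps C :=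
  Fps (fun n => \sum_(k < n.+1) \sum_(l < n.+1)
    coef2 f k l * coefs (gam.1 ^+ k * gam.2 ^+ l) n).

(* A germ of formal irreducible curve, represented by the reduced equation
   that [choose] selects among all of its reduced equations. *)
Definition normal_eqn : pred series2 :=
  [pred f | `[< irreducible f >] &&
            (choose (fun g => `[< associated f g >]) f == f)].
Record curve := Curve { eqn : series2; _ : normal_eqn eqn }.
HB.instance Definition _ := [isSub for eqn].
HB.instance Definition _ := [Choice of curve by <:].
Implicit Types B : curve.

Lemma curve_ofP f : irreducible f -> exists! B, associated f (eqn B).
Proof.
move=> fI; pose P g : pred series2 := fun h => `[< associated g h >].
have PE g h : associated g h -> P g =1 P h.
  move=> gh k; apply/asboolP/asboolP; last exact: associated_trans.
  exact: associated_trans (associated_sym gh).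
have Pff g : P g g by apply/asboolP; exact: associated_refl.
have fg : associated f (choose (P f) f) by apply/asboolP; apply: (chooseP (Pff f)).
have Bg : normal_eqn (choose (P f) f).
  apply/andP; split; first exact/asboolP/(irreducible_associated fg).
  rewrite -/(P _) -(eq_choose (PE _ _ fg)); apply/eqP; apply: choose_id => //.
  exact/asboolP.
exists (Curve Bg); split=> //= B fB; apply: val_inj => /=.
have /andP[_ /eqP <-] := valP B; rewrite -/(P (eqn B)).
rewrite -(eq_choose (PE _ _ fB)); apply: choose_id => //; exact/asboolP.
Qed.

(* Puiseux parametrizations (t^n, phi) or (phi, t^n), with gcd (n, supp phi) = 1. *)
Definition is_puiseux f (gam : fps C * fps C) :=
  exists n : nat, exists phi : fps C,
    [/\ (0 < n)%N, coefs phi 0 = 0,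
        gam = (fps_X ^+ n, phi) \/ gam = (phi, fps_X ^+ n),
        forall d : nat, (d %| n)%N ->
          (forall i, coefs phi i != 0 -> (d %| i)%N) -> d = 1%N
      & pull f gam = 0].
Definition puiseux B : fps C * fps C := xget (0, 0) (is_puiseux (eqn B)).

(* The intersection number dim C[[x,y]] / (f, g), junk if infinite: [e] induces
   a basis of the quotient. *)
Definition inter_dims f g : set nat :=
  [set n | exists e : 'I_n -> series2, forall u, exists! c : 'rV[C]_n,
    exists a b, u = \sum_i const2 (c 0 i) * e i + a * f + b * g].
Definition inter f g : nat := xget 0%N (inter_dims f g).

Lemma inter_sym f g : inter f g = inter g f.
Proof.
have sub f1 g1 : inter_dims f1 g1 `<=` inter_dims g1 f1.
  move=> n [e eP]; exists e => u; have [c [[a [b uE]] cu]] := eP u; exists c.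
  split; first by exists b, a; rewrite uE [LHS]addrAC.
  move=> c' [a' [b' E]]; apply (cu c'); exists b', a'.
  exact: etrans E (addrAC _ _ _).
by congr (xget _ _); apply/seteqP; split; exact: sub.
Qed.

(** ** Divisors *)

Definition divisor := curve -> int.

Definition inter_div (D1 D2 : divisor) : int :=
  \sum_(p \in [set: curve * curve])
    D1 p.1 * D2 p.2 * (inter (eqn p.1) (eqn p.2))%:Z.

Definition div_of (S : {fset curve}) : divisor := fun B => (B \in S)%:Z.

Lemma inter_div_of (S T : {fset curve}) : inter_div (div_of S) (div_of T) =
  \sum_(B <- S) \sum_(B' <- T) (inter (eqn B) (eqn B'))%:Z.
Proof.
rewrite /inter_div (@fsbigTE _ _ _ _ (S `*` T)%fset) => [|p]; last first.
  by rewrite inE negb_and /div_of => /orP[]/negPf ->; rewrite ?mul0r ?mulr0 ?mul0r.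
pose F (p : curve * curve) := (inter (eqn p.1) (eqn p.2))%:Z.
rewrite (eq_big_seq F) => [|p]; last first.
  by rewrite inE /div_of => /andP[-> ->]; rewrite !mul1r.
rewrite (perm_big [seq (B, B') | B <- S, B' <- T]) ?big_allpairs //=.
apply: uniq_perm => [||[B B']]; rewrite ?fset_uniq //.
  by apply: allpairs_uniq => [||[? ?] [? ?]]; rewrite ?fset_uniq.
rewrite !inE /=; apply/andP/allpairsP => [[BS BT]|[[C C'] /= [CS CT [-> ->]]]] //.
by exists (B, B').
Qed.

(* A nonzero formal meromorphic function num / den in lowest terms. *)
Record mero := Mero {
  num : series2; den : series2;
  num_neq0 : num != 0; den_neq0 : den != 0;
  num_den : coprime_elts num den }.
Implicit Types F : mero.

Definition zeros F : divisor := fun B => (multiplicity (eqn B) (num F))%:Z.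
Definition poles F : divisor := fun B => (multiplicity (eqn B) (den F))%:Z.
Definition zero_components F : {fset curve} :=
  fset_set [set B | zeros F B != 0].

(** ** Foliations and blow-ups *)

(* (a, b) stands for a dx + b dy. *)
Definition oneform := (series2 * series2)%type.
Implicit Types w : oneform.

Definition foliation w := coprime_elts w.1 w.2.
Definition singular w := coef2 w.1 0 0 = 0 /\ coef2 w.2 0 0 = 0.

(* The coefficient of w /\ df on dx /\ dy. *)
Definition wedge_d w f : series2 := w.1 * dy f - w.2 * dx f.
Definition invariant_curve w f := divides f (wedge_d w f).
Definition separatrix w B := invariant_curve w (eqn B).

Definition pullback w u v : oneform :=
  (subst2 w.1 u v * dx u + subst2 w.2 u v * dx v,
   subst2 w.1 u v * dy u + subst2 w.2 u v * dy v).

(* The points of the exceptional line of a point blow-up are the directions: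
   [Some c] is y = c x, with local coordinates (x, y/x - c), and [None] is
   x = 0, with local coordinates (x/y, y). *)
Definition chart (c : option C) : series2 * series2 :=
  if c is Some z then (varX, varX * (varY + const2 z)) else (varX * varY, varY).
Definition exc (c : option C) : series2 := if c is Some _ then varX else varY.

Definition form_blowup w (c : option C) : oneform :=
  strict_pair (exc c) (pullback w (chart c).1 (chart c).2).
Definition series_blowup f (c : option C) : series2 :=
  strict (exc c) (subst2 f (chart c).1 (chart c).2).

(* A point infinitely near to 0, as the sequence of directions leading to it. *)
Definition infnear := seq (option C).
HB.instance Definition _ := Choice.on infnear.

(* The strict transforms of the foliation and of a curve, at an infinitely
   near point; the curve passes through it iff the series vanishes at 0. *)
Definition form_at w (s : infnear) : oneform := foldl form_blowup w s.
Definition series_at f (s : infnear) : series2 := foldl series_blowup f s.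
Definition passes f (s : infnear) := coef2 (series_at f s) 0 0 = 0.

(* A component of the exceptional divisor is named by the point whose blow-up
   creates it. In the local coordinates at an infinitely near point, the
   divisor is contained in xy = 0: [axes s] names the component x = 0 and the
   component y = 0, if any. In [axes_from], [q] is the point reached so far. *)
Fixpoint axes_from (q : infnear) (d : option infnear * option infnear) (s : infnear)
    : option infnear * option infnear :=
  if s is c :: s' then
    axes_from (rcons q c)
      (if c is Some z then (Some q, if z == 0 then d.2 else None)
       else (d.1, Some q)) s'
  else d.
Definition axes (s : infnear) := axes_from [::] (None, None) s.
Definition on_component (q s : infnear) :=
  (axes s).1 = Some q \/ (axes s).2 = Some q.
Definition corner (s : infnear) := (axes s).1 <> None /\ (axes s).2 <> None.

(** ** Reduction of singularities *)

(* f and g have independent linear parts. *)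
Definition transverse f g :=
  coef2 f 1 0 * coef2 g 0 1 - coef2 f 0 1 * coef2 g 1 0 != 0.

Definition formal_coordinates u v :=
  [/\ coef2 u 0 0 = 0, coef2 v 0 0 = 0 & transverse u v].

(* In suitable formal coordinates, and up to a unit factor, w has the given
   linear part. *)
Definition has_linear_part w (l : oneform) :=
  singular w /\ exists u v h,
    [/\ formal_coordinates u v, h \is a GRing.unit &
        let z := pullback w u v in
        (linear_part (h * z.1), linear_part (h * z.2)) = l].

Definition saddle_node w := has_linear_part w (0, varX).
Definition reduced_singularity w :=
  (exists2 lam : C, lam != 0 /\ (forall r : rat, 0 < r -> lam != ratr r) &
     has_linear_part w (varY, - const2 lam * varX))
  \/ saddle_node w.

(* A composition of point blow-ups over 0 is given by the finite set of its
   centers; the points of E^-1(0) are then the points that follow a center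
   without being one (and 0 itself when E is the identity). *)
Implicit Types T : {fset infnear}.
Definition prefix_closed T := forall s c, rcons s c \in T -> s \in T.
Definition leaf T (s : infnear) :=
  s \notin T /\ (s = [::] \/ exists q c, s = rcons q c /\ q \in T).

Definition resolves w T :=
  [/\ prefix_closed T,
      forall s, leaf T s -> singular (form_at w s) ->
        reduced_singularity (form_at w s)
    & T != fset0 -> forall s B, leaf T s -> separatrix w B ->
        passes (eqn B) s ->
        [/\ linear_part (series_at (eqn B) s) != 0,
            (axes s).1 <> None -> transverse (series_at (eqn B) s) varX,
            (axes s).2 <> None -> transverse (series_at (eqn B) s) varY,
            ~ corner s
          & forall B', separatrix w B' -> passes (eqn B') s -> B' = B]].

Definition minimal_reduction w T :=
  resolves w T /\ forall T', resolves w T' -> (T `<=` T')%fset.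

Definition generalized_curve w :=
  exists2 T, minimal_reduction w T &
    forall s, leaf T s -> ~ saddle_node (form_at w s).

(* The component created by blowing up [q] is not invariant. *)
Definition dicritical w (q : infnear) :=
  exists c, ~ invariant_curve (form_at w (rcons q c)) (exc c).

Definition meets T (q q' : infnear) :=
  exists s, [/\ leaf T s, on_component q s & on_component q' s].
Definition valence T (q : infnear) : nat :=
  #|` [fset q' in T | (q' != q) && `[< meets T q q' >]]%fset |.

Definition Dic w T : {fset infnear} := [fset q in T | `[< dicritical w q >]]%fset.
Definition Curv w T (q : infnear) : set curve :=
  [set B | separatrix w B /\
           exists s, [/\ leaf T s, on_component q s & passes (eqn B) s]].
Definition Isol w T : set curve :=
  [set B | separatrix w B /\ forall q, q \in Dic w T -> ~ Curv w T q B].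

Definition balanced w F :=
  exists2 T, minimal_reduction w T &
  exists a : infnear -> curve -> int,
    (forall q, q \in Dic w T ->
       finite_set [set B | Curv w T q B /\ a q B != 0] /\
       \sum_(B \in Curv w T q) a q B = 2 - (valence T q)%:Z) /\
    forall B, zeros F B - poles F B =
      (`[< Isol w T B >])%:Z +
      \sum_(q <- Dic w T) (`[< Curv w T q B >])%:Z * a q B.

(** ** Polar excess and GSV-index *)

(* For all but finitely many (a : b) in the projective line. *)
Definition generically (P : C -> C -> Prop) :=
  exists2 S : seq (C * C), (0, 0) \notin S &
    forall a b, (a, b) != (0, 0) ->
      (forall p, p \in S -> a * p.2 != b * p.1) -> P a b.

(* The order along B of the generic polar of (w.1 dx + w.2 dy) / h. *)
Definition polar w h B : int :=
  xget 0 [set n : int | generically (fun a b =>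
    (ord (pull (const2 a * w.1 + const2 b * w.2) (puiseux B)))%:Z
    - (ord (pull h (puiseux B)))%:Z = n)].

(* dF as (d_num F) / (den F)^2. *)
Definition d_num F : oneform :=
  (den F * dx (num F) - num F * dx (den F),
   den F * dy (num F) - num F * dy (den F)).

Definition Delta w F (S : {fset curve}) : int :=
  \sum_(B <- S) (polar w 1 B - polar (d_num F) (den F ^+ 2) B).

Definition GSV1 w B : int :=
  xget 0 [set n : int | exists g k (eta : oneform),
    [/\ g * w.1 = k * dx (eqn B) + eqn B * eta.1,
        g * w.2 = k * dy (eqn B) + eqn B * eta.2,
        coprime_elts g (eqn B)
      & n = (ord (pull k (puiseux B)))%:Z - (ord (pull g (puiseux B)))%:Z]].

Fixpoint GSV_seq w (s : seq curve) : int :=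
  if s is B :: s' then
    GSV1 w B + GSV_seq w s'
    - 2 * \sum_(B' <- s') (inter (eqn B) (eqn B'))%:Z
  else 0.
Definition GSV w (S : {fset curve}) : int := GSV_seq w S.

Lemma GSV_fsetU w (S T : {fset curve}) : [disjoint S & T]%fset ->
  GSV w (S `|` T)%fset = GSV w S + GSV w T - 2 * inter_div (div_of S) (div_of T).
Proof.
pose I B B' : int := (inter (eqn B) (eqn B'))%:Z.
have IC B B' : I B B' = I B' B by rewrite /I inter_sym.
pose D s t := \sum_(B <- s) \sum_(B' <- t) I B B'.
have DC s t : D s t = D t s.
  by rewrite /D exchange_big; do 2!(apply: eq_bigr => ? _); exact: IC.
have Dcatl s1 s2 t : D (s1 ++ s2) t = D s1 t + D s2 t by rewrite /D big_cat.
have Dcons B s : D [:: B] s = \sum_(B' <- s) I B B' by rewrite /D big_seq1.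
pose G s := \sum_(B <- s) (GSV1 w B + I B B) - D s s.
have GE s : GSV_seq w s = G s.
  elim: s => [|B s IHs]; first by rewrite /G /D !big_nil subr0.
  rewrite /= IHs -/(I B) -[X in 2 * X]Dcons /G big_cons -[in RHS]cat1s.
  rewrite Dcatl ![D _ (_ ++ _)]DC !Dcatl (DC s) [D [:: B] [:: B]]Dcons big_seq1.
  ring.
move=> dST; rewrite inter_div_of -/(D S T) /GSV.
have -> : GSV_seq w (S `|` T)%fset = GSV_seq w (S ++ T).
  have ST : perm_eq (S `|` T)%fset (S ++ T).
    apply: uniq_perm => [||B]; rewrite ?fset_uniq ?cat_uniq ?fset_uniq ?andbT //=.
      by apply/hasPn => B /(fdisjointP_sym dST).
    by rewrite inE mem_cat.
  rewrite !GE /G (perm_big _ ST) /D (perm_big _ ST) /=.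
  by congr (_ - _); apply: eq_bigr => B _; exact: perm_big.
rewrite !GE /G big_cat Dcatl ![D _ (_ ++ _)]DC !Dcatl (DC T S) /=; ring.
Qed.

End Foliations.

(* Main.v *)
(* Along a branch B with equation f, the form w is proportional to df, with a
   factor of order GSV(B), and dF is ((num F / f) / den F) df. Comparing orders,
     GSV(B) = polar excess of B + (num F / f, B) - (den F, B),
   and summing over B proves the first formula.

   For the second one, GSV(B) = ((F)_0 - (F)_oo - B, B) is proved by descending
   induction on the tree of infinitely near points. At each of them, the index
   along an invariant component and the tangency order with a dicritical one
   are compared with the intersection number of (F)_0 - (F)_oo with that
   component. As the indices along an invariant exceptional line add up to
   nu + 1 and the tangencies with a dicritical one to nu - 1, for nu the
   multiplicity of the foliation, the prescription 2 - v(D) is what makes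
     mult ((F)_0 - (F)_oo) = nu + 1 - #{invariant components through the point},
   and this is how both sides of the formula for GSV(B) change alike under a
   blow-up. At the end of the tree, a reduced singularity which is not a
   saddle-node has exactly two branches, smooth and transverse. *)
Require Import Defs.
From HB Require Import structures.
From mathcomp Require Import all_boot all_order all_algebra cyclic separable cyclotomic finmap.
From mathcomp Require Import boolp classical_sets cardinality fsbigop reals.
From mathcomp Require Import complex ring zify.
(* Again, since [eqn] would otherwise denote the equality test of [nat]. *)
Require Import Defs.

Set Implicit Arguments.
Unset Strict Implicit.
Unset Printing Implicit Defensive.
Import Order.TTheory GRing.Theory Num.Theory.
Local Open Scope classical_set_scope.
Local Open Scope ring_scope.

(** * Formal power series *)

(** Curves are handled through their parametrizations. The intersection number, a dimension, is an
    order of vanishing only when the parametrization generates the branch: its kernel is the ideal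
    of the branch and its image contains every series of large order. Strict transforms inherit
    this, and therefore meet the exceptional line at a single point. The GSV-index is carried as ord
    [mu1] - ord [mu0], where w = (mu1 / mu0) df along the branch, because a blow-up just multiplies
    each factor by a power of the exceptional equation. At the ends of the tree, the reduction
    constrains separatrices, while what is needed is the invariance of components. The link is that
    an invariant branch outside the exceptional divisor descends to a separatrix. At a dicritical
    point the tangencies give nu - 1 = N - (2 - v) + e - v, with N the multiplicity of the divisor
    and e the number of invariant components through the point: the last v counts the corners of the
    new component, and cancels the one in the prescription. *)

Section FpsTheory.
Variable K : comNzRingType.
Implicit Types f g h : fps K.

Lemma coefsD f g n : coefs (f + g) n = coefs f n + coefs g n.
Proof. by []. Qed.
Lemma coefsN f n : coefs (- f) n = - coefs f n.
Proof. by []. Qed.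
Lemma coefsB f g n : coefs (f - g) n = coefs f n - coefs g n.
Proof. by []. Qed.
Lemma coefsM f g n :
  coefs (f * g) n = \sum_(i < n.+1) coefs f i * coefs g (n - i)%N.
Proof. by []. Qed.
Lemma coefsC (c : K) n : coefs (fps_const c) n = if n == 0%N then c else 0.
Proof. by case: n. Qed.
Lemma coefs0 n : coefs (0 : fps K) n = 0.
Proof. by rewrite (coefsC 0) if_same. Qed.
Lemma coefs1 n : coefs (1 : fps K) n = (n == 0%N)%:R.
Proof. by rewrite (coefsC 1); case: n. Qed.
Lemma coefs_sum (I : Type) (r : seq I) (P : pred I) (F : I -> fps K) n :
  coefs (\sum_(i <- r | P i) F i) n = \sum_(i <- r | P i) coefs (F i) n.
Proof. by apply: (big_morph (fun f => coefs f n)) => //; rewrite coefs0. Qed.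
Lemma coefsMn f k n : coefs (f *+ k) n = coefs f n *+ k.
Proof. by elim: k => [|k IH]; rewrite ?mulr0n ?coefs0 // !mulrS coefsD IH. Qed.

Lemma coefsXM f n : coefs (fps_X * f) n = if n is m.+1 then coefs f m else 0.
Proof.
rewrite coefsM; case: n => [|m]; first by rewrite big_ord1 /= mul0r.
rewrite (bigD1 (Ordinal (isT : 1 < m.+2)%N)) //= mul1r subSS subn0 big1 ?addr0 //.
move=> i; rewrite -val_eqE /= => /negPf ->; exact: mul0r.
Qed.
Lemma coefsXnM k f n :
  coefs (fps_X ^+ k * f) n = if (n < k)%N then 0 else coefs f (n - k)%N.
Proof.
elim: k n => [|k IH] n; first by rewrite expr0 mul1r subn0.
by rewrite exprS -mulrA coefsXM; case: n => [//|n]; rewrite IH ltnS subSS.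
Qed.
Lemma coefsXn k n : coefs (fps_X ^+ k : fps K) n = (n == k)%:R.
Proof.
rewrite -[_ ^+ k]mulr1 coefsXnM coefs1 -[(n - k == 0)%N]/(n <= k)%N.
by rewrite eqn_leq; case: ltnP => [/ltnW nk|nk]; [rewrite andbC leqNgt|rewrite andbT].
Qed.

Fact fps_const_additive : zmod_morphism (@fps_const K).
Proof. by move=> a b; apply: fpsP => -[|n] //=; rewrite subr0. Qed.
HB.instance Definition _ :=
  GRing.isZmodMorphism.Build K (fps K) (@fps_const K) fps_const_additive.
Lemma coefsCM c f n : coefs (fps_const c * f) n = c * coefs f n.
Proof.
rewrite coefsM big_ord_recl /= subn0 big1 ?addr0 // => i _.
by rewrite mul0r.
Qed.
Fact fps_const_multiplicative : monoid_morphism (@fps_const K).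
Proof.
by split=> // a b; apply: fpsP => n; rewrite coefsCM; case: n => //= n; rewrite mulr0.
Qed.
HB.instance Definition _ :=
  GRing.isMonoidMorphism.Build K (fps K) (@fps_const K) fps_const_multiplicative.

Lemma coefsM0 f g : coefs (f * g) 0 = coefs f 0 * coefs g 0.
Proof. by rewrite coefsM big_ord1. Qed.
Lemma coefsM1 f g : coefs (f * g) 1 = coefs f 0 * coefs g 1 + coefs f 1 * coefs g 0.
Proof. by rewrite coefsM !big_ord_recl big_ord0 addr0. Qed.

(** Membership in the n-th power of the ideal of [fps_X]. The zero series belongs to all of them,
    whereas its [ord] is a default value. *)
Definition vg n f := forall m, (m < n)%N -> coefs f m = 0.

Lemma vg_le m n f : (m <= n)%N -> vg n f -> vg m f.
Proof. by move=> mn fn k km; apply: fn; apply: leq_trans mn. Qed.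
Lemma vg0 f : vg 0 f. Proof. by []. Qed.
Lemma vgz n : vg n (0 : fps K). Proof. by move=> m _; rewrite coefs0. Qed.
Lemma vgD n f g : vg n f -> vg n g -> vg n (f + g).
Proof. by move=> fn gn m mn; rewrite coefsD fn ?gn ?addr0. Qed.
Lemma vgN n f : vg n f -> vg n (- f).
Proof. by move=> fn m mn; rewrite coefsN fn ?oppr0. Qed.
Lemma vgB n f g : vg n f -> vg n g -> vg n (f - g).
Proof. by move=> fn gn; apply: vgD => //; apply: vgN. Qed.
Lemma vgM m n f g : vg m f -> vg n g -> vg (m + n) (f * g).
Proof.
move=> fm gn k kmn; rewrite coefsM big1 // => i _.
have [im|mi] := ltnP i m; first by rewrite fm ?mul0r.
have kin : (k - i < n)%N by have := ltn_ord i; lia.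
by rewrite gn ?mulr0.
Qed.
Lemma vgXn n : vg n (fps_X ^+ n).
Proof. by move=> m mn; rewrite coefsXn ltn_eqF. Qed.
Lemma vg1 f : coefs f 0 = 0 -> vg 1 f.
Proof. by move=> f0 [|m]. Qed.
Lemma vgE n f : vg n f <-> exists g, f = fps_X ^+ n * g.
Proof.
split=> [fn|[g ->]]; last first.
  by move=> m mn; rewrite coefsXnM mn.
exists (Fps (fun m => coefs f (m + n))); apply: fpsP => m; rewrite coefsXnM.
by case: ltnP => [/fn//|nm] /=; rewrite subnK.
Qed.
Lemma vg_sep f : (forall n, vg n f) -> f = 0.
Proof. by move=> fn; apply: fpsP => n; rewrite coefs0 (fn n.+1). Qed.
Lemma vgS n f : vg n.+1 f <-> vg n f /\ coefs f n = 0.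
Proof.
split=> [fn|[fn fn0] m]; first by split=> [m mn|]; apply: fn => //; exact: ltnW.
by rewrite ltnS leq_eqVlt => /predU1P[->//|/fn].
Qed.
Lemma vg_exp n f k : vg n f -> vg (n * k) (f ^+ k).
Proof.
move=> fn; elim: k => [|k IH]; first by rewrite muln0.
by rewrite exprS mulnS; apply: vgM.
Qed.
Lemma vg_lead m n f g : vg m f -> vg n g ->
  coefs (f * g) (m + n) = coefs f m * coefs g n.
Proof.
move=> /vgE[f1 ->] /vgE[g1 ->].
by rewrite mulrACA -exprD !coefsXnM !ltnn !subnn coefsM0.
Qed.

Lemma coefs_deriv f n : coefs (fps_deriv f) n = coefs f n.+1 *+ n.+1.
Proof. by []. Qed.
Lemma fderivD f g : fps_deriv (f + g) = fps_deriv f + fps_deriv g.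
Proof. by apply: fpsP => n; rewrite coefsD /= mulrnDl. Qed.
Lemma fderivC c : fps_deriv (fps_const c) = 0 :> fps K.
Proof. by apply: fpsP => n; rewrite coefs0 /= mul0rn. Qed.
Lemma fderivXn n : fps_deriv (fps_X ^+ n) = fps_X ^+ n.-1 *+ n :> fps K.
Proof.
apply: fpsP => m; rewrite coefsMn /= !coefsXn; case: n => [|n] /=.
  by rewrite mulr0n mul0rn.
by rewrite eqSS; case: eqP => [->//|_]; rewrite !mul0rn.
Qed.
Lemma fderivM f g : fps_deriv (f * g) = fps_deriv f * g + f * fps_deriv g.
Proof.
apply: fpsP => n; rewrite coefsD [LHS]/=.
rewrite !coefsM -sumrMnl.
transitivity (\sum_(i < n.+2) (coefs f i * coefs g (n.+1 - i) *+ i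
    + coefs f i * coefs g (n.+1 - i) *+ (n.+1 - i))).
  apply: eq_bigr => i _; rewrite -mulrnDr subnKC //; exact: (ltn_ord i).
rewrite big_split /=; congr (_ + _).
  rewrite big_ord_recl mulr0n add0r; apply: eq_bigr => i _ /=.
  by rewrite subSS mulrnAl.
rewrite big_ord_recr /= subnn mulr0n addr0; apply: eq_bigr => i _.
have -> : (n.+1 - i)%N = (n - i).+1 by have := ltn_ord i; lia.
by rewrite mulrnAr.
Qed.
Lemma vg_deriv n f : vg n.+1 f -> vg n (fps_deriv f).
Proof. by move=> fn m mn /=; rewrite fn ?mul0rn. Qed.

Definition is_ord f n := coefs f n != 0 /\ vg n f.

Lemma is_ord_uniq f m n : is_ord f m -> is_ord f n -> m = n.
Proof.
move=> [fm mf] [fn nf]; apply/eqP; rewrite eqn_leq; apply/andP; split.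
  by rewrite leqNgt; apply: contra fn => /mf ->.
by rewrite leqNgt; apply: contra fm => /nf ->.
Qed.
Lemma ordE f n : is_ord f n -> ord f = n.
Proof.
move=> fn; apply: (@is_ord_uniq f) => //; rewrite /ord.
exact: (@xgetPex _ 0%N [set m | is_ord f m] (ex_intro _ n fn)).
Qed.
Lemma is_ord_ex f : f != 0 -> is_ord f (ord f).
Proof.
move=> f0; suff [n fn] : exists n, is_ord f n by rewrite (ordE fn).
have ex : exists n, coefs f n != 0.
  apply: contrapT => nex; move/eqP: f0; apply; apply: fpsP => n; rewrite coefs0.
  by apply/eqP; apply: contrapT => /negP fn; apply: nex; exists n.
exists (ex_minn ex); case: ex_minnP => n fn nmin; split=> // m mn.
by apply/eqP; apply: contraLR mn => /nmin; rewrite -leqNgt.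
Qed.
Lemma is_ord_neq0 f n : is_ord f n -> f != 0.
Proof. by case=> fn _; apply: contraNneq fn => ->; rewrite coefs0. Qed.
Lemma vg_ord f n : f != 0 -> vg n f -> (n <= ord f)%N.
Proof.
move=> /is_ord_ex[fn _] nf; rewrite leqNgt; apply: contra fn => /nf ->; exact: eqxx.
Qed.
Lemma ord_vg f : f != 0 -> vg (ord f) f.
Proof. by case/is_ord_ex. Qed.
Lemma ord_gt0 f : f != 0 -> coefs f 0 = 0 -> (0 < ord f)%N.
Proof. by move=> f0 fz; apply: vg_ord => //; apply: vg1. Qed.
Lemma ord_eq0 f : coefs f 0 != 0 -> ord f = 0%N.
Proof. by move=> f0; apply: ordE. Qed.
Lemma is_ordXn n : is_ord (fps_X ^+ n) n.
Proof. by split; [rewrite coefsXn eqxx oner_eq0|exact: vgXn]. Qed.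
Lemma ordXn n : ord (fps_X ^+ n : fps K) = n.
Proof. exact/ordE/is_ordXn. Qed.
Lemma fpsX_neq0 : fps_X != 0 :> fps K.
Proof. exact: is_ord_neq0 (is_ordXn 1). Qed.
End FpsTheory.

(** * Fixed points of contractions *)

Section Contraction.
Variables (T : zmodType) (O : nat -> T -> Prop).
Hypothesis OB : forall n a b, O n a -> O n b -> O n (a - b).
Hypothesis O_sep : forall a, (forall n, O n a) -> a = 0.
Hypothesis O_all : forall a, O 0 a.
Hypothesis O_lim : forall u : nat -> T, (forall k, O k (u k.+1 - u k)) ->
  exists l, forall k, O k (l - u k).

(** The iterates of [Phi] from 0 form a Cauchy sequence for the filtration [O], and [O_lim] is
    completeness. Inverses, Weierstrass quotients, roots and solutions of differential equations are
    all obtained in this way. *)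
Lemma contraction_fixpoint (Phi : T -> T) :
  (forall k f g, O k (f - g) -> O k.+1 (Phi f - Phi g)) -> exists f, Phi f = f.
Proof.
move=> PhiP; pose u n := iter n Phi 0.
have uS k : O k (u k.+1 - u k) by elim: k => [|k IH]; [exact: O_all|exact: PhiP].
have [l lP] := O_lim uS; exists l; apply/subr0_eq/O_sep => -[|k]; first exact: O_all.
have -> : Phi l - l = (Phi l - u k.+1) - (l - u k.+1).
  by rewrite opprB addrA subrK.
by apply: OB; [exact: PhiP|exact: lP].
Qed.
End Contraction.

Lemma fps_fixpoint (K : comNzRingType) (Phi : fps K -> fps K) :
  (forall k f g, vg k (f - g) -> vg k.+1 (Phi f - Phi g)) -> exists f, Phi f = f.
Proof.
apply: contraction_fixpoint.
- by move=> *; apply: vgB.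
- exact: vg_sep.
- exact: vg0.
(* The n-th coefficient is constant from [u n.+1] on, so the limit is a diagonal. *)
move=> u uP; exists (Fps (fun n => coefs (u n.+1) n)) => k m mk /=.
elim: k mk => // k IH; rewrite ltnS leq_eqVlt => /predU1P[->|mk].
  exact: subrr.
by have /eqP := uP k m mk; rewrite coefsB subr_eq0 => /eqP ->; exact: IH.
Qed.

Section FpsUnits.
Variable K : comUnitRingType.
Implicit Types f g : fps K.

(** The inverse g of f solves g = c^-1 (1 - (f - c) g), with c the constant term of f; this is a
    contraction because f - c has no constant term. *)
Lemma fps_unitE f : (f \is a GRing.unit) = (coefs f 0 \is a GRing.unit).
Proof.
apply/idP/idP => [uf|uf].
  apply/unitrPr; exists (coefs f^-1 0); rewrite -coefsM0 divrr //.
pose Phi g := fps_const (coefs f 0)^-1 * (1 - (f - fps_const (coefs f 0)) * g).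
have [|g gE] := @fps_fixpoint _ Phi.
  move=> k g h gh; rewrite /Phi -mulrBr; set a := f - _.
  have -> : 1 - a * g - (1 - a * h) = - (a * (g - h)) by ring.
  rewrite -[k.+1]add0n; apply: vgM => //; rewrite -add1n; apply: vgN.
  by apply: vgM => //; apply: vg1; rewrite coefsB coefsC subrr.
apply/unitrPr; exists g; move: gE; rewrite /Phi => gE.
have /(congr1 (fun z => fps_const (coefs f 0) * z)) := gE.
rewrite mulrA -rmorphM divrr // rmorph1 mul1r mulrBl => E.
by move/eqP: E; rewrite subr_eq addrC subrK eq_sym => /eqP.
Qed.
End FpsUnits.

Section FpsDomain.
Variable K : idomainType.
Implicit Types f g : fps K.

Lemma is_ordM f g m n : is_ord f m -> is_ord g n -> is_ord (f * g) (m + n).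
Proof.
move=> [fm mf] [gn ng]; split; last exact: vgM.
by rewrite vg_lead // mulf_neq0.
Qed.
Fact fps_integral : GRing.integral_domain_axiom (fps K).
Proof.
move=> f g fg; apply: contraT; rewrite negb_or => /andP[f0 g0].
have := is_ord_neq0 (is_ordM (is_ord_ex f0) (is_ord_ex g0)).
by rewrite fg eqxx.
Qed.
HB.instance Definition _ := GRing.ComUnitRing_isIntegral.Build (fps K) fps_integral.

Lemma ordM f g : f != 0 -> g != 0 -> ord (f * g) = (ord f + ord g)%N.
Proof. by move=> f0 g0; apply: ordE; apply: is_ordM; apply: is_ord_ex. Qed.
Lemma ord1 : ord (1 : fps K) = 0%N.
Proof. exact: (ordXn K 0). Qed.
Lemma ordX f k : f != 0 -> ord (f ^+ k) = (k * ord f)%N.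
Proof.
by move=> f0; elim: k => [|k IH]; rewrite ?ord1 // exprS ordM ?expf_neq0 // IH.
Qed.
Lemma ordN f : ord (- f) = ord f.
Proof.
have [->|f0] := eqVneq f 0; first by rewrite oppr0.
have [fn nf] := is_ord_ex f0; apply: ordE; split; last exact: vgN.
by rewrite coefsN oppr_eq0.
Qed.
End FpsDomain.

HB.instance Definition _ (R : realType) :=
  GRing.IntegralDomain.copy (series2 R) (fps (fps (complex R))).

(** * Evaluation and substitution *)

Section Series2.
Variable R : realType.
Notation C := (complex R).
Implicit Types f g : series2 R.

Lemma coef2D f g i j : coef2 (f + g) i j = coef2 f i j + coef2 g i j.
Proof. by []. Qed.
Lemma coef2N f i j : coef2 (- f) i j = - coef2 f i j.
Proof. by []. Qed.
Lemma coef2B f g i j : coef2 (f - g) i j = coef2 f i j - coef2 g i j.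
Proof. by []. Qed.
Lemma coef20 i j : coef2 (0 : series2 R) i j = 0.
Proof. by rewrite /coef2 !coefs0. Qed.
Lemma coef2M f g i j : coef2 (f * g) i j =
  \sum_(l < j.+1) \sum_(k < i.+1) coef2 f k l * coef2 g (i - k) (j - l).
Proof.
by rewrite /coef2 coefsM coefs_sum; apply: eq_bigr => l _; rewrite coefsM.
Qed.
Lemma coef2C c i j :
  coef2 (const2 c) i j = (if (i == 0%N) && (j == 0%N) then c else 0) :> C.
Proof. by rewrite /coef2 /const2 coefsC; case: j i => [|j] [|i] //=; rewrite ?coefs0. Qed.
Lemma coef21 i j : coef2 (1 : series2 R) i j = ((i == 0%N) && (j == 0%N))%:R.
Proof. by rewrite (coef2C 1); case: ifP. Qed.
Lemma coef2_sum (I : Type) (r : seq I) (P : pred I) (F : I -> series2 R) i j :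
  coef2 (\sum_(k <- r | P k) F k) i j = \sum_(k <- r | P k) coef2 (F k) i j.
Proof. by rewrite /coef2 !coefs_sum. Qed.
Lemma series2P f g : (forall i j, coef2 f i j = coef2 g i j) -> f = g.
Proof. by move=> fg; apply: fpsP => j; apply: fpsP => i; apply: fg. Qed.

Fact const2_additive : zmod_morphism (@const2 R).
Proof. by move=> a b; rewrite /const2 !rmorphB. Qed.
HB.instance Definition _ :=
  GRing.isZmodMorphism.Build C (series2 R) (@const2 R) const2_additive.
Fact const2_multiplicative : monoid_morphism (@const2 R).
Proof. by split=> [|a b]; rewrite /const2 ?rmorph1 ?rmorphM. Qed.
HB.instance Definition _ :=
  GRing.isMonoidMorphism.Build C (series2 R) (@const2 R) const2_multiplicative.

Definition vg2 n f := forall i j, (i + j < n)%N -> coef2 f i j = 0.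

Lemma vg2B n f g : vg2 n f -> vg2 n g -> vg2 n (f - g).
Proof. by move=> fn gn i j ij; rewrite coef2B fn ?gn ?subr0. Qed.
Lemma vg2z n : vg2 n 0.
Proof. by move=> i j _; rewrite coef20. Qed.
Lemma vg2M m n f g : vg2 m f -> vg2 n g -> vg2 (m + n) (f * g).
Proof.
move=> fm gn i j ij; rewrite coef2M big1 // => l _; rewrite big1 // => k _.
have [klm|klm] := ltnP (k + l) m; first by rewrite fm ?mul0r.
have kl : (i - k + (j - l) < n)%N.
  by have := ltn_ord k; have := ltn_ord l; move: (nat_of_ord k) (nat_of_ord l) klm => *; lia.
by rewrite gn ?mulr0.
Qed.
Lemma vg2_le m n f : (m <= n)%N -> vg2 n f -> vg2 m f.
Proof. by move=> mn fn i j ij; apply: fn; apply: leq_trans mn. Qed.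
Lemma vg2_sep f : (forall n, vg2 n f) -> f = 0.
Proof. by move=> fn; apply: series2P => i j; rewrite coef20 (fn (i + j).+1). Qed.
Lemma vg2_0 f : vg2 0 f. Proof. by []. Qed.
Lemma vg2_1 f : coef2 f 0 0 = 0 -> vg2 1 f.
Proof. by move=> f0 [|i] [|j]. Qed.

Lemma coef2_deriv_x f i j : coef2 (dx f) i j = coef2 f i.+1 j *+ i.+1.
Proof. by []. Qed.
Lemma coef2_deriv_y f i j : coef2 (dy f) i j = coef2 f i j.+1 *+ j.+1.
Proof. by rewrite /coef2 /dy /= coefsMn. Qed.
Lemma dyM f g : dy (f * g) = dy f * g + f * dy g.
Proof. exact: fderivM. Qed.
Lemma dyD f g : dy (f + g) = dy f + dy g.
Proof. exact: fderivD. Qed.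
Lemma dxD f g : dx (f + g) = dx f + dx g.
Proof. by apply: fpsP => j; apply: fderivD. Qed.
Lemma dxM f g : dx (f * g) = dx f * g + f * dx g.
Proof.
apply: fpsP => j; rewrite coefsD !coefsM /= -big_split /= .
transitivity (\sum_(i < j.+1) fps_deriv (coefs f i * coefs g (j - i))).
  by apply: (big_morph _ (@fderivD _)); exact: (fderivC (0 : C)).
by apply: eq_bigr => i _; rewrite fderivM.
Qed.
Lemma dxC c : dx (const2 c) = 0 :> series2 R.
Proof. by apply: series2P => i j; rewrite coef2_deriv_x coef2C coef20 mul0rn. Qed.
Lemma dyC c : dy (const2 c) = 0 :> series2 R.
Proof. by apply: series2P => i j; rewrite coef2_deriv_y coef2C coef20 andbF mul0rn. Qed.
Lemma coef2X i j : coef2 (varX R) i j = ((i == 1%N) && (j == 0%N))%:R.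
Proof. by rewrite /coef2 /varX coefsC; case: j => [|j]; rewrite ?coefs0 ?andbF ?andbT. Qed.
Lemma coef2Y i j : coef2 (varY R) i j = ((i == 0%N) && (j == 1%N))%:R.
Proof.
by rewrite /coef2 /varY /=; case: eqP => _; rewrite ?coefs0 ?coefs1 ?andbF ?andbT.
Qed.
Lemma dxX : dx (varX R) = 1.
Proof.
apply: series2P => i j; rewrite coef2_deriv_x coef2X coef21 eqSS.
by case: i j => [|i] [|j] //=; rewrite ?mul0rn.
Qed.
Lemma dyX : dy (varX R) = 0.
Proof. by apply: series2P => i j; rewrite coef2_deriv_y coef2X coef20 andbF mul0rn. Qed.
Lemma dxY : dx (varY R) = 0.
Proof. by apply: series2P => i j; rewrite coef2_deriv_x coef2Y coef20 mul0rn. Qed.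
Lemma dyY : dy (varY R) = 1.
Proof.
apply: series2P => i j; rewrite coef2_deriv_y coef2Y coef21 eqSS.
by case: i j => [|i] [|j] //=; rewrite ?mul0rn.
Qed.
Lemma vg2_dx n f : vg2 n.+1 f -> vg2 n (dx f).
Proof. by move=> fn i j ij; rewrite coef2_deriv_x fn ?mul0rn. Qed.
Lemma vg2_dy n f : vg2 n.+1 f -> vg2 n (dy f).
Proof. by move=> fn i j ij; rewrite coef2_deriv_y fn ?mul0rn // addnS. Qed.
Lemma coef2M00 f g : coef2 (f * g) 0 0 = coef2 f 0 0 * coef2 g 0 0.
Proof. by rewrite coef2M !big_ord1. Qed.
Lemma coef2M10 f g :
  coef2 (f * g) 1 0 = coef2 f 0 0 * coef2 g 1 0 + coef2 f 1 0 * coef2 g 0 0.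
Proof. by rewrite coef2M !big_ord_recl !big_ord0 !addr0. Qed.
Lemma coef2M01 f g :
  coef2 (f * g) 0 1 = coef2 f 0 0 * coef2 g 0 1 + coef2 f 0 1 * coef2 g 0 0.
Proof. by rewrite coef2M !big_ord_recl !big_ord0 !addr0. Qed.
Lemma series2_unitE f : (f \is a GRing.unit) = (coef2 f 0 0 != 0).
Proof. by rewrite [LHS]fps_unitE [LHS]fps_unitE unitfE. Qed.
End Series2.

(* [O n] plays the n-th step of a separated multiplicative filtration of [T];
   both [pull] and [subst2] are instances of [is_ev]. *)
Section Evaluation.
Variables (R : realType) (T : comNzRingType) (O : nat -> T -> Prop).
Notation C := (complex R).
Hypothesis OB : forall n a b, O n a -> O n b -> O n (a - b).
Hypothesis O_sep : forall a, (forall n, O n a) -> a = 0.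
Hypothesis O_all : forall a, O 0 a.
Hypothesis O_le : forall m n a, (m <= n)%N -> O n a -> O m a.
Hypothesis Oz : forall n, O n 0.
Hypothesis OM : forall m n a b, O m a -> O n b -> O (m + n) (a * b).
Variables (iota : {rmorphism C -> T}) (a b : T).
Hypotheses (Oa : O 1 a) (Ob : O 1 b).
Implicit Types f g : series2 R.

Let ON n x : O n x -> O n (- x).
Proof. by move=> xn; rewrite -sub0r; apply: OB. Qed.
Let OD n x y : O n x -> O n y -> O n (x + y).
Proof. by move=> xn yn; rewrite -[y]opprK; apply: OB => //; apply: ON. Qed.
Let Osum n (I : Type) (r : seq I) (P : pred I) (F : I -> T) :
  (forall i, P i -> O n (F i)) -> O n (\sum_(i <- r | P i) F i).
Proof. by move=> FO; apply: big_ind => // *; apply: OD. Qed.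
Let OMr n x y : O n x -> O n (x * y).
Proof. by move=> xn; rewrite -[n]addn0; apply: OM. Qed.
Let OMl n x y : O n y -> O n (x * y).
Proof. by move=> xn; rewrite -[n]add0n; apply: OM. Qed.
Let OX n x : O 1 x -> O n (x ^+ n).
Proof. by move=> x1; elim: n => // n IH; rewrite exprS -add1n; apply: OM. Qed.

Definition ev_trunc n f : T :=
  \sum_(l < n) \sum_(k < n) iota (coef2 f k l) * (a ^+ k * b ^+ l).
(** The value of f at (a, b), characterized by congruences modulo each [O n]: identities between
    values then follow from uniqueness, without returning to the sums that define [pull] and
    [subst2]. *)
Definition is_ev f e := forall n, O n (e - ev_trunc n f).

Lemma is_ev_uniq f e e' : is_ev f e -> is_ev f e' -> e = e'.
Proof.
move=> fe fe'; apply/subr0_eq/O_sep => n.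
have -> : e - e' = (e - ev_trunc n f) - (e' - ev_trunc n f) by ring.
by apply: OB.
Qed.
Lemma is_evD f g e e' : is_ev f e -> is_ev g e' -> is_ev (f + g) (e + e').
Proof.
move=> fe ge' n; have -> : ev_trunc n (f + g) = ev_trunc n f + ev_trunc n g.
  rewrite -big_split; apply: eq_bigr => l _; rewrite -big_split; apply: eq_bigr => k _.
  by rewrite coef2D rmorphD mulrDl.
have -> : e + e' - (ev_trunc n f + ev_trunc n g) = (e - ev_trunc n f) + (e' - ev_trunc n g) by ring.
by apply: OD.
Qed.

Let P n f : {poly {poly C}} := \poly_(l < n) \poly_(k < n) coef2 f k l.
Let ea : {poly C} -> T := fun q => (map_poly iota q).[a].
Let ee : {poly {poly C}} -> T := fun p => (map_poly ea p).[b].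
Let eaD : {morph ea : p q / p + q}.
Proof. by move=> p q; rewrite /ea rmorphD hornerD. Qed.
Let eaM : {morph ea : p q / p * q}.
Proof. by move=> p q; rewrite /ea rmorphM hornerM. Qed.
Let ea0 : ea 0 = 0. Proof. by rewrite /ea rmorph0 horner0. Qed.
Let ea1 : ea 1 = 1. Proof. by rewrite /ea rmorph1 hornerC. Qed.
Let eaE n (q : {poly C}) : (size q <= n)%N -> ea q = \sum_(k < n) iota q`_k * a ^+ k.
Proof.
move=> qn; rewrite /ea (@horner_coef_wide _ n); last first.
  exact: leq_trans (size_poly _ _) qn.
by apply: eq_bigr => i _; rewrite coef_map.
Qed.
Let eeE n (p : {poly {poly C}}) : (size p <= n)%N -> ee p = \sum_(l < n) ea p`_l * b ^+ l.
Proof.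
move=> pn; rewrite /ee (@horner_coef_wide _ n); last exact: leq_trans (size_poly _ _) pn.
by apply: eq_bigr => i _; rewrite coef_map_id0.
Qed.
Let eeD (p q : {poly {poly C}}) : ee (p + q) = ee p + ee q.
Proof.
set n := maxn (size p) (size q).
rewrite !(@eeE n) ?leq_maxl ?leq_maxr ?size_polyD // -big_split.
by apply: eq_bigr => l _; rewrite coefD eaD mulrDl.
Qed.
Let eeM (p q : {poly {poly C}}) : ee (p * q) = ee p * ee q.
Proof.
pose eam : {rmorphism {poly C} -> T} := HB.pack ea
  (GRing.isMonoidMorphism.Build _ _ ea (conj ea1 eaM))
  (GRing.isZmodMorphism.Build _ _ ea (fun p q => etrans (eaD p (- q)) (congr1 (+%R (ea p))
     (etrans (congr1 (fun z => z.[a]) (raddfN (map_poly iota) q)) (hornerN _ _))))).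
have E r : ee r = (map_poly eam r).[b] by [].
by rewrite !E rmorphM hornerM.
Qed.
Let eeP n f : ee (P n f) = ev_trunc n f.
Proof.
rewrite (@eeE n) ?size_poly //; apply: eq_bigr => l _.
rewrite coef_poly ltn_ord (@eaE n) ?size_poly // mulr_suml; apply: eq_bigr => k _.
by rewrite coef_poly ltn_ord mulrA.
Qed.
Let ee_small n (p : {poly {poly C}}) : (forall k l, (k < n)%N -> (l < n)%N -> p`_l`_k = 0) -> O n
  (ee p).
Proof.
move=> p0; rewrite (@eeE (size p)) //; apply: Osum => l _.
have [ln|nl] := leqP n l.
  by apply: OMl; apply: O_le ln _; apply: OX.
rewrite (@eaE (size p`_l)) // mulr_suml; apply: Osum => k _.
have [kn|nk] := leqP n k.
  by apply: OMr; apply: OMl; apply: O_le kn _; apply: OX.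
by rewrite p0 // rmorph0 !mul0r.
Qed.

(** The product of the truncations and the truncation of the product, as polynomials in two
    variables, have the same coefficients in degrees below n in each variable; the other monomials
    take values in [O n]. *)
Lemma is_evM f g e e' : is_ev f e -> is_ev g e' -> is_ev (f * g) (e * e').
Proof.
move=> fe ge' n.
have -> : e * e' - ev_trunc n (f * g) = (e - ev_trunc n f) * e' +
    ev_trunc n f * (e' - ev_trunc n g) + (ev_trunc n f * ev_trunc n g - ev_trunc n (f * g)).
  by ring.
apply: OD; first by apply: OD; [apply: OMr|apply: OMl].
rewrite -!eeP -eeM.
have -> : ee (P n f * P n g) - ee (P n (f * g)) = ee (P n f * P n g - P n (f * g)).
  by apply/(canLR (addrK _)); rewrite -eeD subrK.
apply: ee_small => k l kn ln; rewrite coefB coefB; apply/eqP; rewrite subr_eq0; apply/eqP.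
rewrite coefM coef_sum [in RHS]coef_poly ln coef_poly kn coef2M.
apply: eq_bigr => j _; rewrite coefM; apply: eq_bigr => i _.
have jl := ltn_ord j; have ik := ltn_ord i.
have jn : (j < n)%N by lia.
have ljn : (l - j < n)%N by lia.
have in' : (i < n)%N by lia.
have kin : (k - i < n)%N by lia.
by rewrite !coef_poly jn ljn !coef_poly in' kin.
Qed.

Lemma is_ev_const c : is_ev (const2 c) (iota c).
Proof.
case=> [|n]; first exact: O_all.
rewrite /ev_trunc big_ord_recl big_ord_recl coef2C !expr0 mulr1 mulr1.
rewrite big1 => [|k _]; last by rewrite coef2C rmorph0 mul0r.
rewrite big1 ?addr0 ?subrr // => l _; rewrite big1 // => k _.
by rewrite coef2C andbF rmorph0 mul0r.
Qed.
Lemma is_evX : is_ev (varX R) a.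
Proof.
case=> [|[|n]]; first exact: O_all.
  by apply: OB => //; rewrite /ev_trunc !big_ord1 coef2X rmorph0 mul0r.
rewrite /ev_trunc big_ord_recl (bigD1 (Ordinal (isT : 1 < n.+2)%N)) //= coef2X rmorph1.
rewrite mul1r expr1 mulr1 big1 => [|k]; last first.
  by rewrite -val_eqE /= coef2X => /negPf ->; rewrite rmorph0 mul0r.
rewrite addr0 big1 ?addr0 ?subrr // => l _; rewrite big1 // => k _.
by rewrite coef2X andbF rmorph0 mul0r.
Qed.
Lemma is_evY : is_ev (varY R) b.
Proof.
case=> [|[|n]]; first exact: O_all.
  by apply: OB => //; rewrite /ev_trunc !big_ord1 coef2Y rmorph0 mul0r.
rewrite /ev_trunc (bigD1 (Ordinal (isT : 1 < n.+2)%N)) //= big_ord_recl coef2Y rmorph1.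
rewrite !mul1r expr1 big1 => [|k _]; last by rewrite coef2Y rmorph0 mul0r.
rewrite addr0 big1 ?addr0 ?subrr // => l; rewrite -val_eqE /= => /negPf l1.
by rewrite big1 // => k _; rewrite coef2Y l1 andbF rmorph0 mul0r.
Qed.

(** A derivation that loses at most one step of the filtration can be computed on truncations. It is
    applied to [dx], [dy] and the derivative of one-variable series. *)
Lemma is_ev_chain (delta : T -> T) :
  {morph delta : x y / x + y} ->
  (forall x y, delta (x * y) = delta x * y + x * delta y) ->
  (forall c, delta (iota c) = 0) ->
  (forall n x, O n.+1 x -> O n (delta x)) ->
  forall f e ex ey, is_ev f e -> is_ev (dx f) ex -> is_ev (dy f) ey ->
  delta e = ex * delta a + ey * delta b.
Proof.
move=> dD dM dC dO f e ex ey fe fx fy.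
have d0 : delta 0 = 0 by have := dC 0; rewrite rmorph0.
have dN x : delta (- x) = - delta x by apply/eqP; rewrite -addr_eq0 -dD addNr d0.
have dX x n : delta (x ^+ n) = (x ^+ n.-1 *+ n) * delta x.
  elim: n => [|n IH]; first by rewrite mulr0n mul0r expr0 -(rmorph1 iota) dC.
  rewrite exprS dM IH; case: n {IH} => [|n] /=; first by rewrite !expr0; ring.
  by rewrite [x * _]mulrA mulrnAr -exprS [X in _ = X * _]mulrS mulrDl [delta x * _]mulrC.
have dS (I : finType) (F : I -> T) : delta (\sum_i F i) = \sum_i delta (F i).
  by apply: big_morph => //.
apply/subr0_eq/O_sep => n.
(* The truncation of f goes one degree further than those of its partial derivatives, so that
   [delta] still leaves an error in [O n]. *)
have -> : delta e - (ex * delta a + ey * delta b) = delta (e - ev_trunc n.+1 f)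
    - (ex - ev_trunc n (dx f)) * delta a - (ey - ev_trunc n (dy f)) * delta b
    + (delta (ev_trunc n.+1 f) - ev_trunc n (dx f) * delta a - ev_trunc n (dy f) * delta b).
  by rewrite dD dN; ring.
apply: OD; first by apply: OB; [apply: OB; [exact: dO|exact: OMr]|exact: OMr].
have dt : delta (ev_trunc n.+1 f) = \sum_(l < n.+1) \sum_(k < n.+1)
    iota (coef2 f k l) * (a ^+ k.-1 *+ k * b ^+ l) * delta a +
    \sum_(l < n.+1) \sum_(k < n.+1) iota (coef2 f k l) * (a ^+ k * (b ^+ l.-1 *+ l)) * delta b.
  rewrite dS -big_split; apply: eq_bigr => l _; rewrite dS -big_split; apply: eq_bigr => k _.
  by rewrite dM dC dM !dX /=; ring.
rewrite dt -addrA -opprD opprD addrACA; apply: OD.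
  have -> : ev_trunc n (dx f) * delta a = \sum_(l < n) \sum_(k < n.+1)
      iota (coef2 f k l) * (a ^+ k.-1 *+ k * b ^+ l) * delta a.
    rewrite mulr_suml; apply: eq_bigr => l _; rewrite mulr_suml big_ord_recl mulr0n mul0r mulr0
      mul0r add0r.
    apply: eq_bigr => k _; rewrite coef2_deriv_x /= rmorphMn /bump /=.
    by congr (_ * _); rewrite !add0n ?add1n !mulrnAl mulrnAr.
  rewrite big_ord_recr /= addrAC subrr add0r; apply: Osum => k _.
  by apply: OMr; apply: OMl; apply: OMl; apply: OX.
have -> : ev_trunc n (dy f) * delta b = \sum_(l < n.+1) \sum_(k < n)
      iota (coef2 f k l) * (a ^+ k * (b ^+ l.-1 *+ l)) * delta b.
  rewrite big_ord_recl big1 ?add0r => [|k _]; last by rewrite mulr0n !mulr0 mul0r.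
  rewrite mulr_suml; apply: eq_bigr => l _; rewrite mulr_suml.
  apply: eq_bigr => k _; rewrite coef2_deriv_y /= rmorphMn /bump /=.
  by congr (_ * _); rewrite !add0n ?add1n !mulrnAl !mulrnAr.
rewrite -sumrB; apply: Osum => l _; rewrite big_ord_recr /= addrAC subrr add0r.
by apply: OMr; apply: OMl; apply: OMr; apply: OX.
Qed.
End Evaluation.

(** This is why substitutions compose: a ring morphism compatible with the filtrations sends
    truncations to truncations. *)
Lemma is_ev_map (R : realType) (T T' : comNzRingType) (O : nat -> T -> Prop)
    (O' : nat -> T' -> Prop) (iota : {rmorphism complex R -> T})
    (iota' : {rmorphism complex R -> T'}) (h : T -> T') (a b : T) :
  {morph h : x y / x + y} -> {morph h : x y / x * y} -> h 1 = 1 ->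
  (forall c, h (iota c) = iota' c) -> (forall n x, O n x -> O' n (h x)) ->
  forall f e, is_ev O iota a b f e -> is_ev O' iota' (h a) (h b) f (h e).
Proof.
move=> hD hM h1 hC hO f e fe n.
have h0 : h 0 = 0 by rewrite -(rmorph0 iota) hC rmorph0.
have hN x : h (- x) = - h x by apply/eqP; rewrite -addr_eq0 -hD addNr h0.
have hX x k : h (x ^+ k) = h x ^+ k by elim: k => [//|k IH]; rewrite !exprS hM IH.
have := hO _ _ (fe n); rewrite hD hN; congr (O' _ (_ - _)).
rewrite (big_morph _ hD h0); apply: eq_bigr => l _.
by rewrite (big_morph _ hD h0); apply: eq_bigr => k _; rewrite !hM hC !hX.
Qed.

Lemma sum_ord_trunc (T : nmodType) (m n : nat) (F : nat -> T) :
  (m <= n)%N -> (forall i, (m <= i < n)%N -> F i = 0) ->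
  \sum_(i < n) F i = \sum_(i < m) F i.
Proof.
move=> mn F0; rewrite (big_ord_widen n F mn) [RHS]big_mkcond; apply: eq_bigr => i _.
by case: ltnP => // mi; rewrite F0 // mi ltn_ord.
Qed.

Lemma sum_ord2 (T : nmodType) (F : nat -> T) : \sum_(i < 2) F i = F 0%N + F 1%N.
Proof. by rewrite !big_ord_recl big_ord0 addr0. Qed.

Section Pull.
Variable R : realType.
Notation C := (complex R).
Implicit Types (f g u v : series2 R) (gam : fps C * fps C) (p q t : fps C).

Definition z0 gam := coefs gam.1 0 = 0 /\ coefs gam.2 0 = 0.

Lemma z0_vg gam k l : z0 gam -> vg (k + l) (gam.1 ^+ k * gam.2 ^+ l).
Proof.
by case=> /vg1 p0 /vg1 q0; apply: vgM; rewrite -[X in vg X]mul1n; apply: vg_exp.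
Qed.

Lemma pull_coefs f gam n : coefs (pull f gam) n =
  \sum_(k < n.+1) \sum_(l < n.+1) coef2 f k l * coefs (gam.1 ^+ k * gam.2 ^+ l) n.
Proof. by []. Qed.
Lemma subst2_coefs f u v i j : coef2 (subst2 f u v) i j =
  \sum_(k < (i + j).+1) \sum_(l < (i + j).+1) coef2 f k l * coef2 (u ^+ k * v ^+ l) i j.
Proof. by []. Qed.

Opaque pull subst2 fps_mul.

Lemma pull_ev gam f : z0 gam ->
  is_ev (@vg C) (@fps_const C) gam.1 gam.2 f (pull f gam).
Proof.
move=> gam0 n m mn; rewrite coefsB; apply/eqP; rewrite subr_eq0; apply/eqP.
rewrite coefs_sum pull_coefs exchange_big.
pose F k l := coef2 f k l * coefs (gam.1 ^+ k * gam.2 ^+ l) m.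
have F0 k l : (m < k + l)%N -> F k l = 0 by move=> mkl; rewrite /F z0_vg ?mulr0.
rewrite (eq_bigr (fun l : 'I_n => \sum_(k < n) F k l)) => [|l _]; last first.
  by rewrite coefs_sum; apply: eq_bigr => k _; rewrite coefsCM.
rewrite (@sum_ord_trunc _ m.+1 n (fun l => \sum_(k < n) F k l)) // => [|l lm].
  apply: eq_bigr => l _; rewrite (@sum_ord_trunc _ m.+1 n (fun k => F k l)) // => k km.
  by apply: F0; lia.
by apply: big1 => k _; apply: F0; lia.
Qed.

Let isev_uniq gam f e : z0 gam -> 
  is_ev (@vg C) (@fps_const C) gam.1 gam.2 f e -> pull f gam = e.
Proof.
move=> gam0 fe; apply: is_ev_uniq (pull_ev f gam0) fe => //.
- by move=> *; apply: vgB.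
- exact: vg_sep.
Qed.

Lemma pullD gam f g : z0 gam -> pull (f + g) gam = pull f gam + pull g gam.
Proof.
move=> gam0; apply: isev_uniq => //; apply: is_evD; try exact: pull_ev.
- by move=> *; apply: vgB.
- exact: vgz.
Qed.
Lemma pullM gam f g : z0 gam -> pull (f * g) gam = pull f gam * pull g gam.
Proof.
move=> gam0; have [p0 q0] := gam0; apply: isev_uniq => //; apply: is_evM; try exact: pull_ev.
- by move=> *; apply: vgB.
- exact: vg0.
- by move=> m n a; apply: vg_le.
- exact: vgz.
- by move=> *; apply: vgM.
- exact: vg1.
- exact: vg1.
Qed.
Lemma pullC gam c : z0 gam -> pull (const2 c) gam = fps_const c.
Proof.
move=> gam0; apply: isev_uniq => //; apply: is_ev_const => //.
exact: vgz.
Qed.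
Lemma pullX gam : z0 gam -> pull (varX R) gam = gam.1.
Proof.
move=> gam0; apply: isev_uniq => //.
apply: (@is_evX R (fps C) (@vg C) _ _ _ (@fps_const C) gam.1 gam.2) => //.
- by move=> *; apply: vgB.
- exact: vgz.
- exact: vg1 gam0.1.
Qed.
Lemma pullY gam : z0 gam -> pull (varY R) gam = gam.2.
Proof.
move=> gam0; apply: isev_uniq => //.
apply: (@is_evY R (fps C) (@vg C) _ _ _ (@fps_const C) gam.1 gam.2) => //.
- by move=> *; apply: vgB.
- exact: vgz.
- exact: vg1 gam0.2.
Qed.
Lemma pull1 gam : z0 gam -> pull (1 : series2 R) gam = 1.
Proof. exact: (pullC 1). Qed.

Definition pullm gam of z0 gam : series2 R -> fps C := fun f => pull f gam.
Fact pullm_additive gam (h : z0 gam) : zmod_morphism (pullm h).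
Proof. by move=> f g; rewrite /pullm -[in RHS](subrK g f) (pullD (f - g) g h) addrK. Qed.
Fact pullm_multiplicative gam (h : z0 gam) : monoid_morphism (pullm h).
Proof. by split=> [|f g]; rewrite /pullm ?pull1 ?pullM. Qed.
HB.instance Definition _ gam h :=
  GRing.isZmodMorphism.Build (series2 R) (fps C) (@pullm gam h) (pullm_additive h).
HB.instance Definition _ gam h :=
  GRing.isMonoidMorphism.Build (series2 R) (fps C) (@pullm gam h) (pullm_multiplicative h).
Lemma pullE gam (h : z0 gam) f : pull f gam = pullm h f. Proof. by []. Qed.
Lemma pull_z gam : z0 gam -> pull (0 : series2 R) gam = 0.
Proof. by move=> h; rewrite (pullE h) rmorph0. Qed.
Lemma pullN gam f : z0 gam -> pull (- f) gam = - pull f gam.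
Proof. by move=> h; rewrite !(pullE h) rmorphN. Qed.
Lemma pullB gam f g : z0 gam -> pull (f - g) gam = pull f gam - pull g gam.
Proof. by move=> h; rewrite !(pullE h) rmorphB. Qed.
Lemma pullXn gam f n : z0 gam -> pull (f ^+ n) gam = pull f gam ^+ n.
Proof. by move=> h; rewrite !(pullE h) rmorphXn. Qed.
Lemma pull_coef0 gam f : coefs (pull f gam) 0 = coef2 f 0 0.
Proof. by rewrite pull_coefs !big_ord1 !expr0 mulr1 coefs1 mulr1. Qed.
Lemma pull_coef1 gam f : z0 gam ->
  coefs (pull f gam) 1 = coef2 f 1 0 * coefs gam.1 1 + coef2 f 0 1 * coefs gam.2 1.
Proof.
move=> h; rewrite pull_coefs !big_ord_recl !big_ord0 !addr0 /lift /bump [nat_of_ord _]/= !expr0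
  !expr1.
rewrite !mul1r !mulr1 coefs1 mulr0 add0r [X in _ + (_ + _ * X)](_ : _ = 0) ?mulr0 ?addr0.
  by rewrite addrC.
by rewrite coefsM1 h.1 h.2 mul0r mulr0 addr0.
Qed.
Lemma pull_vg a n gam f : z0 gam -> vg a gam.1 -> vg a gam.2 -> vg2 n f ->
  vg (a * n) (pull f gam).
Proof.
move=> h p0 q0 fn m mn; rewrite pull_coefs big1 // => k _; rewrite big1 // => l _.
have [kl|kl] := ltnP (k + l) n; first by rewrite fn ?mul0r.
rewrite (_ : coefs _ _ = 0) ?mulr0 //.
have : vg (a * (k + l)) (gam.1 ^+ k * gam.2 ^+ l) by rewrite mulnDr; apply: vgM; apply: vg_exp.
by apply; apply: leq_trans mn _; rewrite leq_mul2l kl orbT.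
Qed.
Lemma pull_congr k gam gam' f : z0 gam -> z0 gam' ->
  vg k (gam.1 - gam'.1) -> vg k (gam.2 - gam'.2) -> vg k (pull f gam - pull f gam').
Proof.
move=> h h' pk qk n nk; rewrite coefsB [X in X - _]pull_coefs [X in _ - X]pull_coefs.
rewrite -[LHS]sumrB; apply: big1 => i _; rewrite -[LHS]sumrB; apply: big1 => j _.
rewrite -mulrBr -coefsB (_ : coefs _ _ = 0) ?mulr0 //; suff : vg k (gam.1 ^+ i * gam.2 ^+ j -
  gam'.1 ^+ i * gam'.2 ^+ j) by apply.
have vX p q l : vg k (p - q) -> vg k (p ^+ l - q ^+ l).
  by move=> pq; rewrite subrXX -[k]addn0; apply: vgM.
rewrite (_ : _ - _ = (gam.1 ^+ i - gam'.1 ^+ i) * gam.2 ^+ j +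
   gam'.1 ^+ i * (gam.2 ^+ j - gam'.2 ^+ j)); last by ring.
by apply: vgD; [rewrite -[k]addn0|rewrite -[k]add0n]; apply: vgM => //; apply: vX.
Qed.

Lemma pull_deriv gam f : z0 gam -> fps_deriv (pull f gam) =
  pull (dx f) gam * fps_deriv gam.1 + pull (dy f) gam * fps_deriv gam.2.
Proof.
move=> gam0; have [p0 q0] := gam0.
apply: (@is_ev_chain R _ (@vg C) _ _ _ _ _ (@fps_const C) gam.1 gam.2 _ _ _ _ _ _ _ f);
  try exact: pull_ev.
- by move=> *; apply: vgB.
- exact: vg_sep.
- exact: vg0.
- exact: vgz.
- by move=> *; apply: vgM.
- exact: vg1.
- exact: vg1.
- exact: fderivD.
- exact: fderivM.
- exact: fderivC.
- exact: vg_deriv.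
Qed.

Lemma vg2_uv u v k l : coef2 u 0 0 = 0 -> coef2 v 0 0 = 0 -> vg2 (k + l) (u ^+ k * v ^+ l).
Proof.
move=> /vg2_1 u0 /vg2_1 v0; apply: vg2M.
  by elim: k => // k IH; rewrite exprS -add1n; apply: vg2M.
by elim: l => // l IH; rewrite exprS -add1n; apply: vg2M.
Qed.

Lemma subst2_ev f u v : coef2 u 0 0 = 0 -> coef2 v 0 0 = 0 ->
  is_ev (@vg2 R) (@const2 R) u v f (subst2 f u v).
Proof.
move=> u0 v0 n i j mn; rewrite coef2B; apply/eqP; rewrite subr_eq0; apply/eqP.
rewrite coef2_sum subst2_coefs exchange_big.
pose F k l := coef2 f k l * coef2 (u ^+ k * v ^+ l) i j.
have F0 k l : (i + j < k + l)%N -> F k l = 0 by move=> mkl; rewrite /F vg2_uv ?mulr0.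
rewrite (eq_bigr (fun l : 'I_n => \sum_(k < n) F k l)) => [|l _]; last first.
  by rewrite coef2_sum; apply: eq_bigr => k _; rewrite /coef2 !coefsCM.
rewrite (@sum_ord_trunc _ (i + j).+1 n (fun l => \sum_(k < n) F k l)) // => [|l lm].
  apply: eq_bigr => l _; rewrite (@sum_ord_trunc _ (i + j).+1 n (fun k => F k l)) // => k km.
  by apply: F0; lia.
by apply: big1 => k _; apply: F0; lia.
Qed.
Let sub_uniq f u v e : coef2 u 0 0 = 0 -> coef2 v 0 0 = 0 ->
  is_ev (@vg2 R) (@const2 R) u v f e -> subst2 f u v = e.
Proof.
move=> u0 v0 fe; apply: is_ev_uniq (subst2_ev f u0 v0) fe => //.
- by move=> *; apply: vg2B.
- exact: vg2_sep.
Qed.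
Lemma subst2M f g u v : coef2 u 0 0 = 0 -> coef2 v 0 0 = 0 ->
  subst2 (f * g) u v = subst2 f u v * subst2 g u v.
Proof.
move=> u0 v0; apply: sub_uniq => //; apply: is_evM; try exact: subst2_ev.
- by move=> *; apply: vg2B.
- exact: vg2_0.
- by move=> m n a; apply: vg2_le.
- exact: vg2z.
- by move=> *; apply: vg2M.
- exact: vg2_1.
- exact: vg2_1.
Qed.
Let subst2_chain (delta : series2 R -> series2 R) f u v (e1 e2 : series2 R) :
  {morph delta : x y / x + y} ->
  (forall x y, delta (x * y) = delta x * y + x * delta y) ->
  (forall c, delta (const2 c) = 0) ->
  (forall n x, vg2 n.+1 x -> vg2 n (delta x)) ->
  coef2 u 0 0 = 0 -> coef2 v 0 0 = 0 ->
  delta (subst2 f u v) = subst2 (dx f) u v * delta u + subst2 (dy f) u v * delta v.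
Proof.
move=> dD dM dC dO u0 v0.
apply: (@is_ev_chain R _ (@vg2 R) _ _ _ _ _ (@const2 R) u v _ _ delta _ _ _ _ f) => //;
  try exact: subst2_ev.
- by move=> *; apply: vg2B.
- exact: vg2_sep.
- exact: vg2z.
- by move=> *; apply: vg2M.
- exact: vg2_1.
- exact: vg2_1.
Qed.
Lemma subst2_dx f u v : coef2 u 0 0 = 0 -> coef2 v 0 0 = 0 ->
  dx (subst2 f u v) = subst2 (dx f) u v * dx u + subst2 (dy f) u v * dx v.
Proof.
apply: (subst2_chain f 0 0); [exact: dxD|exact: dxM|exact: dxC|exact: vg2_dx].
Qed.
Lemma subst2_dy f u v : coef2 u 0 0 = 0 -> coef2 v 0 0 = 0 ->
  dy (subst2 f u v) = subst2 (dx f) u v * dy u + subst2 (dy f) u v * dy v.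
Proof.
apply: (subst2_chain f 0 0); [exact: dyD|exact: dyM|exact: dyC|exact: vg2_dy].
Qed.
Lemma pull_z0 gam u v : coef2 u 0 0 = 0 -> coef2 v 0 0 = 0 -> z0 (pull u gam, pull v gam).
Proof. by move=> u0 v0; split; rewrite pull_coef0. Qed.
Lemma pull_subst2 gam f u v : z0 gam -> coef2 u 0 0 = 0 -> coef2 v 0 0 = 0 ->
  pull (subst2 f u v) gam = pull f (pull u gam, pull v gam).
Proof.
move=> h u0 v0; apply/esym/isev_uniq; first exact: pull_z0.
apply: (@is_ev_map R _ _ (@vg2 R) (@vg C) (@const2 R) (@fps_const C) (fun f => pull f gam));
  last exact: subst2_ev.
- by move=> x y; apply: pullD.
- by move=> x y; apply: pullM.
- exact: pull1.
- by move=> c; apply: pullC.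
by move=> n x xn; rewrite -[n]mul1n; apply: pull_vg => //; apply: vg1; case: h.
Qed.
Lemma subst2_coef00 f u v : coef2 (subst2 f u v) 0 0 = coef2 f 0 0.
Proof. by rewrite subst2_coefs !big_ord1 !expr0 mulr1 coef21 mulr1. Qed.
Lemma subst2_coef1 f u v i j : (i + j = 1)%N -> coef2 u 0 0 = 0 -> coef2 v 0 0 = 0 ->
  coef2 (subst2 f u v) i j = coef2 f 1 0 * coef2 u i j + coef2 f 0 1 * coef2 v i j.
Proof.
move=> ij u0 v0; rewrite subst2_coefs ij.
have uv0 : coef2 (u * v) i j = 0 by apply: (vg2M (vg2_1 u0) (vg2_1 v0)); rewrite ij.
have c1 : coef2 (1 : series2 R) i j = 0 by rewrite coef21; case: i j ij {uv0} => [|i] [|j].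
rewrite (sum_ord2 (fun k => \sum_(l < 2) coef2 f k l * coef2 (u ^+ k * v ^+ l) i j)).
rewrite [X in X + _ = _](sum_ord2 (fun l => coef2 f 0 l * coef2 (u ^+ 0 * v ^+ l) i j)).
rewrite [X in _ + X = _](sum_ord2 (fun l => coef2 f 1 l * coef2 (u ^+ 1 * v ^+ l) i j)).
by rewrite !expr0 !expr1 !mul1r !mulr1 c1 uv0 !mulr0 add0r addr0 addrC.
Qed.

(** The composite p(t), viewed as the pullback of a series in x alone so as to inherit the
    properties of [pull]. *)
Definition comp1 t p : fps C := pull (fps_const p : series2 R) (t, 0).
Lemma coef2_fps_const p i j :
  coef2 (fps_const p : series2 R) i j = if j is 0 then coefs p i else 0.
Proof. by rewrite /coef2; case: j => [|j] //; rewrite coefs0. Qed.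
Lemma pull_fps_const p gam : z0 gam -> pull (fps_const p) gam = comp1 gam.1 p.
Proof.
move=> gam0; apply: fpsP => n; rewrite /comp1 [LHS]pull_coefs [RHS]pull_coefs.
apply: eq_bigr => k _; rewrite [LHS]big_ord_recl [RHS]big_ord_recl.
have S0 (y : fps C) : \sum_(i < n) coef2 (fps_const p : series2 R) k (lift ord0 i) *
    coefs (gam.1 ^+ k * y ^+ lift ord0 i) n = 0.
  by apply: big1 => i _; rewrite coef2_fps_const mul0r.
rewrite [X in _ + X = _]S0 [X in _ = _ + X]S0 [LHS]addr0 [RHS]addr0.
exact: erefl.
Qed.

Lemma comp1_coefs t p n : coefs (comp1 t p) n = \sum_(k < n.+1) coefs p k * coefs (t ^+ k) n.
Proof.
rewrite [LHS]pull_coefs; apply: eq_bigr => k _; rewrite [LHS]big_ord_recl.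
have S0 : \sum_(i < n) coef2 (fps_const p : series2 R) k (lift ord0 i) *
    coefs (t ^+ k * 0 ^+ lift ord0 i) n = 0.
  by apply: big1 => i _; rewrite coef2_fps_const mul0r.
by rewrite [X in _ + X = _]S0 [LHS]addr0 coef2_fps_const expr0 mulr1.
Qed.

Lemma comp1_z0 t : coefs t 0 = 0 -> z0 (t, 0).
Proof. by split; rewrite ?coefs0. Qed.
Lemma comp1X t : coefs t 0 = 0 -> comp1 t fps_X = t.
Proof. by move=> /comp1_z0 h; apply: pullX. Qed.
Lemma comp1_vg t p n : coefs t 0 = 0 -> vg n p -> vg n (comp1 t p).
Proof.
move=> t0 pn; have h := comp1_z0 t0; rewrite -[n]mul1n.
apply: pull_vg => //; [exact: vg1|exact: vgz|].
move=> i [|j] ij; rewrite /coef2 coefsC ?coefs0 //; first last.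
  by case: i {ij}.
by rewrite addn0 in ij; apply: pn.
Qed.
Lemma comp1D t p q : coefs t 0 = 0 -> comp1 t (p + q) = comp1 t p + comp1 t q.
Proof. by move=> /comp1_z0 h; rewrite /comp1 rmorphD; apply: pullD. Qed.
Lemma comp1M t p q : coefs t 0 = 0 -> comp1 t (p * q) = comp1 t p * comp1 t q.
Proof. by move=> /comp1_z0 h; rewrite /comp1 rmorphM; apply: pullM. Qed.
Lemma comp1C t c : coefs t 0 = 0 -> comp1 t (fps_const c) = fps_const c.
Proof. by move=> /comp1_z0 h; apply: pullC. Qed.
Lemma comp1_1 t : coefs t 0 = 0 -> comp1 t 1 = 1.
Proof. exact: (comp1C 1). Qed.
Lemma comp1_coef0 t p : coefs (comp1 t p) 0 = coefs p 0.
Proof. by rewrite /comp1 pull_coef0. Qed.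
Lemma comp1Xn t p n : coefs t 0 = 0 -> comp1 t (p ^+ n) = comp1 t p ^+ n.
Proof. by move=> h; elim: n => [|n IH]; rewrite ?expr0 ?comp1_1 // !exprS comp1M // IH. Qed.
Lemma comp1_pull t f gam : coefs t 0 = 0 -> z0 gam ->
  comp1 t (pull f gam) = pull f (comp1 t gam.1, comp1 t gam.2).
Proof.
move=> t0 h; apply/esym/isev_uniq; first by split; rewrite comp1_coef0 ?h.1 ?h.2.
apply: (@is_ev_map R _ _ (@vg C) (@vg C) (@fps_const C) (@fps_const C) (comp1 t));
  last exact: pull_ev.
- by move=> x y; apply: comp1D.
- by move=> x y; apply: comp1M.
- exact: comp1_1.
- by move=> c; apply: comp1C.
by move=> n x; apply: comp1_vg.
Qed.
Lemma comp1A s t p : coefs s 0 = 0 -> coefs t 0 = 0 ->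
  comp1 s (comp1 t p) = comp1 (comp1 s t) p.
Proof.
move=> s0 t0; apply: etrans (comp1_pull (fps_const p) s0 (comp1_z0 t0)) _.
by apply: pull_fps_const; split; rewrite comp1_coef0 ?coefs0.
Qed.
(** With p = X^n p1 and p1(0) nonzero, p(t) = t^n p1(t) is a product of nonzero series. *)
Lemma comp1_neq0 t p : coefs t 0 = 0 -> t != 0 -> p != 0 -> comp1 t p != 0.
Proof.
move=> t0 tn /is_ord_ex [pn /vgE[p1 E]].
have p10 : coefs p1 0 != 0 by move: pn; rewrite {1}E coefsXnM ltnn subnn.
rewrite E comp1M // comp1Xn // comp1X // mulf_neq0 ?expf_neq0 //.
by apply: (@is_ord_neq0 _ _ 0); split=> //; rewrite comp1_coef0.
Qed.

Definition swap f : series2 R := Fps (fun j => Fps (fun i => coef2 f j i)).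
Lemma coef2_swap f i j : coef2 (swap f) i j = coef2 f j i.
Proof. by []. Qed.
Lemma swapK f : swap (swap f) = f.
Proof. exact: series2P. Qed.
Lemma swapM f g : swap (f * g) = swap f * swap g.
Proof. by apply: series2P => i j; rewrite coef2_swap !coef2M exchange_big. Qed.
Lemma pull_swap f p q : pull (swap f) (p, q) = pull f (q, p).
Proof.
apply: fpsP => n; rewrite [LHS]pull_coefs [RHS]pull_coefs [LHS]exchange_big.
apply: eq_bigr => l _; apply: eq_bigr => k _.
by rewrite coef2_swap mulrC [X in coefs X _]mulrC mulrC.
Qed.
End Pull.

Opaque pull subst2 comp1 swap fps_mul fps_add fps_opp fps_const fps_X fps_deriv.

(** * Weierstrass division *)

Section Weierstrass.
Variable R : realType.
Notation C := (complex R).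
Implicit Types (f g h a : series2 R).

(** The x-adic filtration: x^k divides h. *)
Let vx k h := forall j, vg k (coefs h j).
Definition ytail n h : series2 R := Fps (fun j => coefs h (j + n)).
Definition yhead n h : series2 R := Fps (fun j => if (j < n)%N then coefs h j else 0).

Let head_tau n h : h = yhead n h + varY R ^+ n * ytail n h.
Proof.
apply: fpsP => j; rewrite coefsD coefsXnM /=; case: ltnP => [_|nj]; first by rewrite addr0.
by rewrite add0r subnK.
Qed.

Let ytailB n a h : ytail n (a - h) = ytail n a - ytail n h.
Proof. by []. Qed.

(** Write f = [yhead n f] + y^n U with U a unit. The y-tail of h - a f vanishes exactly when A = a U
    is a fixed point of the map sending A to [ytail n h - ytail n (A * W)], which contracts
    x-adically since x divides W. *)
Lemma weierstrass_division f n h :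
  (forall j, (j < n)%N -> coef2 f 0 j = 0) -> coef2 f 0 n != 0 ->
  exists a r, h = a * f + r /\ forall j, (n <= j)%N -> coefs r j = 0.
Proof.
move=> f0 fn; pose U := ytail n f.
have uU : U \is a GRing.unit by rewrite series2_unitE.
pose W := U^-1 * yhead n f.
have vxM k a b : vx k a -> vx 1 b -> vx k.+1 (a * b).
  move=> ak b1 j; rewrite coefsM => m mk; rewrite coefs_sum big1 // => i _.
  by have := vgM (ak i) (b1 (j - i)%N); rewrite addn1; apply.
have vxMl a b : vx 1 b -> vx 1 (a * b) by move=> b1; apply: vxM b1 => j; apply: vg0.
have hd1 : vx 1 (yhead n f).
  by move=> j; apply: vg1; rewrite /yhead /=; case: ltnP => [/f0|_]; rewrite ?coefs0.
have W1 : vx 1 W by apply: vxMl.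
have [|||||A AE] := @contraction_fixpoint (series2 R) vx _ _ _ _ (fun A => ytail n h - ytail n (A *
  W)).
- by move=> k a b ak bk j; apply: vgB; [exact: ak|exact: bk].
- by move=> a an; apply: fpsP => j; rewrite coefs0; apply: vg_sep => k; apply: an.
- by move=> a j; apply: vg0.
- move=> u uP; exists (Fps (fun j => Fps (fun i => coefs (coefs (u i.+1) j) i))) => k j m mk.
  rewrite coefsB; elim: k mk => // k IH; rewrite ltnS leq_eqVlt => /predU1P[->|mk].
    exact: subrr.
  have /eqP := uP k j m mk; rewrite coefsB subr_eq0 => /eqP E.
  by rewrite [X in _ - X]E; exact: IH.
- move=> k a b ab j; rewrite (_ : _ - _ = ytail n ((b - a) * W)); last first.
    by rewrite opprB addrC addrA subrK -ytailB -mulrBl.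
  apply: vxM => // i; rewrite -opprB coefsN; apply: vgN; exact: ab.
pose a := A * U^-1; exists a, (h - a * f); split; first by rewrite addrC subrK.
have E : h - a * f = (yhead n h - yhead n (A * W))
     + varY R ^+ n * (ytail n h - ytail n (A * W) - A).
  rewrite {1}(head_tau n h) {1}(head_tau n f) -/U.
  have aU : a * U = A by rewrite /a mulrVK.
  have {1}-> : a * (yhead n f + varY R ^+ n * U) = A * W + varY R ^+ n * A.
    by rewrite mulrDr mulrCA aU /W mulrA.
  by rewrite {1}(head_tau n (A * W)); ring.
move=> j nj; rewrite E AE subrr mulr0 addr0 coefsB /= ltnNge nj; exact: subrr.
Qed.

Lemma pull_sum (I : Type) (r : seq I) (P : pred I) (F : I -> series2 R) gam : z0 gam ->
  pull (\sum_(i <- r | P i) F i) gam = \sum_(i <- r | P i) pull (F i) gam.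
Proof. by move=> gam0; rewrite (pullE gam0) rmorph_sum. Qed.

Definition comp1m (t : fps C) of coefs t 0 = 0 : fps C -> fps C := comp1 t.
Fact comp1m_additive (t : fps C) (t0 : coefs t 0 = 0) : zmod_morphism (comp1m t0).
Proof. by move=> f g; rewrite /comp1m -[in RHS](subrK g f) (comp1D (f - g) g t0) addrK. Qed.
Fact comp1m_multiplicative (t : fps C) (t0 : coefs t 0 = 0) : monoid_morphism (comp1m t0).
Proof. by split=> [|f g]; rewrite /comp1m ?comp1_1 ?comp1M. Qed.
HB.instance Definition _ t t0 :=
  GRing.isZmodMorphism.Build (fps C) (fps C) (@comp1m t t0) (comp1m_additive t0).
HB.instance Definition _ t t0 :=
  GRing.isMonoidMorphism.Build (fps C) (fps C) (@comp1m t t0) (comp1m_multiplicative t0).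
Lemma comp1E (t : fps C) (t0 : coefs t 0 = 0) (p : fps C) : comp1 t p = comp1m t0 p. Proof. by [].
  Qed.

Lemma series2_poly_sum n h : (forall j, (n <= j)%N -> coefs h j = 0) ->
  h = \sum_(j < n) fps_const (coefs h j) * varY R ^+ j.
Proof.
move=> h0; apply: fpsP => j; rewrite coefs_sum.
have E (i : 'I_n) : coefs (fps_const (coefs h i) * varY R ^+ i) j =
    if (i == j :> nat) then coefs h j else 0.
  by rewrite coefsCM coefsXn eq_sym; case: eqP => [<-|_]; rewrite ?mulr1 ?mulr0.
rewrite (eq_bigr _ (fun i _ => E i)) -big_mkcond.
have [jn|nj] := ltnP j n; first by rewrite (big_pred1 (Ordinal jn)).
rewrite big1 ?h0 // => i /eqP ij; have := ltn_ord i; by rewrite ij ltnNge nj.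
Qed.

Lemma pull_poly_sum n h gam : z0 gam -> (forall j, (n <= j)%N -> coefs h j = 0) ->
  pull h gam = \sum_(j < n) comp1 gam.1 (coefs h j) * gam.2 ^+ j.
Proof.
move=> gam0 /series2_poly_sum {1}->; rewrite (pull_sum _ _ _ gam0).
by apply: eq_bigr => j _; rewrite (pullM _ _ gam0) (pullXn _ _ gam0) (pullY gam0) (pull_fps_const _
  gam0).
Qed.

(** So 1, t, ..., t^(n-1) generate C[[t]] over C[[p]]: divide h(y) by p(y) - x, of order n in y, and
    substitute x = p(t), y = t. *)
Lemma fps_module_decomp (p h : fps C) n : is_ord p n -> (0 < n)%N ->
  exists r : nat -> fps C, h = \sum_(i < n) comp1 p (r i) * fps_X ^+ i.
Proof.
move=> [pn p0] n0; have pz : coefs p 0 = 0 by apply: p0.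
pose liftY q : series2 R := Fps (fun j => fps_const (coefs q j)).
have gam0 : z0 (p, fps_X : fps C) by [].
have lift2 q i j : coef2 (liftY q) i j = if i == 0%N then coefs q j else 0.
  by rewrite /coef2 /= -coefsC.
have liftP q : pull (liftY q) (p, fps_X) = q.
  apply: fpsP => m; rewrite [LHS]pull_coefs big_ord_recl [X in _ + X]big1 => [|k _]; last first.
    by rewrite big1 // => l _; rewrite lift2 mul0r.
  rewrite addr0 (bigD1 ord_max) // big1 => [|l lm]; last first.
    rewrite expr0 mul1r coefsXn (_ : (m == l :> nat) = false) ?mulr0 //.
    by apply: contra_neqF lm => /eqP ml; apply: val_inj.
  by rewrite [LHS]addr0 expr0 mul1r coefsXn eqxx mulr1 lift2.
clearbody liftY; have [||a [r [E r0]]] := @weierstrass_division (liftY p - varX R) n (liftY h).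
- by move=> j jn; rewrite coef2B lift2 coef2X p0 // subrr.
- by rewrite coef2B lift2 coef2X subr0.
exists (coefs r); rewrite -(pull_poly_sum gam0 r0) -[LHS]liftP E (pullD _ _ gam0).
by rewrite (pullM _ _ gam0) (pullB _ _ gam0) liftP (pullX gam0) subrr mulr0 add0r.
Qed.

Let toS (P : {poly fps C}) : series2 R := Fps (fun j => P`_j).
Let toS0 (P : {poly fps C}) j : (size P <= j)%N -> coefs (toS P) j = 0.
Proof. exact: nth_default. Qed.
Let pull_toS (P : {poly fps C}) gam (gam0 : z0 gam) :
  pull (toS P) gam = (map_poly (comp1m gam0.1) P).[gam.2].
Proof.
rewrite (pull_poly_sum gam0 (@toS0 P)) (@horner_coef_wide _ (size P)) ?size_poly //.
by apply: eq_bigr => j _; rewrite coef_map.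
Qed.

(* Cayley-Hamilton for multiplication by q on C[[t]] over C[[p]]. *)
Lemma pull_kernel_monic (p q : fps C) n : is_ord p n -> (0 < n)%N -> coefs q 0 = 0 ->
  exists chi : series2 R, [/\ pull chi (p, q) = 0, coef2 chi 0 n = 1
    & forall j, (n < j)%N -> coefs chi j = 0].
Proof.
case: n => // n pn _ qz.
have gam0 : z0 (p, q) by split => //; case: pn => _; apply.
have pz := gam0.1; simpl in pz.
have /choice[r rE] : forall i : nat, exists r : nat -> fps C,
    q * fps_X ^+ i = \sum_(j < n.+1) comp1 p (r j) * fps_X ^+ j.
  by move=> i; apply: fps_module_decomp.
pose M : 'M[fps C]_n.+1 := \matrix_(i, j) r i j.
pose v : 'cV[fps C]_n.+1 := \col_j fps_X ^+ j.
pose cm := comp1m gam0.1.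
have Mv : map_mx cm M *m v = q *: v.
  apply/matrixP => i j; rewrite !mxE rE; apply: eq_bigr => k _.
  by rewrite !mxE.
have act (P : {poly fps C}) : map_mx cm (horner_mx M P) *m v = (map_poly cm P).[q] *: v.
  elim/poly_ind: P => [|P c IH].
    by rewrite !rmorph0 horner0 scale0r; apply: mul0mx.
  rewrite !rmorphD !rmorphM /= horner_mx_X horner_mx_C map_polyX map_polyC hornerMXaddC.
  rewrite mulmxDl -mulmxA Mv -scalemxAr IH scalerA scalerDl mulrC; congr (_ + _).
  by rewrite map_scalar_mx mul_scalar_mx.
exists (toS (char_poly M)); split.
- have /matrixP/(_ ord0 ord0) := act (char_poly M).
  rewrite Cayley_Hamilton map_mx0 mul0mx !mxE mulr1 => E.
  by rewrite (pull_toS _ gam0) -E.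
- have /monicP := char_poly_monic M; rewrite /lead_coef size_char_poly /= => E.
  by rewrite /coef2 /toS [coefs _ n.+1]/= E coefs1.
- by move=> j nj; apply: toS0; rewrite size_char_poly.
Qed.
End Weierstrass.

Lemma det_mul_eq0 (K : comNzRingType) n (A B : 'M[K]_n) : \det A = 0 -> \det (A *m B) = 0.
Proof. by move=> A0; rewrite det_mulmx A0 mul0r. Qed.

(** * Parametrizations of irreducible germs *)

Section PuiseuxGenerates.
Variable R : realType.
Notation C := (complex R).
Implicit Types (f g : series2 R) (gam : fps C * fps C).

Lemma complex_prim_root n : (0 < n)%N -> exists z : C, n.-primitive_root z.
Proof.
move=> n0; pose p : {poly C} := 'X^n - 1; have [r Dp] := closed_field_poly_normal p.
rewrite (monicP _) ?monicXnsubC // scale1r in Dp.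
have rn1 : all n.-unity_root r by apply/allP=> z; rewrite -root_prod_XsubC -Dp.
have sz_r : (n < (size r).+1)%N by rewrite -(size_prod_XsubC r id) -Dp size_XnsubC.
have [|z] := hasP (has_prim_root n0 rn1 _ sz_r); last by exists z.
by rewrite -separable_prod_XsubC -Dp separable_Xn_sub_1 // pnatr_eq0 -lt0n.
Qed.

Definition nz gam := gam.1 != 0 \/ gam.2 != 0.
(** The local ring of the branch, embedded in C[[t]], contains every series of large order, that is,
    it has a nonzero conductor. *)
Definition conductor gam := exists c, forall h, vg c h -> exists g : series2 R, pull g gam = h.
(* [gam] is a birational parametrization of the irreducible germ [f = 0]. *)
Definition gen f gam :=
  [/\ z0 gam, nz gam, forall h : series2 R, pull h gam = 0 <-> divides f h & conductor gam].

Section Core.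
Variables (n : nat) (phi : fps C).
Hypotheses (n0 : (0 < n)%N) (phi0 : coefs phi 0 = 0)
  (prim : forall d : nat, (d %| n)%N ->
          (forall i, coefs phi i != 0 -> (d %| i)%N) -> d = 1%N).

Let Xn0 : coefs (fps_X ^+ n : fps C) 0 = 0.
Proof. by rewrite coefsXn; case: n n0. Qed.
Let cn : {rmorphism fps C -> fps C} := comp1m Xn0.
Let gam := (fps_X ^+ n : fps C, phi).
Let gam0 : z0 gam. Proof. by split. Qed.

Let sX0 (z : C) : coefs (fps_const z * fps_X) 0 = 0.
Proof. by rewrite coefsCM (coefsXn _ 1) mulr0. Qed.
(** The substitution of z t for t; for z an n-th root of unity, it is the Galois action on C[[t]]
    over C[[t^n]]. *)
Let scl z : {rmorphism fps C -> fps C} := comp1m (sX0 z).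
Let sclE z p k : coefs (scl z p) k = z ^+ k * coefs p k.
Proof.
rewrite [LHS]comp1_coefs (bigD1 ord_max) // big1 => [|i ik]; last first.
  rewrite exprMn -rmorphXn coefsCM coefsXn (_ : (k == i :> nat) = false) ?mulr0 //.
  by apply: contra_neqF ik => /eqP ml; apply: val_inj.
by rewrite [LHS]addr0 exprMn -rmorphXn coefsCM coefsXn eqxx mulr1 mulrC.
Qed.

(** If the conjugates phi(zeta^i t) and phi(zeta^j t) agree, n divides (j - i) k for every exponent
    k of phi. Then n / gcd(n, j - i) divides n and all these exponents, hence is 1, and n divides j
    - i < n. *)
Let puiseux_det (zeta : C) (zP : n.-primitive_root zeta) :
  \det (Vandermonde n (\row_(i < n) scl (zeta ^+ i) phi)) != 0.
Proof.
rewrite det_Vandermonde; apply/prodf_neq0 => i _; apply/prodf_neq0 => j ij.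
rewrite !mxE subr_eq0; apply/eqP => E.
have dv k : coefs phi k != 0 -> (n %| (j - i) * k)%N.
  move=> pk; have /(congr1 (fun p => coefs p k)) := E; rewrite [X in X = _]sclE [X in _ = X]sclE =>
    /(mulIf pk).
  rewrite -!exprM => /eqP; rewrite (eq_prim_root_expr zP) eqn_mod_dvd; last first.
    by rewrite leq_mul2r (ltnW ij) orbT.
  by rewrite -mulnBl.
pose g := gcdn n (j - i); have g0 : (0 < g)%N by rewrite gcdn_gt0 n0.
have gn : (g %| n)%N by apply: dvdn_gcdl.
have gji : (g %| j - i)%N by apply: dvdn_gcdr.
have d1 : (n %/ g = 1)%N.
  apply: prim; first by rewrite -{2}(divnK gn) dvdn_mulr.
  move=> k /dv; rewrite -{1}(divnK gn) -{1}(divnK gji) -mulnA [(g * k)%N]mulnC mulnA.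
  rewrite (dvdn_pmul2r g0) Gauss_dvdr; first exact: id.
  by rewrite /coprime -(eqn_pmul2r g0) mul1n muln_gcdl (divnK gn) (divnK gji).
have := divnK gn; rewrite d1 mul1n => gE.
have : (n %| j - i)%N by rewrite -[X in (X %| _)%N]gE.
move/dvdn_leq; rewrite subn_gt0 ij => /(_ isT); have := ltn_ord j; lia.
Qed.

Let rep_phi j : exists r : nat -> fps C, phi ^+ j = \sum_(k < n) cn (r k) * fps_X ^+ k.
Proof. exact: fps_module_decomp (is_ordXn _ n) n0. Qed.

Let scl_cn (zeta : C) (zP : n.-primitive_root zeta) i (p : fps C) :
  scl (zeta ^+ i) (cn p) = cn p.
Proof.
apply: etrans (comp1A p (sX0 _) Xn0) _; congr (comp1 _ p).
rewrite comp1Xn ?sX0 // comp1X ?sX0 // exprMn -rmorphXn -exprM mulnC exprM.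
by rewrite (prim_expr_order zP) expr1n rmorph1 mul1r.
Qed.

(** Applying the n conjugations to a relation gives a row killed by the Vandermonde matrix of the
    conjugates of phi, whose determinant is nonzero. *)
Lemma puiseux_independent (r : 'I_n -> fps C) :
  \sum_(j < n) cn (r j) * phi ^+ j = 0 -> forall j, r j = 0.
Proof.
move=> r0; have [zeta zP] := complex_prim_root n0.
set V := Vandermonde n (\row_(i < n) scl (zeta ^+ i) phi).
have rV : (\row_j cn (r j)) *m V = 0.
  apply/rowP => i; rewrite mxE [RHS]mxE; have E := congr1 (scl (zeta ^+ i)) r0.
  rewrite rmorph_sum rmorph0 in E; apply: etrans E; apply: eq_bigr => j _.
  by rewrite mxE [X in _ * X]mxE [X in _ * X ^+ _]mxE rmorphM rmorphXn (scl_cn zP).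
have : (\det V) *: (\row_j cn (r j)) = 0.
  by rewrite -mul_mx_scalar -(mul_mx_adj V) mulmxA rV mul0mx.
move/rowP => E j; have := E j; rewrite !mxE => /eqP; rewrite mulf_eq0.
rewrite (negPf (puiseux_det zP)) => /eqP cr; apply/eqP; apply: contraTT (isT) => rj.
have := @comp1_neq0 R (fps_X ^+ n) (r j) Xn0 _ rj; rewrite (comp1E Xn0) -/cn cr eqxx.
by apply; rewrite expf_neq0 ?fpsX_neq0.
Qed.

(** Let P express the powers of phi in the basis t^k over C[[t^n]]. Its determinant is nonzero, P
    being a factor of the Vandermonde matrix of the conjugates. By the adjugate of P, the image of
    [pull] contains the products of det P, taken at t^n, with each t^k, hence all its multiples. *)
Lemma puiseux_conductor : conductor gam.
Proof.
have /choice[r rE] := rep_phi.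
pose P : 'M[fps C]_n := \matrix_(j, k) r j k.
have [zeta zP] := complex_prim_root n0.
have detP : \det P != 0.
  apply: contra_neq (puiseux_det zP) => dP.
  pose Z : 'M[fps C]_n := \matrix_(k, i) scl (zeta ^+ i) (fps_X ^+ k).
  have -> : Vandermonde n (\row_(i < n) scl (zeta ^+ i) phi) = map_mx cn P *m Z.
    apply/matrixP => j i; rewrite mxE [X in X ^+ _]mxE [RHS]mxE -rmorphXn rE rmorph_sum.
    apply: eq_bigr => k _; rewrite rmorphM (scl_cn zP).
    by rewrite [X in _ = X * _]mxE [X in _ = _ * X]mxE [X in _ = cn X * _]mxE.
  have Ed : \det (map_mx cn P) = 0 by rewrite det_map_mx dP; exact: rmorph0.
  exact: det_mul_eq0.
pose cd := cn (\det P).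
have cd0 : cd != 0.
  by apply: comp1_neq0 => //; rewrite expf_neq0 ?fpsX_neq0.
have ker_lift (s : 'I_n -> fps C) :
    pull (\sum_(j < n) fps_const (s j) * varY R ^+ j) gam = \sum_(j < n) cn (s j) * phi ^+ j.
  rewrite (pull_sum _ _ _ gam0); apply: eq_bigr => j _.
  by rewrite (pullM _ _ gam0) (pullXn _ _ gam0) (pullY gam0) (pull_fps_const _ gam0).
have cdX (k : 'I_n) : exists g : series2 R, pull g gam = cd * fps_X ^+ k.
  exists (\sum_(j < n) fps_const (\adj P k j) * varY R ^+ j); rewrite ker_lift.
  have /matrixP E := mul_adj_mx P.
  transitivity (\sum_(l < n) cn ((\adj P *m P) k l) * fps_X ^+ l).
    transitivity (\sum_(j < n) \sum_(l < n) cn (\adj P k j) * (cn (P j l) * fps_X ^+ l)).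
      apply: eq_bigr => j _; rewrite rE mulr_sumr; apply: eq_bigr => l _.
      by rewrite [X in _ = _ * (cn X * _)]mxE.
    apply: etrans (exchange_big _ _ _ _ _ _) _; apply: eq_bigr => l _.
    rewrite mxE rmorph_sum mulr_suml; apply: eq_bigr => j _.
    by rewrite rmorphM mulrA.
  rewrite (bigD1 k) // big1 => [|l lk]; last by rewrite E !mxE eq_sym (negPf lk) rmorph0 mul0r.
  by rewrite E !mxE eqxx [LHS]addr0.
have /choice[gk gkE] := cdX.
have [cdn /vgE[u uE]] := is_ord_ex cd0.
have uu : u \is a GRing.unit.
  by rewrite fps_unitE unitfE; move: cdn; rewrite {1}uE coefsXnM ltnn subnn.
exists (ord cd) => h /vgE[h1 ->].
have [s sE] := fps_module_decomp (u^-1 * h1) (is_ordXn _ n) n0.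
exists (\sum_(k < n) fps_const (s k) * gk k).
have -> : fps_X ^+ ord cd * h1 = cd * (u^-1 * h1) by rewrite [X in _ = X * _]uE -mulrA (mulVKr uu).
rewrite (pull_sum _ _ _ gam0) sE mulr_sumr.
apply: eq_bigr => k _; rewrite (pullM _ _ gam0) (pull_fps_const _ gam0) gkE.
by rewrite mulrCA.
Qed.

(** Division by [chi], which vanishes along [gam], leaves a remainder of degree less than n in y,
    and such a remainder vanishes along [gam] only if it is zero. So [chi] generates the kernel of
    [pull], and the irreducible f is associated to it. *)
Lemma puiseux_gen_core f : irreducible f -> pull f gam = 0 -> gen f gam.
Proof.
move=> [f0 fN fI] fg.
have [chi [chi0 chin chij]] := pull_kernel_monic (is_ordXn _ n) n0 phi0.
have ex : exists j, coef2 chi 0 j != 0 by exists n; rewrite chin oner_eq0.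
have [m mn mmin] : exists2 m, coef2 chi 0 m != 0 & forall j, (j < m)%N -> coef2 chi 0 j = 0.
  exists (ex_minn ex); case: ex_minnP => // m _ mmin j jm.
  by apply/eqP; apply: contraTT jm => /mmin; rewrite -leqNgt.
have mlen : (m <= n)%N.
  rewrite leqNgt; apply: contraTN isT => nm; have := mmin _ nm.
  by rewrite chin => /eqP; rewrite oner_eq0.
have dvd h : pull h gam = 0 -> divides chi h.
  move=> hg; have [a [r [E r0]]] := weierstrass_division h mmin mn; exists a.
  have rn j : (n <= j)%N -> coefs r j = 0 by move=> nj; apply: r0; apply: leq_trans nj.
  suff r_0 : r = 0 by rewrite E r_0 addr0.
  rewrite (series2_poly_sum rn) big1 // => j _.
  rewrite (_ : coefs r j = 0) ?rmorph0 ?mul0r //.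
  apply: (puiseux_independent (r := fun j => coefs r j)).
  rewrite -[LHS](pull_poly_sum gam0 rn).
  by move: hg; rewrite E (pullD _ _ gam0) (pullM _ _ gam0) chi0 mulr0 add0r.
have chiN : chi \isn't a GRing.unit.
  apply/negP => uchi; move: chi0; rewrite -/gam => c0.
  have := pull1 gam0; rewrite -(mulVr uchi) (pullM _ _ gam0) c0 mulr0.
  by move/eqP; rewrite eq_sym oner_eq0.
have [a aE] := dvd f fg.
have [ua|uc] := fI a chi aE; last by move: chiN; rewrite uc.
split; [exact: gam0| |move=> h|exact: puiseux_conductor].
  by left; rewrite expf_neq0 ?fpsX_neq0.
split=> [/dvd[b ->]|[b ->]].
  by exists (b * a^-1); rewrite aE mulrA divrK.
by rewrite (pullM _ _ gam0) fg mulr0.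
Qed.
End Core.

Lemma swap_neq0 f : f != 0 -> swap f != 0.
Proof. by apply: contra_neq => f0; rewrite -[f]swapK f0; apply: series2P => i j; rewrite coef2_swap
  !coef20. Qed.
Lemma swap_unit f : (swap f \is a GRing.unit) = (f \is a GRing.unit).
Proof. by rewrite !series2_unitE. Qed.
Lemma swap_divides f g : divides f g -> divides (swap f) (swap g).
Proof. by move=> [h ->]; exists (swap h); rewrite swapM. Qed.
Lemma swap_irreducible f : irreducible f -> irreducible (swap f).
Proof.
move=> [f0 fN fI]; split; first exact: swap_neq0.
  by rewrite swap_unit.
move=> g h E; rewrite -(swap_unit g) -(swap_unit h); apply: fI.
by rewrite -swapM -E swapK.
Qed.
Lemma swap_gen f p q : gen f (p, q) -> gen (swap f) (q, p).
Proof.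
move=> [[p0 q0] pq0 ker [c cP]]; split.
- by split.
- by case: pq0; [right|left].
- move=> h; have -> : pull h (q, p) = pull (swap h) (p, q) by rewrite pull_swap.
  by rewrite ker; split=> /swap_divides; rewrite ?swapK.
by exists c => h /cP[g <-]; exists (swap g); rewrite pull_swap.
Qed.

Lemma puiseux_gen f gam : irreducible f -> is_puiseux f gam -> gen f gam.
Proof.
move=> fI [n [phi [n0 phi0 [->|->] prim fg]]]; first exact: puiseux_gen_core.
rewrite -[f]swapK; apply: swap_gen; apply: (puiseux_gen_core n0 phi0 prim); first exact:
  swap_irreducible.
by rewrite pull_swap.
Qed.
End PuiseuxGenerates.

Lemma is_ord_sum (K : comNzRingType) (I : finType) (F : I -> fps K) i v :
  is_ord (F i) v -> (forall l, l != i -> vg v.+1 (F l)) -> is_ord (\sum_l F l) v.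
Proof.
move=> [Fi vi] Fl; rewrite (bigD1 i) //=.
have rest : vg v.+1 (\sum_(l | l != i) F l).
  by apply: (big_ind (vg v.+1)) => //; [exact: vgz|move=> *; apply: vgD].
split; first by rewrite coefsD rest ?addr0.
by apply: vgD => //; apply: vg_le rest.
Qed.

(** * Intersection numbers as orders along a parametrization *)

Section Intersection.
Variable R : realType.
Notation C := (complex R).
Implicit Types (f g u a b : series2 R) (gam : fps C * fps C).

Definition in_ideal f g u := exists a b, u = a * f + b * g.

Lemma in_idealD f g u v : in_ideal f g u -> in_ideal f g v -> in_ideal f g (u + v).
Proof. by move=> [a [b ->]] [a' [b' ->]]; exists (a + a'), (b + b'); ring. Qed.
Lemma in_idealMl f g u v : in_ideal f g u -> in_ideal f g (v * u).
Proof. by move=> [a [b ->]]; exists (v * a), (v * b); ring. Qed.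
Lemma in_ideal0 f g : in_ideal f g 0.
Proof. by exists 0, 0; rewrite !mul0r addr0. Qed.
Lemma in_ideal_sum f g (I : Type) (r : seq I) (P : pred I) (F : I -> series2 R) :
  (forall i, P i -> in_ideal f g (F i)) -> in_ideal f g (\sum_(i <- r | P i) F i).
Proof.
move=> FI; apply: big_ind => //; first exact: in_ideal0.
by move=> x y; apply: in_idealD.
Qed.

Let lin n (e : 'I_n -> series2 R) (c : 'rV[C]_n) : series2 R := \sum_i const2 (c 0 i) * e i.
Let linB n (e : 'I_n -> series2 R) c c' : lin e (c - c') = lin e c - lin e c'.
Proof. by rewrite /lin -sumrB; apply: eq_bigr => i _; rewrite !mxE rmorphB mulrBl. Qed.
Let linD n (e : 'I_n -> series2 R) c c' : lin e (c + c') = lin e c + lin e c'.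
Proof. by rewrite /lin -big_split; apply: eq_bigr => i _; rewrite !mxE rmorphD mulrDl. Qed.
Let repr f g n (e : 'I_n -> series2 R) u (c : 'rV[C]_n) :=
  in_ideal f g (u - lin e c).

Lemma inter_dimsP f g n : inter_dims f g n <->
  exists e : 'I_n -> series2 R, (forall u, exists c, repr f g e u c) /\
    (forall c, repr f g e 0 c -> c = 0).
Proof.
have reprE e u (c : 'rV[C]_n) : repr f g e u c <->
    exists a b, u = \sum_i const2 (c 0 i) * e i + a * f + b * g.
  rewrite -/(lin e c); split=> [[a [b E]]|[a [b E]]]; exists a, b.
    by rewrite -addrA -E addrC subrK.
  by rewrite E; ring.
split=> [[e eP]|[e [ex un]]]; exists e.
  split=> [u|c /reprE c0].
    by have [c [/reprE cE _]] := eP u; exists c.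
  have [c' [_ cu]] := eP 0; rewrite -(cu c c0); apply: cu; exists 0, 0.
  by rewrite !mul0r !addr0 big1 // => i _; rewrite mxE rmorph0 mul0r.
move=> u; have [c cE] := ex u; exists c; split; first exact/reprE.
move=> c' /reprE cE'; apply/eqP; rewrite -subr_eq0; apply/eqP; apply: un.
have [a [b E]] := cE; have [a' [b' E']] := cE'; rewrite /repr; exists (a - a'), (b - b').
rewrite linB.
rewrite /repr in cE cE'; clear cE cE'; move: (lin e c) (lin e c') E E' => s s' E E'.
have -> : 0 - (s - s') = (u - s) - (u - s') by ring.
by rewrite E E'; ring.
Qed.

Let lin_mul m n (e : 'I_n -> series2 R) (c : 'rV_m) (B : 'M_(m, n)) :
  lin e (c *m B) = \sum_i const2 (c 0 i) * lin e (row i B).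
Proof.
transitivity (\sum_l \sum_i const2 (c 0 i) * (const2 (B i l) * e l)).
  apply: eq_bigr => l _; rewrite mxE rmorph_sum mulr_suml; apply: eq_bigr => i _.
  by rewrite rmorphM mulrA.
apply: etrans (exchange_big _ _ _ _ _ _) _; apply: eq_bigr => i _; rewrite mulr_sumr.
by apply: eq_bigr => l _; rewrite [in RHS]mxE.
Qed.
Let lin_delta n (e : 'I_n -> series2 R) j : lin e (delta_mx 0 j) = e j.
Proof.
rewrite /lin (bigD1 j) // big1 => [|i ij]; last first.
  by rewrite mxE (negPf ij) andbF rmorph0 mul0r.
by rewrite mxE !eqxx [LHS]addr0 rmorph1 mul1r.
Qed.

(** Expressing each of two bases in the other gives matrices with product 1. *)
Lemma inter_dims_le f g m n : inter_dims f g m -> inter_dims f g n -> (n <= m)%N.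
Proof.
move=> /inter_dimsP[e [ex _]] /inter_dimsP[e' [ex' un']].
have /choice[A AE] : forall j, exists c, repr f g e (e' j) c by move=> j; apply: ex.
have /choice[B BE] : forall i, exists c, repr f g e' (e i) c by move=> i; apply: ex'.
pose MA := \matrix_(j, i) A j 0 i; pose MB := \matrix_(i, j) B i 0 j.
apply: (@mulmx1_min _ _ _ MA MB); apply/row_matrixP => j.
have rA : row j MA = A j by apply/rowP => i; rewrite !mxE.
have rB i : row i MB = B i by apply/rowP => l; rewrite !mxE.
rewrite row_mul row1 rA; apply/eqP; rewrite -subr_eq0; apply/eqP; apply: un'.
rewrite /repr linB lin_mul lin_delta.
rewrite (_ : 0 - _ = (e' j - lin e (A j)) + \sum_i const2 (A j 0 i) * (e i - lin e' (B i))).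
  apply: in_idealD; first exact: AE.
  by apply: in_ideal_sum => i _; apply: in_idealMl; apply: BE.
have Es : \sum_i const2 (A j 0 i) * (e i - lin e' (B i)) =
    lin e (A j) - \sum_i const2 (A j 0 i) * lin e' (row i MB).
  by rewrite -sumrB; apply: eq_bigr => i _; rewrite rB mulrBr.
by rewrite sub0r opprB -addrA Es [- lin e _ + _]addrA addNr add0r.
Qed.

Lemma inter_dimsE f g n : inter_dims f g n -> inter f g = n.
Proof.
move=> fgn; have fgi : inter_dims f g (inter f g).
  exact: (@xgetPex _ 0%N (inter_dims f g) (ex_intro _ n fgn)).
by apply/eqP; rewrite eqn_leq (inter_dims_le fgi fgn) (inter_dims_le fgn fgi).
Qed.

(** Along [gam] the local ring of f becomes a subring of C[[t]] with a semigroup of orders Gam, in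
    which the ideal of g has orders k + Gam. Elements chosen for each order in Gam but not in k +
    Gam form a basis of the quotient, and the conductor makes their number k. *)
Lemma pull_is_inter f g gam : gen f gam -> pull g gam != 0 ->
  inter_dims f g (ord (pull g gam)).
Proof.
move=> [gam0 _ ker [c cP]] gn0; set k := ord (pull g gam).
have gk : is_ord (pull g gam) k by apply: is_ord_ex.
pose Gam v := `[< exists a : series2 R, is_ord (pull a gam) v >].
have GamP v : Gam v -> exists a : series2 R, is_ord (pull a gam) v by move/asboolP.
have Gc v : (c <= v)%N -> Gam v.
  move=> cv; have [a aE] := cP _ (vg_le cv (@vgXn _ v)).
  by apply/asboolP; exists a; rewrite aE; apply: is_ordXn.
have Gk v : Gam v -> Gam (k + v)%N.
  move=> /GamP[a av]; apply/asboolP; exists (g * a).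
  by rewrite (pullM _ _ gam0); apply: is_ordM.
pose H v := (k <= v)%N && Gam (v - k)%N.
have HG v : H v -> Gam v by move=> /andP[kv /Gk]; rewrite subnKC.
pose G v := Gam v && ~~ H v.
pose L := [seq v <- iota 0 (k + c) | G v].
(* Below k + c, the set Gam has k more elements than its shift by k, because it contains all of [c,
   k + c). *)
have sizeL : size L = k.
  have c1 : count Gam (iota 0 (k + c)) = (count Gam (iota 0 c) + k)%N.
    rewrite [(k + c)%N]addnC iotaD count_cat add0n; congr (_ + _)%N.
    have : all Gam (iota c k) by apply/allP => v; rewrite mem_iota => /andP[/Gc].
    by rewrite all_count size_iota => /eqP.
  have c2 : count H (iota 0 (k + c)) = count Gam (iota 0 c).
    rewrite iotaD count_cat add0n -[X in iota X c]addn0 iotaDl count_map.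
    rewrite (_ : count H _ = 0%N) ?add0n.
      by apply: eq_count => v; rewrite /H /= leq_addr addKn.
    apply/eqP; rewrite -leqn0 leqNgt -has_count -all_predC; apply/allP => v.
    by rewrite mem_iota add0n /H /= => vk; rewrite negb_and -ltnNge vk.
  have c3 : (count G (iota 0 (k + c)) + count H (iota 0 (k + c)) = count Gam (iota 0 (k + c)))%N.
    elim: (iota _ _) => //= v s IH; rewrite -IH /G.
    case: (boolP (H v)) => [Hv|nHv]; first by rewrite (HG v Hv) /=; lia.
    by rewrite andbT /=; lia.
  apply/eqP; rewrite size_filter -(eqn_add2r (count H (iota 0 (k + c)))) c3 c1 c2.
  by rewrite addnC.
have nthL (i : 'I_k) : G (nth 0%N L i).
  have : nth 0%N L i \in L by rewrite mem_nth ?sizeL.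
  by rewrite mem_filter => /andP[].
have /choice[a aP] : forall v, exists a : series2 R, Gam v -> is_ord (pull a gam) v.
  move=> v; have [/GamP[a av]|nG] := boolP (Gam v); last by exists 0.
  by exists a.
pose e (i : 'I_k) := a (nth 0%N L i).
have eP i : is_ord (pull (e i) gam) (nth 0%N L i) by apply: aP; case/andP: (nthL i).
apply/inter_dimsP; exists e; split.
  (* Spanning: a leading term of order d is removed by a basis element or by a multiple of g, and
     from the order k + c on everything is a multiple of g. *)
  suff gen_d m d u : (k + c - d < m)%N -> vg d (pull u gam) -> exists c, repr f g e u c.
    by move=> u; apply: (gen_d (k + c - 0).+1 0%N).
  elim: m d u => // m IH d u dm ud.
  have [kcd|dkc] := leqP (k + c) d.
    have /vgE[h hE] := vg_le kcd ud; have [gn /vgE[g1 g1E]] := gk.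
    have ug1 : g1 \is a GRing.unit.
      by rewrite fps_unitE unitfE; move: gn; rewrite {1}g1E coefsXnM ltnn subnn.
    have [b bE] : exists b : series2 R, pull b gam = fps_X ^+ c * (g1^-1 * h).
      by apply: cP; apply/vgE; exists (g1^-1 * h).
    exists 0; rewrite /repr /lin big1 ?subr0 => [|i _]; last by rewrite mxE rmorph0 mul0r.
    have /ker[q qE] : pull (u - b * g) gam = 0.
      rewrite (pullB _ _ gam0) (pullM _ _ gam0) bE hE [X in _ - _ * X]g1E exprD.
      have -> : fps_X ^+ c * (g1^-1 * h) * (fps_X ^+ k * g1) =
         fps_X ^+ k * fps_X ^+ c * (h * (g1 * g1^-1)).
        move: (fps_X ^+ k) (fps_X ^+ c) (g1^-1) => x y z; ring.
      by rewrite divrr // mulr1 subrr.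
    by exists q, b; rewrite -qE subrK.
  have step (v : series2 R) : vg d.+1 (pull (u - v) gam) -> (exists cv, repr f g e v cv) ->
      exists cu, repr f g e u cu.
    move=> uvd [cv cvE]; have [||cw cwE] := IH d.+1 (u - v); [lia|by []|].
    exists (cw + cv); rewrite /repr linD.
    rewrite /repr in cvE cwE; move: (lin e cw) (lin e cv) cvE cwE => s t tE sE.
    have -> : u - (s + t) = (u - v - s) + (v - t) by ring.
    exact: in_idealD.
  have [ud0|ud0] := eqVneq (coefs (pull u gam) d) 0.
    apply: (step 0); first by rewrite subr0; apply/vgS.
    exists 0; rewrite /repr /lin big1 ?subr0 => [|i _]; first exact: in_ideal0.
    by rewrite mxE rmorph0 mul0r.
  have Gd : Gam d by apply/asboolP; exists u.
  have kill v : is_ord (pull v gam) d ->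
      vg d.+1 (pull (u - const2 (coefs (pull u gam) d / coefs (pull v gam) d) * v) gam).
    move=> [vd vdv]; rewrite (pullB _ _ gam0) (pullM _ _ gam0) (pullC _ gam0); apply/vgS; split.
      by apply: vgB => //; rewrite -[d]add0n; apply: vgM.
    by rewrite coefsB coefsCM divfK // subrr.
  have [Hd|nHd] := boolP (H d).
    have [kd Gdk] := andP Hd; have gd : is_ord (pull (a (d - k)%N * g) gam) d.
      by rewrite (pullM _ _ gam0) -[X in is_ord _ X](subnK kd); apply: is_ordM => //; apply: aP.
    apply: step (kill _ gd) _; exists 0.
    rewrite /repr /lin big1 ?subr0 => [|i _]; last by rewrite mxE rmorph0 mul0r.
    by exists 0; eexists; rewrite mul0r add0r mulrA.
  have dL : d \in L by rewrite mem_filter /G Gd nHd mem_iota.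
  have iP : (index d L < k)%N by rewrite -sizeL index_mem.
  pose i := Ordinal iP; have ed : is_ord (pull (e i) gam) d.
    by have := eP i; rewrite nth_index.
  apply: step (kill _ ed) _.
  exists ((coefs (pull u gam) d / coefs (pull (e i) gam) d) *: delta_mx 0 i).
  rewrite /repr /lin (bigD1 i) // big1 => [|j ji]; last first.
    by rewrite !mxE (negPf ji) andbF mulr0 rmorph0 mul0r.
  by rewrite !mxE !eqxx mulr1 [X in _ - X]addr0 subrr; apply: in_ideal0.
(* Independence: the orders of the basis elements are distinct, so a combination has the least order
   v of its terms; as a multiple of g along [gam], it would put v in k + Gam. *)
move=> d [a1 [b1 E]]; apply/rowP => j; rewrite [RHS]mxE; apply/eqP; apply: contraT => dj.
have [i di imin] := @arg_minnP _ j (fun i => d 0 i != 0) (fun i : 'I_k => nth 0%N L i) dj.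
have uL : uniq L by rewrite filter_uniq ?iota_uniq.
set v := nth 0%N L i in imin.
have ordS : is_ord (pull (\sum_i const2 (d 0 i) * e i) gam) v.
  have F l : pull (const2 (d 0 l) * e l) gam = fps_const (d 0 l) * pull (e l) gam.
    by rewrite (pullM _ _ gam0) (pullC _ gam0).
  rewrite (pull_sum _ _ _ gam0); apply: (@is_ord_sum _ _ _ i).
    have [ei vei] := eP i; rewrite (F i); split; first by rewrite coefsCM; exact: mulf_neq0.
    by rewrite -[v]add0n; apply: vgM.
  move=> l li; rewrite (F l); have [->|dl] := eqVneq (d 0 l) 0.
    by rewrite rmorph0 mul0r; apply: vgz.
  rewrite -[v.+1]add0n; apply: vgM => //; have [_] := eP l; apply: vg_le.
  rewrite ltn_neqAle imin // andbT /v nth_uniq ?sizeL //.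
  by apply: contra li => /eqP il; apply/eqP; apply: val_inj.
have E2 : pull (\sum_i const2 (d 0 i) * e i) gam = pull (- b1) gam * pull g gam.
  have -> : \sum_i const2 (d 0 i) * e i = - (a1 * f + b1 * g) by rewrite -E sub0r opprK.
  have fz : pull f gam = 0 by apply/ker; exists 1; rewrite mul1r.
  by rewrite opprD (pullD _ _ gam0) -!mulNr !(pullM _ _ gam0) fz mulr0 add0r.
have bn0 : pull (- b1) gam != 0.
  by have := is_ord_neq0 ordS; rewrite E2; apply: contraNneq => ->; rewrite mul0r.
have vE : v = (ord (pull (- b1) gam) + k)%N.
  apply: is_ord_uniq ordS _; rewrite E2; apply: is_ordM => //; exact: is_ord_ex.
have /andP[_ /negP[]] := nthL i; rewrite -/v vE /H leq_addl addnK.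
by apply/asboolP; exists (- b1); apply: is_ord_ex.
Qed.

Lemma inter_gen f g gam : gen f gam -> pull g gam != 0 -> inter f g = ord (pull g gam).
Proof. by move=> fg gn; apply/inter_dimsE/pull_is_inter. Qed.
End Intersection.

Lemma sum_ord_single (T : nmodType) (n i : nat) (F : nat -> T) : (i < n)%N ->
  (forall k, (k < n)%N -> k != i -> F k = 0) -> \sum_(k < n) F k = F i.
Proof.
move=> ni F0; rewrite (bigD1 (Ordinal ni)) //= big1 ?addr0 // => k kn.
by apply: F0 => //; apply: contra kn => /eqP kn; apply/eqP/val_inj.
Qed.

(** * Blowing up curves *)

Section BlowUp.
Variable R : realType.
Notation C := (complex R).
Implicit Types (f g h : series2 R) (gam : fps C * fps C) (c : option C) (z : C).

(* [f_i(1, Y)], for [f_i] the homogeneous part of degree [i] of [f]. *)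
Definition hp f i : {poly C} := \poly_(l < i.+1) coef2 f (i - l) l.

Lemma coef_hp f i l : (hp f i)`_l = if (l <= i)%N then coef2 f (i - l) l else 0.
Proof. by rewrite coef_poly ltnS. Qed.

Lemma coef2XnM n f i j :
  coef2 (varX R ^+ n * f) i j = if (i < n)%N then 0 else coef2 f (i - n) j.
Proof. by rewrite /coef2 /varX -rmorphXn coefsCM coefsXnM. Qed.
Lemma coef2YnM n f i j :
  coef2 (varY R ^+ n * f) i j = if (j < n)%N then 0 else coef2 f i (j - n).
Proof. by rewrite /coef2 /varY coefsXnM; case: ltnP => _ //; rewrite coefs0. Qed.
Lemma coef2CM (a : C) f i j : coef2 (const2 a * f) i j = a * coef2 f i j.
Proof. by rewrite /coef2 /const2 !coefsCM. Qed.

Lemma coef2_shiftY z l i j : coef2 ((varY R + const2 z) ^+ l) i j =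
  if i == 0%N then (('X + z%:P : {poly C}) ^+ l)`_j else 0.
Proof.
elim: l j => [|l IH] j.
  by rewrite !expr0 coef21 coef1; case: (i == 0%N).
rewrite !exprS !mulrDl coef2D coefD coef2CM coefCM coefXM IH -[varY R]expr1 coef2YnM IH.
by case: j => [|j] //=; rewrite ?subn1; case: (i == 0%N); rewrite ?mulr0 ?addr0.
Qed.

(** Setting y = x (Y + z) turns the homogeneous part of degree i into x^i times its dehomogenization
    at Y + z. *)
Lemma coef2_blowup_some f z i j :
  coef2 (subst2 f (varX R) (varX R * (varY R + const2 z))) i j =
  (hp f i \Po ('X + z%:P))`_j.
Proof.
rewrite [LHS]subst2_coefs; pose F k l := coef2 f k l *
  coef2 (varX R ^+ k * (varX R * (varY R + const2 z)) ^+ l) i j.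
have FE k l : F k l = if (k + l == i)%N then coef2 f k l * (('X + z%:P : {poly C}) ^+ l)`_j else 0.
  rewrite /F exprMn mulrA -exprD coef2XnM coef2_shiftY; case: ltnP => ik.
    by rewrite gtn_eqF // mulr0.
  by rewrite subn_eq0 eqn_leq ik andTb; case: ifP; rewrite ?mulr0.
have -> : hp f i \Po ('X + z%:P) = \sum_(l < i.+1) coef2 f (i - l) l *: ('X + z%:P) ^+ l.
  by rewrite /hp poly_def rmorph_sum /=; apply: eq_bigr => l _; rewrite comp_polyZ comp_Xn_poly.
rewrite coef_sum; apply: etrans (exchange_big _ _ _ _ _ _) _.
rewrite (@sum_ord_trunc _ i.+1 (i + j).+1 (fun l => \sum_(k < (i + j).+1) F k l)) => [||l /andP[il
  _]].
- apply: eq_bigr => l _; rewrite coefZ.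
  have li : (i - l < (i + j).+1)%N by lia.
  apply: etrans (sum_ord_single (F := F^~ l) li _) _.
    by move=> k _ kl; rewrite FE ifF //; apply: contraNF kl => /eqP kl; rewrite -[X in (X - _)%N]kl
      addnK.
  by rewrite FE subnK ?eqxx // -ltnS.
- by rewrite ltnS leq_addr.
- by apply: big1 => k _; rewrite FE gtn_eqF //; lia.
Qed.

Lemma coef2_blowup_none f i j :
  coef2 (subst2 f (varX R * varY R) (varY R)) i j =
  if (i <= j)%N then coef2 f i (j - i) else 0.
Proof.
rewrite [LHS]subst2_coefs; pose F k l := coef2 f k l *
  coef2 ((varX R * varY R) ^+ k * varY R ^+ l) i j.
have FE k l : F k l = if (k == i) && (k + l == j)%N then coef2 f k l else 0.
  rewrite /F exprMn -mulrA -exprD -[_ ^+ (k + l)]mulr1 coef2XnM coef2YnM coef21.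
  have [ik|ki] := ltnP i k; first by rewrite gtn_eqF // mulr0.
  have [jk|kj] := ltnP j (k + l); first by rewrite [(k + l == j)%N]gtn_eqF // andbF mulr0.
  rewrite !subn_eq0 [k == i]eqn_leq ki [(k + l == j)%N]eqn_leq kj !andTb.
  by case: ifP; rewrite ?mulr1 ?mulr0.
have ii : (i < (i + j).+1)%N by lia.
apply: etrans (sum_ord_single (F := fun k => \sum_(l < (i + j).+1) F k l) ii _) _.
  by move=> k _ ki; apply: big1 => l _; rewrite FE (negPf ki).
have [ij|ji] := leqP i j; last by apply: big1 => l _; rewrite FE eqxx gtn_eqF //; lia.
have jj : (j - i < (i + j).+1)%N by lia.
apply: etrans (sum_ord_single (F := F i) jj _) _; last by rewrite FE subnKC // !eqxx.
by move=> l _ li; rewrite FE eqxx ifF //; apply: contraNF li => /eqP <-; rewrite addKn.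
Qed.

Definition is_mult f m := hp f m != 0 /\ forall i, (i < m)%N -> hp f i = 0.

Lemma hp_neq0 f i j : coef2 f i j != 0 -> hp f (i + j) != 0.
Proof.
apply: contraNneq => /(congr1 (fun p : {poly C} => p`_j)).
by rewrite coef_hp leq_addl addnK coef0 => ->.
Qed.
Lemma is_mult_vg2 f m : is_mult f m -> vg2 m f.
Proof.
move=> [_ fm] i j /fm; move=> E; apply/eqP; apply: contraTT isT => /hp_neq0.
by rewrite E eqxx.
Qed.
Lemma is_mult_ex f : f != 0 -> exists m, is_mult f m.
Proof.
move=> f0; have ex : exists m, hp f m != 0.
  apply: contrapT => nex; move/eqP: f0; apply; apply: series2P => i j; rewrite coef20.
  apply/eqP; apply: contrapT => /negP /hp_neq0 ij; apply: nex; by exists (i + j)%N.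
exists (ex_minn ex); case: ex_minnP => m fm mmin; split=> // i im.
by apply/eqP; apply: contraTT im => /mmin; rewrite -leqNgt.
Qed.
Lemma is_mult_neq0 f m : is_mult f m -> f != 0.
Proof.
case=> + _; apply: contraNneq => ->; apply/eqP/polyP => l.
by rewrite coef_hp coef0 coef20 if_same.
Qed.
Lemma is_mult_uniq f m n : is_mult f m -> is_mult f n -> m = n.
Proof.
move=> [fm mf] [fn nf]; apply/eqP; rewrite eqn_leq; apply/andP; split.
  by rewrite leqNgt; apply: contra fn => /mf ->.
by rewrite leqNgt; apply: contra fm => /nf ->.
Qed.
(** The multiplicity is the order in x after the substitution of x Y for y; [swap] lets it be read
    as the order of a series over C[[y]], which is additive. *)
Lemma is_mult_ord f m :
  is_mult f m <-> is_ord (swap (subst2 f (varX R) (varX R * (varY R + const2 0)))) m.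
Proof.
have E i : coefs (swap (subst2 f (varX R) (varX R * (varY R + const2 0)))) i =
    Fps (fun j => (hp f i)`_j).
  apply: fpsP => j; have := coef2_swap (subst2 f (varX R) (varX R * (varY R + const2 0))) j i.
  by rewrite /= coef2_blowup_some (_ : 'X + 0%:P = 'X) ?polyC0 ?addr0 ?comp_polyXr.
have E0 i : (coefs (swap (subst2 f (varX R) (varX R * (varY R + const2 0)))) i == 0) =
    (hp f i == 0).
  rewrite E; apply/eqP/eqP => [h0|->]; last by apply: fpsP => j; rewrite coefs0 /= coef0.
  by apply/polyP => j; have := congr1 (fun p => coefs p j) h0; rewrite coefs0 coef0.
rewrite /is_ord E0; split=> -[fm mf]; split=> // i im.
  by apply/eqP; rewrite E0 mf.
by apply/eqP; rewrite -E0 mf.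
Qed.
Lemma chart00 c : coef2 (chart c).1 0 0 = 0 /\ coef2 (chart c).2 0 0 = 0.
Proof.
case: c => [z|] /=; rewrite ?coef2M00 ?coef2X ?coef2Y ?mul0r //.
Qed.
Lemma is_multM f g m n : is_mult f m -> is_mult g n -> is_mult (f * g) (m + n).
Proof.
move=> /is_mult_ord fm /is_mult_ord gn; apply/is_mult_ord.
have [u0 v0] := chart00 (Some 0).
by rewrite (subst2M f g u0 v0) swapM; apply: is_ordM.
Qed.
Lemma is_mult0 f : is_mult f 0 <-> f \is a GRing.unit.
Proof.
rewrite series2_unitE; split=> [[f0 _]|f0]; last by split=> //; exact: (@hp_neq0 f 0 0).
apply: contraNneq f0 => f0; apply/eqP/polyP => -[|l]; rewrite coef_hp coef0 //.
Qed.
Lemma is_mult_gt0 f m : is_mult f m -> coef2 f 0 0 = 0 -> (0 < m)%N.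
Proof.
case: m => // /is_mult0; rewrite series2_unitE => + f0; by rewrite f0 eqxx.
Qed.

(* The strict transform of [f] when [f] has multiplicity [m]. *)
Definition bl f m c : series2 R :=
  if c is Some z then Fps (fun j => Fps (fun i => (hp f (m + i) \Po ('X + z%:P))`_j))
  else Fps (fun j => Fps (fun i => if (i <= j + m)%N then coef2 f i (j + m - i) else 0)).
(** The exceptional line in the chart c and, for [excv], the value of its equation along [gam]. *)
Definition epar c : fps C * fps C := if c is Some _ then (0, fps_X) else (fps_X, 0).
Definition excv c gam : fps C := if c is Some _ then gam.1 else gam.2.
(* The germ at the point [c] of P^1 of the form of degree [m] dehomogenized as [P]. *)
Definition germ m (P : {poly C}) c : fps C :=
  if c is Some z then Fps (fun n => (P \Po ('X + z%:P))`_n)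
  else Fps (fun n => if (n <= m)%N then P`_(m - n) else 0).

Lemma pull_axis1 f n : coefs (pull f (0, fps_X)) n = coef2 f 0 n.
Proof.
rewrite [LHS]pull_coefs; pose F (k l : nat) : C := coef2 f k l * coefs ((0 : fps C) ^+ k * fps_X ^+
  l) n.
have FE k l : F k l = if (k == 0%N) && (l == n) then coef2 f k l else 0.
  rewrite /F /= expr0n; case: k => [|k]; last by rewrite mul0r coefs0 mulr0.
  by rewrite mul1r coefsXn eq_sym /=; case: eqP => _; rewrite ?mulr1 ?mulr0.
apply: etrans (sum_ord_single (F := fun k => \sum_(l < n.+1) F k l) (ltn0Sn n) _) _.
  by move=> k _ k0; apply: big1 => l _; rewrite FE (negPf k0).
apply: etrans (sum_ord_single (F := F 0%N) (ltnSn n) _) _; last by rewrite FE !eqxx.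
by move=> l _ ln; rewrite FE (negPf ln).
Qed.
Lemma pull_axis2 f n : coefs (pull f (fps_X, 0)) n = coef2 f n 0.
Proof. by rewrite -coef2_swap -pull_axis1 pull_swap. Qed.

Lemma pull_epar f m c : pull (bl f m c) (epar c) = germ m (hp f m) c.
Proof.
case: c => [z|]; apply: fpsP => n.
  by rewrite [LHS]pull_axis1 /coef2 /= addn0.
rewrite [LHS]pull_axis2 /coef2 /= add0n coef_hp leq_subr.
by case: leqP => // nm; rewrite subKn.
Qed.

Lemma subst2_blowup f m c : (forall i, (i < m)%N -> hp f i = 0) ->
  subst2 f (chart c).1 (chart c).2 = exc c ^+ m * bl f m c.
Proof.
move=> mf; apply: series2P => i j; case: c => [z|] /=.
  rewrite [LHS]coef2_blowup_some coef2XnM; case: ltnP => [/mf ->|mi].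
    by rewrite comp_poly0 coef0.
  by rewrite /coef2 /= subnKC.
rewrite [LHS]coef2_blowup_none coef2YnM; case: ltnP => [jm|mj].
  case: leqP => // ij; apply/eqP; apply: contraT => /hp_neq0.
  by rewrite subnKC // mf ?eqxx.
by rewrite /coef2 /= subnK.
Qed.

(** Bounds by m the order of a zero of a binary form of degree m, since a translation preserves the
    degree of P. *)
Lemma germ_neq0 m (P : {poly C}) c : P != 0 -> (size P <= m.+1)%N ->
  exists2 n, (n <= m)%N & coefs (germ m P c) n != 0.
Proof.
move=> P0 Pm; case: c => [z|] /=.
  have Q0 : P \Po ('X + z%:P) != 0.
    by rewrite -size_poly_eq0 size_comp_poly2 ?size_XaddC // size_poly_eq0.
  exists (size (P \Po ('X + z%:P))).-1; last by rewrite -/(lead_coef _) lead_coef_eq0.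
  by rewrite size_comp_poly2 ?size_XaddC //; case: (size P) Pm.
exists (m - (size P).-1)%N; first exact: leq_subr.
have sP : ((size P).-1 <= m)%N by case: (size P) Pm.
by rewrite leq_subr subKn // -/(lead_coef _) lead_coef_eq0.
Qed.
Lemma size_hp f m : (size (hp f m) <= m.+1)%N.
Proof. exact: size_poly. Qed.

Lemma strictE (e g h : series2 R) m : e != 0 -> g = e ^+ m * h -> ~ divides e h ->
  strict e g = h.
Proof.
move=> e0 gE eh.
have [[n gn] en] := @xgetPex _ 0 [set h | (exists m, g = e ^+ m * h) /\ ~ divides e h]
   (ex_intro _ h (conj (ex_intro _ m gE) eh)).
rewrite -/(strict e g) in gn en *; set h' := strict e g in gn en *.
have aux (a b : series2 R) k l : e ^+ k * a = e ^+ l * b -> ~ divides e a -> (k <= l)%N -> ~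
  divides e b -> a = b.
  move=> E ea kl eb; move: E; rewrite -(subnKC kl) exprD -mulrA => /(mulfI (expf_neq0 _ e0)).
  case: (l - k)%N => [|d] E; first by rewrite E expr0 mul1r.
  by case: ea; exists (e ^+ d * b); rewrite E exprS; ring.
have [mn|/ltnW nm] := leqP n m; first by apply: (aux _ _ n m) => //; rewrite -gn -gE.
by apply/esym/(aux _ _ m n) => //; rewrite -gn -gE.
Qed.

Lemma pullXe : z0 (0, fps_X : fps C) /\ z0 (fps_X : fps C, 0).
Proof. by split; split; rewrite ?coefs0 ?(coefsXn _ 1). Qed.
Lemma z0_epar c : z0 (epar c).
Proof. by case: c => [z|]; [case: pullXe|case: pullXe]. Qed.
Lemma pull_exc_epar c : pull (exc c) (epar c) = 0.
Proof.
by case: c => [z|] /=; [rewrite pullX //; case: pullXe|rewrite pullY //; case: pullXe].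
Qed.
Lemma exc_neq0 c : exc c != 0 :> series2 R.
Proof.
apply/eqP; case: c => [z|] /= /(congr1 (fun f => coef2 f)).
  by move/(congr1 (fun F => F 1%N 0%N)); rewrite coef2X coef20 => /eqP; rewrite oner_eq0.
by move/(congr1 (fun F => F 0%N 1%N)); rewrite coef2Y coef20 => /eqP; rewrite oner_eq0.
Qed.
Lemma exc_dvd c f : divides (exc c) f <-> pull f (epar c) = 0.
Proof.
split=> [[h ->]|f0]; first by rewrite (pullM _ _ (z0_epar c)) pull_exc_epar mulr0.
case: c f0 => [z|] /= f0.
  exists (Fps (fun j => Fps (fun i => coef2 f i.+1 j))); apply: series2P => i j.
  rewrite mulrC -[varX R]expr1 coef2XnM; case: i => [|i] /=; last by rewrite subn1.
  by rewrite -pull_axis1 f0 coefs0.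
exists (Fps (fun j => Fps (fun i => coef2 f i j.+1))); apply: series2P => i j.
rewrite mulrC -[varY R]expr1 coef2YnM; case: j => [|j] /=; last by rewrite subn1.
by rewrite -pull_axis2 f0 coefs0.
Qed.

(** The restriction of [bl f m c] to the exceptional line is the germ of the nonzero form [hp f m],
    so no further power of the exceptional equation factors out. *)
Lemma series_blowupE f m c : is_mult f m -> series_blowup f c = bl f m c.
Proof.
move=> fm; apply: (strictE (m := m)); [exact: exc_neq0|exact: subst2_blowup (proj2 fm)|].
move/exc_dvd; rewrite pull_epar => g0; have [hm _] := fm.
by have [n _] := germ_neq0 c hm (size_hp f m); rewrite g0 coefs0 eqxx.
Qed.

(* The curve that [gam], given in the chart [c], parametrizes downstairs. *)
Definition pd c gam : fps C * fps C :=
  if c is Some z then (gam.1, gam.1 * (gam.2 + fps_const z)) else (gam.1 * gam.2, gam.2).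
Lemma pdE c gam : z0 gam -> pd c gam = (pull (chart c).1 gam, pull (chart c).2 gam).
Proof.
move=> h; case: c => [z|] /=; rewrite ?(pullM _ _ h) ?(pullD _ _ h) ?(pullC _ h).
  by rewrite (pullX h) (pullY h).
by rewrite (pullX h) (pullY h).
Qed.
Lemma pd_z0 c gam : z0 gam -> z0 (pd c gam).
Proof. by case=> p0 q0; case: c => [z|]; split; rewrite //= coefsM0 ?p0 ?q0 ?mul0r ?mulr0. Qed.
Lemma pull_exc c gam : z0 gam -> pull (exc c) gam = excv c gam.
Proof. by move=> h; case: c => [z|] /=; rewrite ?(pullX h) ?(pullY h). Qed.

Lemma pull_pd f m c gam : z0 gam -> is_mult f m ->
  pull f (pd c gam) = excv c gam ^+ m * pull (bl f m c) gam.
Proof.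
move=> h fm; have [u0 v0] := chart00 c.
rewrite (pdE c h) -(pull_subst2 f h u0 v0) (subst2_blowup c (proj2 fm)) (pullM _ _ h) (pullXn _ _
  h).
by rewrite (pull_exc c h).
Qed.
Lemma pd_nz c gam : excv c gam != 0 -> nz (pd c gam).
Proof. by case: c => [z|] /= h; [left|right]. Qed.
Lemma pd_nz_excv c gam : nz (pd c gam) -> excv c gam != 0.
Proof.
case: c => [z|] /= [] /=; first exact: id; last exact: id.
  by apply: contraNneq => ->; rewrite mul0r.
by apply: contraNneq => ->; rewrite mulr0.
Qed.
End BlowUp.

(** * Existence of Puiseux parametrizations *)

Section Puiseux.
Variable R : realType.
Notation C := (complex R).
Implicit Types (f g h : series2 R) (gam : fps C * fps C) (c : option C) (z : C) (s : seq (option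
  C)).

Lemma vg_all0 (p : fps C) m : (0 < m)%N -> (forall k, vg (m * k) p) -> p = 0.
Proof. by move=> m0 pk; apply: vg_sep => n; apply: vg_le (pk n); rewrite leq_pmull. Qed.

Lemma chain0 (a : nat -> fps C) m : (0 < m)%N ->
  (forall k, a k = fps_X ^+ m * a k.+1) -> a 0%N = 0.
Proof.
move=> m0 aS; apply: (vg_all0 m0) => k; apply/vgE; exists (a k).
elim: k => [|k {1}->]; first by rewrite muln0 expr0 mul1r.
by rewrite aS mulrA -exprD mulnS addnC.
Qed.

Definition push s gam := foldr (@pd R) gam s.

Lemma push_z0 s gam : z0 gam -> z0 (push s gam).
Proof. by move=> h; elim: s => //= c s; apply: pd_z0. Qed.

(** A curve inside the exceptional line is a reparametrization of that line. *)
Lemma axis_comp c f gam : z0 gam -> excv c gam = 0 ->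
  pull f gam = comp1 (if c is Some _ then gam.2 else gam.1) (pull f (epar c)).
Proof.
move=> h e0; have X0 (t : fps C) : coefs t 0 = 0 -> comp1 t 0 = 0.
  by move=> t0; rewrite (comp1E t0) rmorph0.
have E (t : fps C) : coefs t 0 = 0 -> comp1 t (pull f (epar c)) =
    pull f (comp1 t (epar c).1, comp1 t (epar c).2).
  by move=> t0; apply: comp1_pull t0 (z0_epar c).
case: gam h e0 => p r [/= p0 r0]; case: c E => [z|] /= E e0.
  by rewrite (E _ r0) (X0 _ r0) (comp1X r0) e0.
by rewrite (E _ p0) (X0 _ p0) (comp1X p0) e0.
Qed.

Lemma series_blowup_axis f c : f != 0 -> pull (series_blowup f c) (epar c) != 0.
Proof.
move=> f0; have [m fm] := is_mult_ex f0; rewrite (series_blowupE c fm) pull_epar.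
have [hm _] := fm; have [n _ gn] := germ_neq0 c hm (size_hp f m).
by apply: contraNneq gn => ->; rewrite coefs0.
Qed.

Lemma blowup_root_excv f c gam : f != 0 -> z0 gam -> nz gam ->
  pull (series_blowup f c) gam = 0 -> excv c gam != 0.
Proof.
move=> f0 h hn g0; apply/eqP => e0; have := axis_comp (series_blowup f c) h e0.
rewrite g0 => /esym/eqP; apply/negP; apply: comp1_neq0; last exact: series_blowup_axis.
  by case: c {g0 e0} => [z|]; case: h.
by case: c {g0} e0 => [z|] /= e0; case: hn => //; rewrite e0 eqxx.
Qed.

Lemma blowup_pull f c gam : f != 0 -> z0 gam -> exists m,
  is_mult f m /\ pull f (pd c gam) = excv c gam ^+ m * pull (series_blowup f c) gam.
Proof.
move=> f0 h; have [m fm] := is_mult_ex f0; exists m; split=> //.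
by rewrite (series_blowupE c fm); apply: pull_pd.
Qed.

Lemma series_blowup_neq0 f c : f != 0 -> series_blowup f c != 0.
Proof.
move=> f0; apply: contraNneq (series_blowup_axis c f0) => ->.
by rewrite (pull_z (z0_epar c)).
Qed.
Lemma series_at_neq0 f s : f != 0 -> series_at f s != 0.
Proof. by elim: s f => //= c s IH f f0; apply: IH; apply: series_blowup_neq0. Qed.

Lemma root_push f s gam : f != 0 -> z0 gam -> nz gam -> pull (series_at f s) gam = 0 ->
  pull f (push s gam) = 0 /\ nz (push s gam).
Proof.
move=> + h hn; elim: s f => [|c s IH] f f0 g0; first by split.
have [g1 n1] := IH _ (series_blowup_neq0 c f0) g0; have h1 := push_z0 s h.
split; last exact: pd_nz (blowup_root_excv f0 h1 n1 g1).
by have [m [_ ->]] := blowup_pull c f0 h1; rewrite g1 mulr0.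
Qed.

(** Multiplicity n of the strict transform forces order at least n along the exceptional line, where
    the restriction is the germ of a form of degree m. *)
Lemma mult_blowup_le f c m n : is_mult f m -> is_mult (series_blowup f c) n -> (n <= m)%N.
Proof.
move=> fm; rewrite (series_blowupE c fm) => gn; have [hm _] := fm.
have [k km] := germ_neq0 c hm (size_hp f m); rewrite -pull_epar => gk.
apply: leq_trans km; rewrite leqNgt; apply: contra gk => kn.
suff : vg n (pull (bl f m c) (epar c)) by move->.
rewrite -[n]mul1n; apply: pull_vg; [exact: z0_epar| | |exact: is_mult_vg2].
  by apply: vg1; case: (z0_epar c).
by apply: vg1; case: (z0_epar c).
Qed.

Lemma closed_root (P : {poly C}) : (1 < size P)%N -> exists z, root P z.
Proof. by move=> P1; apply/closed_rootP; rewrite gtn_eqF. Qed.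

Section ConstantMultiplicity.
Variable m : nat.
Hypothesis m0 : (0 < m)%N.

Let good f := is_mult f m /\
  forall s, coef2 (series_at f s) 0 0 = 0 -> is_mult (series_at f s) m.
Let good_child f c : good f -> coef2 (series_blowup f c) 0 0 = 0 -> good (series_blowup f c).
Proof. by move=> [fm fs] c0; split=> [|s]; [apply: (fs [:: c])|apply: (fs (c :: s))]. Qed.

(** The strict transform has order at least m along the exceptional line, where it is the germ of a
    form of degree m: the order is m and the coefficient of y^m is nonzero. The next tangent cone
    then has a root again, so the construction continues in charts of type [Some]. *)
Let good_some f z : good f -> root (hp f m) z ->
  good (series_blowup f (Some z)) /\ (hp (series_blowup f (Some z)) m)`_m != 0.
Proof.
move=> fg rz; have [fm _] := fg; have [hm _] := fm.
have f1E j : coef2 (series_blowup f (Some z)) 0 j = (hp f m \Po ('X + z%:P))`_j.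
  by rewrite (series_blowupE _ fm) /coef2 /= addn0.
have gc : good (series_blowup f (Some z)).
  apply: good_child => //; rewrite f1E -horner_coef0 horner_comp !hornerE.
  exact/eqP.
split=> //; have [f1m _] := gc.
rewrite coef_hp leqnn subnn f1E.
have [n nm] := germ_neq0 (Some z) hm (size_hp f m); rewrite /= => hn.
move: nm; rewrite leq_eqVlt => /predU1P[nE|nm]; first by rewrite -[X in _`_X]nE.
by move: hn; rewrite -f1E (is_mult_vg2 f1m) ?eqxx.
Qed.

(** The successive roots are the coefficients of a graph y = phi(x): each blow-up extracts x^m from
    f(x, phi(x)), which is thus divisible by every power of x. *)
Let some_chain_root f : good f -> (hp f m)`_m != 0 ->
  exists gam, [/\ z0 gam, nz gam & pull f gam = 0].
Proof.
move=> fg fmm; pose Good f := good f /\ (hp f m)`_m != 0.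
have /choice[nx nxP] : forall f, exists z, Good f -> Good (series_blowup f (Some z)).
  move=> g; have [[gg gmm]|ng] := pselect (Good g); last by exists 0.
  have [|z rz] := @closed_root (hp g m); last by exists z => _; apply: good_some.
  apply: leq_ltn_trans m0 _; rewrite ltnNge; apply: contra gmm => sm.
  by rewrite nth_default.
pose F k := iter k (fun g => series_blowup g (Some (nx g))) f.
have FG k : Good (F k) by elim: k => [|k IH]; [split|apply: nxP].
pose phi k : fps C := Fps (fun n => if n is n'.+1 then nx (F (k + n')%N) else 0).
have h k : z0 (fps_X, phi k) by split; rewrite ?(coefsXn _ 1).
have step k : pull (F k) (fps_X, phi k) = fps_X ^+ m * pull (F k.+1) (fps_X, phi k.+1).
  have [[Fm _] _] := FG k.
  have -> : (fps_X, phi k) = pd (Some (nx (F k))) (fps_X, phi k.+1).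
    congr pair; apply: fpsP => n; rewrite coefsXM; case: n => [//|n].
    rewrite coefsD coefsC /=; case: n => [|n]; rewrite ?addn0 ?add0r ?addr0 //.
    by rewrite addnS.
  by rewrite (pull_pd _ (h _) Fm) -(series_blowupE _ Fm).
exists (fps_X, phi 0%N); split; [exact: h|by left; apply: fpsX_neq0|].
exact: (chain0 (a := fun k => pull (F k) (fps_X, phi k)) m0 step).
Qed.

(** Either a tangent y = z x appears after finitely many blow-ups in the direction [None], and the
    graph construction applies, or it never does, and x = 0 is a branch. *)
Lemma good_root f : coef2 f 0 0 = 0 ->
  (forall s, coef2 (series_at f s) 0 0 = 0 -> is_mult (series_at f s) m) ->
  exists gam, [/\ z0 gam, nz gam & pull f gam = 0].
Proof.
move=> f00 fs; pose G k := series_at f (nseq k None).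
have GS k : G k.+1 = series_blowup (G k) None.
  by rewrite /G -[k.+1]addn1 nseqD /series_at foldl_cat.
have [[k [Gk [z rz]]]|nex] := pselect (exists k, coef2 (G k) 0 0 = 0 /\
    exists z, root (hp (G k) m) z).
  have gG : good (G k).
    split; first exact: fs.
    by move=> s; rewrite /G /series_at -foldl_cat; apply: fs.
  have [g1 g1m] := good_some gG rz; have [gam [h hn g0]] := some_chain_root g1 g1m.
  have f0 : f != 0 by apply: is_mult_neq0 (fs [::] f00).
  have [|r0 rn] := @root_push f (rcons (nseq k None) (Some z)) gam f0 h hn.
    by rewrite /series_at foldl_rcons.
  by exists (push (rcons (nseq k None) (Some z)) gam); split=> //; apply: push_z0.
have Gz k : coef2 (G k) 0 0 = 0.
  elim: k => [|k IH] //; have Gm : is_mult (G k) m by apply: fs.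
  rewrite GS (series_blowupE _ Gm) /coef2 /= add0n subn0.
  have hs : (size (hp (G k) m) <= 1)%N.
    by rewrite leqNgt; apply/negP => /closed_root rz; apply: nex; exists k.
  have := @coef_hp R (G k) m m; rewrite leqnn subnn => <-.
  exact: nth_default (leq_trans hs m0).
have [h _] := pullXe R; exists (0, fps_X); split; [exact: h|by right; apply: fpsX_neq0|].
apply: (chain0 (a := fun k => pull (G k) (0, fps_X)) m0) => k.
have Gm : is_mult (G k) m by apply: (fs _ (Gz k)).
have E : (0, fps_X : fps C) = pd None (0, fps_X) by rewrite /= mul0r.
by have := pull_pd None h Gm; rewrite -E -(series_blowupE _ Gm) -GS.
Qed.
End ConstantMultiplicity.

(** By induction on the multiplicity, which blow-ups do not increase: either it drops at some
    infinitely near point, or it is constant along all of them and [good_root] applies. *)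
Lemma branch_exists f : f != 0 -> coef2 f 0 0 = 0 ->
  exists gam, [/\ z0 gam, nz gam & pull f gam = 0].
Proof.
move=> f0; have [m fm] := is_mult_ex f0.
have [n] := ubnP m; elim: n m f f0 fm => // n IH m f f0 fm mn f00.
have [[s [k [s0 sk km]]]|nex] := pselect (exists s k,
    [/\ coef2 (series_at f s) 0 0 = 0, is_mult (series_at f s) k & (k < m)%N]).
  have [|//|gam [h hn g0]] := IH k (series_at f s) (series_at_neq0 s f0) sk.
    exact: leq_trans km mn.
  have [r0 rn] := root_push f0 h hn g0; exists (push s gam); split=> //; exact: push_z0.
apply: (good_root (is_mult_gt0 fm f00) f00) => s s0.
have [k sk] := is_mult_ex (series_at_neq0 s f0); suff -> : m = k by [].
apply/eqP; rewrite eqn_leq leqNgt; apply/andP; split.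
  by apply/negP => km; apply: nex; exists s, k.
have le s' g : forall i j, is_mult g i -> is_mult (series_at g s') j -> (j <= i)%N.
  elim: s' g => [|c s' IHs] g i j gi gj; first by rewrite (is_mult_uniq gi gj).
  have [l gl] := is_mult_ex (series_blowup_neq0 c (is_mult_neq0 gi)).
  exact: leq_trans (IHs _ _ _ gl gj) (mult_blowup_le gi gl).
exact: le fm sk.
Qed.

(** With p = X^n u and t = X v the equation becomes v^n u(X v) = 1, solved by Newton iteration with
    a frozen slope. *)
Lemma root_of_series (p : fps C) n : is_ord p n -> (0 < n)%N ->
  exists2 t : fps C, coefs t 0 = 0 & comp1 t p = fps_X ^+ n.
Proof.
move=> [pn /vgE[u pE]] n0; set u0 := coefs u 0.
have u00 : u0 != 0 by move: pn; rewrite {1}pE coefsXnM ltnn subnn.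
have [v0 v0E] : exists v0 : C, v0 ^+ n * u0 = 1.
  by exists (n.-root u0^-1); rewrite rootCK // mulVf.
have v00 : v0 != 0.
  apply: contra_eqN v0E => /eqP ->; rewrite expr0n gtn_eqF // mul0r eq_sym; exact: oner_neq0.
(* Imposing the constant term v0 makes the iteration contract from its first step; a fixed point has
   this constant term. *)
pose nv (v : fps C) : fps C := v - fps_const (coefs v 0) + fps_const v0.
have nv0 v : coefs (nv v) 0 = v0 by rewrite coefsD coefsB !coefsC subrr add0r.
pose U (v : fps C) : fps C := comp1 (fps_X * nv v) u.
have Xv0 v : coefs (fps_X * nv v) 0 = 0 by rewrite coefsXM.
have U0 v : coefs (U v) 0 = u0 by rewrite comp1_coef0.
(* The inverse of the derivative of v^n u0 at v0. *)
pose kap : C := (v0 ^+ n.-1 *+ n * u0)^-1.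
have kapE : kap * (v0 ^+ n.-1 *+ n * u0) = 1.
  by rewrite mulVf // mulf_neq0 // -mulr_natr mulf_neq0 ?expf_neq0 // pnatr_eq0 -lt0n.
pose Phi (v : fps C) : fps C := nv v - fps_const kap * (nv v ^+ n * U v - 1).
have Phi0 v : coefs (Phi v) 0 = v0.
  rewrite coefsB coefsCM coefsB coefs1 coefsM0 nv0 U0.
  have -> : coefs (nv v ^+ n) 0 = v0 ^+ n.
    elim: (n) => [|k IH]; first by rewrite !expr0 coefs1.
    by rewrite !exprS coefsM0 IH nv0.
  by rewrite v0E eqxx subrr mulr0 subr0.
have [|v vE] := @fps_fixpoint _ Phi.
  move=> [|k] v v' vv'.
    by apply: vg1; rewrite coefsB [X in X - _]Phi0 [X in _ - X]Phi0 subrr.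
  have v0' : coefs v 0 = coefs v' 0 by apply/eqP; rewrite -subr_eq0 -coefsB vv'.
  have nvv : nv v - nv v' = v - v' by rewrite /nv v0'; ring.
  have Uvv : vg k.+2 (U v - U v').
    apply: pull_congr; [exact: comp1_z0|exact: comp1_z0| |by rewrite subrr; apply: vgz].
    by rewrite /= -mulrBr nvv -add1n; apply: vgM => //; exact: (@vgXn _ 1).
  pose S := \sum_(i < n) nv v ^+ (n.-1 - i) * nv v' ^+ i.
  have dX : nv v ^+ n - nv v' ^+ n = (v - v') * S.
    by rewrite subrXX nvv; congr (_ * _); apply: eq_bigr => i _; rewrite -subn1 -subnDA add1n.
  have S0 : coefs S 0 = v0 ^+ n.-1 *+ n.
    have X0 w k' : coefs (nv w ^+ k') 0 = v0 ^+ k'.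
      elim: k' => [|k' IH]; first by rewrite !expr0 coefs1.
      by rewrite !exprS coefsM0 IH nv0.
    rewrite coefs_sum (eq_bigr (fun _ => v0 ^+ n.-1)); first by rewrite sumr_const card_ord.
    by move=> i _; rewrite coefsM0 !X0 -exprD subnK // -ltnS prednK.
  have -> : Phi v - Phi v' = (v - v') * (1 - fps_const kap * (S * U v)) -
      fps_const kap * (nv v' ^+ n * (U v - U v')).
    rewrite /Phi; have -> : nv v ^+ n = nv v' ^+ n + (v - v') * S by rewrite -dX addrC subrK.
    have -> : nv v = nv v' + (v - v') by rewrite -nvv addrC subrK.
    move: (nv v' ^+ n) (U v) (U v') (nv v') (v - v') (S) (fps_const kap) => A B B' a D s K.
    by ring.
  apply: vgB; last first.
    by rewrite -[k.+2]add0n; apply: vgM => //; rewrite -[k.+2]add0n; apply: vgM.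
  rewrite -addn1; apply: vgM => //; apply: vg1.
  by rewrite coefsB coefs1 coefsCM coefsM0 S0 U0 kapE subrr.
have v_0 : coefs v 0 = v0 by rewrite -vE Phi0.
have nvE : nv v = v by rewrite /nv v_0 subrK.
exists (fps_X * v); first by rewrite coefsXM.
have t0 : coefs (fps_X * v) 0 = 0 by rewrite coefsXM.
rewrite pE (comp1M _ _ t0) (comp1Xn _ _ t0) (comp1X t0) exprMn -mulrA.
move: vE; rewrite /Phi /U nvE => /eqP; rewrite subr_eq addrC -subr_eq subrr eq_sym.
rewrite mulf_eq0 subr_eq0 => /orP[/eqP k0|/eqP ->]; last by rewrite mulr1.
have : kap == 0 by have := congr1 (fun p => coefs p 0) k0; rewrite coefsC coefs0 => /= ->.
by move/eqP=> k00; move/eqP: kapE; rewrite k00 mul0r eq_sym oner_eq0.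
Qed.

(** A branch (p, q) with p of order n is reparametrized so that p becomes t^n; then the largest d
    dividing n and the exponents of the other component is removed by replacing t^d with t. *)
Lemma puiseux_exists f : f != 0 -> coef2 f 0 0 = 0 -> exists gam, is_puiseux f gam.
Proof.
move=> f0 f00; have [[p q] [h hn fg]] := branch_exists f0 f00; have [/= p0 q0] := h.
have [pz|pn] := eqVneq p 0.
  exists (0, fps_X ^+ 1), 1%N, 0; split; [by []|exact: coefs0|by right| |].
    by move=> d; rewrite dvdn1 => /eqP.
  have [z01 _] := pullXe R; rewrite expr1.
  have := axis_comp (c := Some 0) f h pz; rewrite fg => /esym/eqP E.
  apply/eqP; apply: contraTT E => E; apply: comp1_neq0 => //=.
  by case: hn => //=; rewrite pz eqxx.
have n0 : (0 < ord p)%N by apply: ord_gt0.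
have [t t0 tp] := root_of_series (is_ord_ex pn) n0.
set n := ord p in n0 tp; set phi := comp1 t q.
have fphi : pull f (fps_X ^+ n, phi) = 0.
  by rewrite -tp -(comp1_pull f t0 h) fg (comp1E t0) rmorph0.
have phi0 : coefs phi 0 = 0 by rewrite comp1_coef0.
pose P d := (d %| n)%N && `[< forall i, coefs phi i != 0 -> (d %| i)%N >].
have P1 : P 1%N by rewrite /P dvd1n; apply/asboolP => i _; apply: dvd1n.
have Pn d : P d -> (d <= n)%N by move=> /andP[dn _]; apply: dvdn_leq.
have exP : exists d, P d by exists 1%N.
pose d := ex_maxn exP Pn; have [/andP[dn /asboolP dphi] dmax] : P d /\ forall d', P d' -> (d' <=
  d)%N.
  by rewrite /d; case: ex_maxnP.
have d0 : (0 < d)%N by apply: dvdn_gt0 dn.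
pose phi1 : fps C := Fps (fun i => coefs phi (d * i)).
have Xd0 : coefs (fps_X ^+ d : fps C) 0 = 0 by rewrite coefsXn ltn_eqF.
have phi1E : comp1 (fps_X ^+ d) phi1 = phi.
  apply: fpsP => i; rewrite [LHS]comp1_coefs.
  have [di|ndi] := boolP (d %| i)%N; last first.
    rewrite big1 => [|k _].
      by apply/esym/eqP; apply: contraNT ndi; apply: dphi.
    rewrite -exprM coefsXn (_ : (i == _)%N = false) ?mulr0 //.
    by apply: contraNF ndi => /eqP ->; apply: dvdn_mulr.
  have ii : (i %/ d < i.+1)%N by rewrite ltnS leq_div.
  apply: etrans (sum_ord_single (F := fun k => coefs phi1 k * coefs ((fps_X ^+ d) ^+ k) i) ii _) _.
    move=> k _ ki; rewrite -exprM coefsXn (_ : (i == _)%N = false) ?mulr0 //.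
    by apply: contraNF ki => /eqP ->; rewrite mulKn.
  by rewrite -exprM coefsXn /= [(d * _)%N]mulnC divnK // eqxx mulr1.
have phi10 : coefs phi1 0 = 0 by rewrite /= muln0.
have nd0 : (0 < n %/ d)%N by rewrite (divn_gt0 _ d0); apply: dvdn_leq n0 dn.
exists (fps_X ^+ (n %/ d), phi1), (n %/ d)%N, phi1; split; [exact: nd0|exact: phi10|by left| |].
  move=> d' d'n d'phi; have d'0 : (0 < d')%N by apply: dvdn_gt0 d'n.
  have : (d * d' <= d)%N.
    apply: dmax; rewrite /P -{1}(divnK dn) [(d * d')%N]mulnC (dvdn_pmul2r d0) d'n andTb.
    apply/asboolP => i pi; have di := dphi i pi; rewrite -(divnK di) (dvdn_pmul2r d0).
    by apply: d'phi; rewrite /= mulnC (divnK di).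
  rewrite -{2}[d]muln1 (leq_pmul2l d0) => d'1; apply/eqP; rewrite eqn_leq d'1; exact: d'0.
have h1 : z0 (fps_X ^+ (n %/ d) : fps C, phi1).
  split; [rewrite [LHS]coefsXn (ltn_eqF nd0); reflexivity|exact: phi10].
apply/eqP; apply: contraTT isT => E.
have := @comp1_neq0 R (fps_X ^+ d) _ Xd0 _ E; rewrite (comp1_pull f Xd0 h1) /= phi1E.
rewrite (comp1Xn _ _ Xd0) (comp1X Xd0) -exprM mulnC (divnK dn) fphi eqxx => H.
by apply: H; apply: expf_neq0; apply: fpsX_neq0.
Qed.
End Puiseux.

Lemma ord_fpsX (K : comNzRingType) : ord (fps_X : fps K) = 1%N.
Proof. exact: (ordXn K 1). Qed.

(** * Zeros of a binary form on the exceptional line *)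

Section GermSum.
Variable R : realType.
Notation C := (complex R).
Implicit Types (P Q : {poly C}) (c : option C) (z a : C).

Lemma germ_mul_some m Q a z :
  germ m.+1 (('X - a%:P) * Q) (Some z) = (fps_X + fps_const (z - a)) * germ m Q (Some z).
Proof.
apply: fpsP => n; rewrite [X in _ = coefs X _]mulrDl [RHS]coefsD coefsXM coefsCM /= comp_polyM
  comp_polyB comp_polyX comp_polyC.
by rewrite -addrA -polyCB mulrDl coefD coefXM coefCM; case: n.
Qed.

Lemma germ_mul_none m Q a : (size Q <= m.+1)%N ->
  germ m.+1 (('X - a%:P) * Q) None = (1 - fps_const a * fps_X) * germ m Q None.
Proof.
move=> sQ; apply: fpsP => n; rewrite [X in _ = coefs X _]mulrBl [1 * _]mul1r -mulrA [RHS]coefsB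
  coefsCM coefsXM /=.
rewrite mulrBl coefB coefXM coefCM; case: n => [|n] /=.
  by rewrite !subn0 (nth_default _ sQ) !mulr0.
rewrite ltnS subSS; case: (ltngtP n m) => nm.
- by rewrite subn_eq0 leqNgt nm /= -subnS.
- by rewrite mulr0 subr0.
- by rewrite nm subnn /=.
Qed.

Lemma ord_unitM (u p : fps C) : coefs u 0 != 0 -> p != 0 -> ord (u * p) = ord p.
Proof.
move=> u0 p0; have un : u != 0 by apply: contraNneq u0 => ->; rewrite coefs0.
by rewrite (ordM un p0) (ord_eq0 u0).
Qed.

Lemma ord_germ_mul m Q a c : Q != 0 -> (size Q <= m.+1)%N ->
  ord (germ m.+1 (('X - a%:P) * Q) c) = ((c == Some a) + ord (germ m Q c))%N.
Proof.
move=> Q0 sQ; have g0 : germ m Q c != 0.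
  by have [n _] := germ_neq0 c Q0 sQ; apply: contraNneq => ->; rewrite coefs0.
case: c g0 => [z|] g0; last first.
  by rewrite (germ_mul_none _ sQ) ord_unitM // coefsB coefs1 coefsCM /= mulr0 subr0 oner_neq0.
rewrite germ_mul_some (inj_eq (@Some_inj _)); have [za|za] := eqVneq z a.
  rewrite za in g0 *.
  rewrite subrr rmorph0 addr0; apply: ordE; apply: (@is_ordM _ _ _ 1).
    exact: (is_ordXn _ 1).
  exact: (is_ord_ex g0).
by rewrite ord_unitM // coefsD coefsC /= add0r subr_eq0.
Qed.

(** A form of degree m has m zeros on P^1, the defect of degree of P being the order at [None]. The
    sum may run over any finite set of directions containing [K0], so that several such sums can be
    compared over a common one. *)
Lemma germ_sum m P : P != 0 -> (size P <= m.+1)%N ->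
  exists K0 : seq (option C), forall K, uniq K -> {subset K0 <= K} ->
    (\sum_(c <- K) ord (germ m P c))%N = m.
Proof.
elim: m P => [|m IH] P P0 sP.
  exists [::] => K _ _; rewrite big1 // => c _; apply: ord_eq0.
  by have [[|n]] := germ_neq0 c P0 sP.
have [s1|s1] := leqP (size P) 1.
  exists [:: None] => K uK KK; have NK : None \in K by apply: KK; rewrite inE.
  have [p pE] : exists p, P = p%:P by exists P`_0; apply: size1_polyC.
  have p0 : p != 0 by apply: contraNneq P0 => p0; rewrite pE p0.
  rewrite (bigD1_seq None) //= big1 ?addn0 => [|[z|] //= _].
    apply: ordE; split; first by rewrite /= leqnn subnn pE coefC.
    by move=> n nm; rewrite /= (ltnW nm) pE coefC subn_eq0 leqNgt nm.
  by apply: ord_eq0; rewrite /= pE comp_polyC coefC.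
have [a /factor_theorem [Q QE]] := closed_root s1.
have Q0 : Q != 0 by apply: contraNneq P0 => Q0; rewrite QE Q0 mul0r.
have sQ : (size Q <= m.+1)%N.
  by move: sP; rewrite QE size_mul ?polyXsubC_eq0 // size_XsubC addn2.
have [K0 K0P] := IH Q Q0 sQ; exists (Some a :: K0) => K uK KK.
transitivity (\sum_(c <- K) ((c == Some a) + ord (germ m Q c)))%N.
  by apply: eq_bigr => c _; rewrite QE mulrC ord_germ_mul.
rewrite big_split /= K0P // => [|c cK]; last by apply: KK; rewrite inE cK orbT.
have aK : Some a \in K by apply: KK; rewrite inE eqxx.
rewrite (bigD1_seq (Some a)) //= eqxx big1 => [|c /negPf -> //]; lia.
Qed.
End GermSum.

(** * Factorization into branches *)

Section Factor.
Variable R : realType.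
Notation C := (complex R).
Implicit Types (f g h u : series2 R) (gam : fps C * fps C) (c : option C) (B : curve R).

Lemma curve_irr B : irreducible (eqn B).
Proof. by have /andP[/asboolP] := valP B. Qed.
Lemma eqn_neq0 B : eqn B != 0. Proof. by case: (curve_irr B). Qed.
Lemma eqn_nonunit B : eqn B \isn't a GRing.unit. Proof. by case: (curve_irr B). Qed.
Lemma eqn00 B : coef2 (eqn B) 0 0 = 0.
Proof. by have := eqn_nonunit B; rewrite series2_unitE negbK => /eqP. Qed.

Lemma puiseuxP B : is_puiseux (eqn B) (puiseux B).
Proof.
have [gam g] := puiseux_exists (eqn_neq0 B) (eqn00 B); exact: (xgetPex _ (ex_intro _ gam g)).
Qed.
Lemma genB B : gen (eqn B) (puiseux B).
Proof. exact: puiseux_gen (curve_irr B) (puiseuxP B). Qed.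

Lemma divides_mull f g h : divides f g -> divides f (h * g).
Proof. by move=> [a ->]; exists (h * a); rewrite mulrA. Qed.
Lemma divides_mulr f g h : divides f g -> divides f (g * h).
Proof. by rewrite mulrC; apply: divides_mull. Qed.

Lemma pull_unit u gam : u \is a GRing.unit -> pull u gam != 0.
Proof.
rewrite series2_unitE; apply: contraNneq => E.
by have := pull_coef0 gam u; rewrite E coefs0 => <-.
Qed.

Lemma gen_prime f gam g h : gen f gam -> divides f (g * h) -> divides f g \/ divides f h.
Proof.
move=> [gz _ gk _] /gk; rewrite (pullM _ _ gz) => /eqP; rewrite mulf_eq0.
by case/orP => /eqP /gk; [left|right].
Qed.

(** The multiplicity is additive, and positive on non-units, so splitting into factors
    terminates. *)
Lemma factorization f : f != 0 -> exists u (s : seq (curve R)),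
  u \is a GRing.unit /\ f = u * \prod_(B <- s) eqn B.
Proof.
move=> f0; have [m fm] := is_mult_ex f0; have [n] := ubnP m.
elim: n m f f0 fm => // n IH m f f0 fm mn.
have [fu|fnu] := boolP (f \is a GRing.unit); first by exists f, [::]; rewrite big_nil mulr1.
have [fI|nI] := pselect (irreducible f).
  have [B [[v vu vE] _]] := curve_ofP fI; exists v^-1, [:: B].
  by rewrite unitrV big_seq1 vE mulKr.
have [g [h [fE gnu hnu]]] : exists g h, [/\ f = g * h, g \isn't a GRing.unit & h \isn't a
  GRing.unit].
  apply: contrapT => nex; apply: nI; split=> // g h fE.
  have [gu|gnu] := boolP (g \is a GRing.unit); first by left.
  right; apply: contrapT => /negP hnu; case: nex; exists g, h; split.
  - exact: fE.
  - exact: gnu.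
  - exact: hnu.
have g0 : g != 0 by apply: contraNneq f0 => g0; rewrite fE g0 mul0r.
have h0 : h != 0 by apply: contraNneq f0 => h0; rewrite fE h0 mulr0.
have [i gi] := is_mult_ex g0; have [j hj] := is_mult_ex h0.
have mE : m = (i + j)%N by apply: is_mult_uniq fm _; rewrite fE; apply: is_multM.
have i0 : (0 < i)%N by rewrite lt0n; apply: contraNneq gnu => i0; apply/is_mult0; rewrite -i0.
have j0 : (0 < j)%N by rewrite lt0n; apply: contraNneq hnu => j0; apply/is_mult0; rewrite -j0.
have [|u [s [uu gE]]] := IH i g g0 gi; first by lia.
have [|v [t [vu hE]]] := IH j h h0 hj; first by lia.
exists (u * v), (s ++ t); rewrite unitrM uu vu big_cat fE gE hE; split; [by []|exact: mulrACA].
Qed.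

Lemma eqn_divides B B' : divides (eqn B) (eqn B') -> B = B'.
Proof.
move=> [h hE]; have [B0 [_ uB0]] := curve_ofP (curve_irr B).
have [_ _ /(_ _ _ hE)[hu|Bu]] := curve_irr B'; last by have /negP := eqn_nonunit B; case.
rewrite -(uB0 B (associated_refl _)); apply: uB0; exists h => //.
Qed.

Lemma multiplicityE f g n : f != 0 -> g != 0 ->
  divides (f ^+ n) g -> ~ divides (f ^+ n.+1) g -> multiplicity f g = n.
Proof.
move=> f0 g0 dn ndn; apply: xget_unique => // m [dm ndm].
have le i j : (i <= j)%N -> divides (f ^+ j) g -> divides (f ^+ i) g.
  by move=> ij [h ->]; exists (h * f ^+ (j - i)); rewrite -mulrA -exprD subnK.
by case: (ltngtP m n) => // mn; [case: ndm|case: ndn]; apply: le (mn) _.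
Qed.

Lemma prod_notin B (s : seq (curve R)) : B \notin s ->
  ~ divides (eqn B) (\prod_(B' <- s) eqn B').
Proof.
elim: s => [_|B' s IH]; rewrite ?big_nil ?big_cons.
  case=> h hE; have /negP := eqn_nonunit B; apply; apply/unitrPr; exists h.
  by rewrite mulrC -hE.
rewrite inE negb_or => /andP[BB' Bs] /(gen_prime (genB B))[/eqn_divides E|]; last exact: IH.
by rewrite E eqxx in BB'.
Qed.

Lemma prod_count B (s : seq (curve R)) : \prod_(B' <- s) eqn B' =
  eqn B ^+ count_mem B s * \prod_(B' <- [seq B' <- s | B' != B]) eqn B'.
Proof.
elim: s => [|B' s IH]; first by rewrite !big_nil mulr1.
rewrite big_cons IH /=; have [->|nB] := eqVneq B' B.
  by rewrite /= add1n exprS -mulrA.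
by rewrite /= add0n big_cons mulrCA.
Qed.

Lemma multiplicity_prod B u (s : seq (curve R)) : u \is a GRing.unit ->
  multiplicity (eqn B) (u * \prod_(B' <- s) eqn B') = count_mem B s.
Proof.
move=> uu; have B0 := eqn_neq0 B; apply: multiplicityE => //.
- rewrite mulf_neq0 //; first by apply: contraTneq uu => ->; rewrite unitr0.
  elim: s => [|B' s IH]; rewrite ?big_nil ?big_cons ?oner_neq0 //.
  exact: mulf_neq0 (eqn_neq0 B') IH.
- by rewrite (prod_count B); apply/divides_mull/divides_mulr; exists 1; rewrite mul1r.
rewrite (prod_count B) exprS => -[h E0].
have E : u * \prod_(B' <- [seq B' <- s | B' != B]) eqn B' = h * eqn B.
  apply: (mulIf (expf_neq0 (count_mem B s) B0)); rewrite -[RHS]mulrA -E0.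
  by rewrite -mulrA [_ * (eqn B ^+ _)]mulrC.
have : divides (eqn B) (u * \prod_(B' <- [seq B' <- s | B' != B]) eqn B') by exists h; rewrite -E.
case/(gen_prime (genB B)) => [[k kE]|]; last by apply: prod_notin; rewrite mem_filter eqxx.
by move: uu; rewrite kE unitrM (negPf (eqn_nonunit B)) andbF.
Qed.

Lemma fps_dvd (p q : fps C) : p != 0 -> vg (ord p) q -> exists r, q = p * r.
Proof.
move=> p0 /vgE[q1 ->]; have [pn /vgE[p1 pE]] := is_ord_ex p0.
have p1u : p1 \is a GRing.unit.
  by rewrite fps_unitE unitfE; move: pn; rewrite {1}pE coefsXnM ltnn subnn.
by exists (p1^-1 * q1); rewrite {2}pE -!mulrA mulVKr.
Qed.

(* The conductor of [B] puts [v ^+ M / h], of large order along the branch, into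
   the local ring of [B]. *)
Lemma power_in_ideal B h v : coef2 v 0 0 = 0 -> ~ divides (eqn B) h ->
  exists M a, divides (eqn B) (v ^+ M - h * a).
Proof.
move=> v00 nd; have [gz _ gk [c cP]] := genB B.
have h0 : pull h (puiseux B) != 0 by apply/eqP => /gk.
pose N := ord (pull h (puiseux B)).
have vN : vg (N + c) (pull v (puiseux B) ^+ (N + c)).
  rewrite -[X in vg X _]mul1n; apply: vg_exp; apply: vg1; by rewrite pull_coef0.
have [r rE] := fps_dvd h0 (vg_le (leq_addr c N) vN).
have rc : vg c r.
  have [->|r0] := eqVneq r 0; first exact: vgz.
  apply: (@vg_le _ c (ord r)); last exact: ord_vg.
  have := vN; rewrite rE => /(vg_ord (mulf_neq0 h0 r0)); rewrite (ordM h0 r0) -/N.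
  by rewrite leq_add2l.
have [a aE] := cP r rc; exists (N + c)%N, a; apply/gk.
by rewrite (pullB _ _ gz) (pullXn _ _ gz) (pullM _ _ gz) aE rE subrr.
Qed.

(** A Nullstellensatz: if h vanishes along [gam] without being divisible by [eqn B], every series
    without constant term has a power in the ideal of h and [eqn B], so x and y vanish along [gam].
    Unlike in [gen], the parametrization may be non-primitive. *)
Lemma pull_ker_curve B gam : z0 gam -> nz gam -> pull (eqn B) gam = 0 ->
  forall h, pull h gam = 0 <-> divides (eqn B) h.
Proof.
move=> gz gn gB h; split=> [g0|[a ->]]; last by rewrite (pullM _ _ gz) gB mulr0.
apply: contrapT => nd.
have z v : coef2 v 0 0 = 0 -> pull v gam = 0.
  move=> v0; have [M [a [b abE]]] := power_in_ideal v0 nd.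
  have : pull v gam ^+ M = 0.
    apply: etrans (esym (pullXn _ _ gz)) _.
    have -> : v ^+ M = h * a + b * eqn B by rewrite -abE addrC subrK.
    by rewrite (pullD _ _ gz) (pullM _ _ gz) (pullM _ _ gz) g0 gB mul0r mulr0 addr0.
  by move/eqP; rewrite expf_eq0 => /andP[_ /eqP].
have := z (varX R); rewrite coef2X (pullX gz) => /(_ erefl) x0.
have := z (varY R); rewrite coef2Y (pullY gz) => /(_ erefl) y0.
by case: gn; rewrite ?x0 ?y0 eqxx.
Qed.

(** The arc is killed by a nonzero series, x or the one from Cayley-Hamilton, and then by one of its
    irreducible factors. *)
Lemma branch_curve gam : z0 gam -> nz gam ->
  exists B, forall h, pull h gam = 0 <-> divides (eqn B) h.
Proof.
move=> gz gn; have [chi chi0 gchi] : exists2 chi : series2 R, chi != 0 & pull chi gam = 0.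
  case: gam gz gn => p q /= gz gn; have [q0 p0] := gz.
  have [pz|pn] := eqVneq p 0.
    exists (varX R); last by rewrite (pullX gz).
    by apply/eqP => /(congr1 (fun f => coef2 f 1 0)); rewrite coef2X coef20 => /eqP; rewrite
      oner_eq0.
  have [chi [g0 c1 _]] := pull_kernel_monic (is_ord_ex pn) (ord_gt0 pn q0) p0.
  exists chi => //; apply/eqP => /(congr1 (fun f => coef2 f 0 (ord p))); rewrite c1 coef20.
  by move/eqP; rewrite oner_eq0.
have [u [s [uu E]]] := factorization chi0.
suff [B BP] : exists B, pull (eqn B) gam = 0 by exists B; apply: pull_ker_curve.
move: gchi; rewrite E (pullM _ _ gz) => /eqP; rewrite mulf_eq0 (negPf (pull_unit _ uu)) /=.
elim: s {E} => [|B s IH]; rewrite ?big_nil ?big_cons.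
  by rewrite (pull1 gz) oner_eq0.
by rewrite (pullM _ _ gz) mulf_eq0 => /orP[/eqP ?|/IH]; first by exists B.
Qed.

Lemma gen_exc c : gen (exc c : series2 R) (epar c).
Proof.
split; [exact: z0_epar| |by move=> h; split=> /exc_dvd|].
  by case: c => [z|]; [right|left]; apply: fpsX_neq0.
exists 0%N => h _; case: c => [z|]; last first.
  by exists (fps_const h); apply: fpsP => n; rewrite pull_axis2 coef2_fps_const.
exists (swap (fps_const h)); apply: fpsP => n.
by rewrite pull_axis1 coef2_swap coef2_fps_const.
Qed.

Lemma gen_neq0 f gam : gen f gam -> f != 0.
Proof.
case=> gz gn gk _; apply/eqP => f0.
have d v : pull v gam = 0 -> v = 0 by move/gk => [a ->]; rewrite f0 mulr0.
have [B BP] := branch_curve gz gn.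
have /d /eqP : pull (eqn B) gam = 0 by apply/BP; exists 1; rewrite mul1r.
by apply/negP; apply: eqn_neq0.
Qed.

(** Let n be the order of the exceptional equation along [gam]. Downstairs, the coordinate line
    [exc c] meets f with multiplicity n, so m <= n. Upstairs, the curve B of [gam] divides the
    strict transform and meets the exceptional line n times, whereas the strict transform meets it m
    times over all directions. Hence m = n, the cofactor of B is a unit, and no other direction is
    met. *)
Lemma gen_step f c gam : z0 gam -> gen f (pd c gam) ->
  gen (series_blowup f c) gam /\
  forall c', coef2 (series_blowup f c') 0 0 = 0 -> c' = c.
Proof.
move=> gz fg; have f0 := gen_neq0 fg; have [gz1 gn1 gk [k kP]] := fg.
have e0 := pd_nz_excv gn1; pose n := ord (excv c gam).
have gn : nz gam by move: e0; case: (c) => [z|] /=; [left|right].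
have [m fm] := is_mult_ex f0; have hm := proj1 fm; have sm := size_hp f m.
have pex : pull (exc c) (pd c gam) = excv c gam.
  by move: gz1; case: (c) => [z|] /= gz1; [rewrite (pullX gz1)|rewrite (pullY gz1)].
have cop : pull f (epar c) != 0.
  apply/eqP => /exc_dvd[r rE].
  have : pull f (pd c gam) = 0 by apply/gk; exists 1; rewrite mul1r.
  rewrite rE (pullM _ _ gz1) pex => /eqP; rewrite mulf_eq0 (negPf e0) orbF => /eqP /gk[a aE].
  have E : 1 = a * exc c.
    by apply: (mulIf f0); rewrite mul1r {1}rE aE mulrAC.
  have := congr1 (fun f => pull f (epar c)) E; rewrite (pullM _ _ (z0_epar c)) pull_exc_epar mulr0.
  by rewrite (pull1 (z0_epar c)) => /eqP; rewrite oner_eq0.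
have mn : (m <= n)%N.
  have : ord (pull f (epar c)) = n.
    rewrite -(inter_gen (gen_exc c) cop) inter_sym (inter_gen fg) ?pex //.
  have [fn _] := is_ord_ex cop; move=> E; move: fn; rewrite E => fn; rewrite leqNgt.
  apply/negP => nm; move/eqP: fn; apply; have H := @is_mult_vg2 _ _ _ fm.
  case: (c) => [z|]; first exact: etrans (pull_axis1 f n) (H 0%N n nm).
  by apply: etrans (pull_axis2 f n) (H n 0%N _); rewrite addn0.
have fc0 : pull (series_blowup f c) gam = 0.
  have : pull f (pd c gam) = 0 by apply/gk; exists 1; rewrite mul1r.
  rewrite (pull_pd c gz fm) -(series_blowupE c fm) => /eqP; rewrite mulf_eq0.
  by rewrite (negPf (expf_neq0 _ e0)) => /eqP.
have [B BP] := branch_curve gz gn.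
have Bg : gen (eqn B) gam.
  (* The conductor downstairs serves upstairs, since series lift through the chart. *)
  split=> //; exists k => h /kP[g gE]; exists (subst2 g (chart c).1 (chart c).2).
  have [h1 h2] := chart00 c; by rewrite (pull_subst2 _ gz h1 h2) -(pdE _ gz).
have [r rE] := (BP _).1 fc0.
have bc0 := series_blowup_axis c f0.
have [r0 B0] : pull r (epar c) != 0 /\ pull (eqn B) (epar c) != 0.
  by apply/andP; rewrite -negb_or -mulf_eq0 -(pullM _ _ (z0_epar c)) -rE.
have oB : ord (pull (eqn B) (epar c)) = n.
  by rewrite -(inter_gen (gen_exc c) B0) inter_sym (inter_gen Bg) (pull_exc _ gz).
have oc : ord (pull (series_blowup f c) (epar c)) = (ord (pull r (epar c)) + n)%N.
  by rewrite rE (pullM _ _ (z0_epar c)) (ordM r0 B0) oB.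
have gE c' : pull (series_blowup f c') (epar c') = germ m (hp f m) c'.
  by rewrite (series_blowupE _ fm) pull_epar.
have [K0 K0P] := germ_sum hm sm.
pose K c' := undup [:: c, c' & K0].
have KP c' : (\sum_(c0 <- K c') ord (germ m (hp f m) c0))%N = m.
  by apply: K0P; rewrite ?undup_uniq // => x xK; rewrite mem_undup !inE xK !orbT.
have KD c' : (ord (germ m (hp f m) c) + \sum_(c0 <- K c' | c0 != c) ord (germ m (hp f m) c0))%N = m.
  by rewrite -[RHS](KP c') [RHS](bigD1_seq c) ?undup_uniq // mem_undup !inE eqxx.
have rr : ord (pull r (epar c)) = 0%N.
  have := KD c; rewrite -gE oc; lia.
have ru : r \is a GRing.unit.
  rewrite series2_unitE; have [h _] := is_ord_ex r0; by rewrite rr pull_coef0 in h.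
split.
  split; [exact: gz|exact: gn| |by have [_ _ _] := Bg].
  move=> h; split=> [/BP[a ->]|[a ->]]; last by rewrite (pullM _ _ gz) fc0 mulr0.
  by exists (a * r^-1); rewrite rE -mulrA mulKr.
move=> c' c'0; apply/eqP; apply: contraT => nc.
have := KD c'; rewrite -gE oc rr add0n => E.
have : (0 < ord (germ m (hp f m) c'))%N.
  rewrite -gE; apply: ord_gt0; [exact: series_blowup_axis|by rewrite pull_coef0].
suff : (ord (germ m (hp f m) c') <= \sum_(c0 <- K c' | c0 != c) ord (germ m (hp f m) c0))%N.
  by move: E; lia.
rewrite (big_rem c') /= ?nc ?leq_addr //.
by rewrite mem_undup !inE eqxx orbT.
Qed.

(** The direction is the value of q / p at 0 when q has at least the order of p, and [None]
    otherwise. *)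
Lemma direction_exists gam : z0 gam -> nz gam -> exists c gam', z0 gam' /\ gam = pd c gam'.
Proof.
case: gam => p q [/= p0 q0] gn.
have [[pn pq]|npq] := pselect (p != 0 /\ vg (ord p) q).
  have [r rE] := fps_dvd pn pq; exists (Some (coefs r 0)), (p, r - fps_const (coefs r 0)).
  split; first by split; rewrite //= coefsB coefsC subrr.
  by rewrite /= subrK -rE.
have qn : q != 0.
  apply/eqP => qz; apply: npq; rewrite qz; split; last exact: vgz.
  by case: gn; rewrite //= qz eqxx.
have [r rE] : exists r, p = q * r.
  have [->|pn] := eqVneq p 0; first by exists 0; rewrite mulr0.
  apply: (fps_dvd qn); have [pq|qp] := leqP (ord p) (ord q).
    by case: npq; split=> //; apply: vg_le pq (ord_vg qn).
  exact: vg_le (ltnW qp) (ord_vg pn).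
exists None, (r, q); split; last by rewrite /= mulrC -rE.
split=> //=; apply/eqP; apply: contraT => r0; case: npq.
have pn : p != 0.
  rewrite rE mulf_neq0 //; apply: contraNneq r0 => ->; by rewrite coefs0.
split=> //; rewrite rE mulrC ord_unitM //; exact: ord_vg.
Qed.

Lemma unit_blowup f c : coef2 f 0 0 != 0 -> coef2 (series_blowup f c) 0 0 != 0.
Proof.
move=> f0; have fu : is_mult f 0 by apply/is_mult0; rewrite series2_unitE.
rewrite (series_blowupE c fu) -(pull_coef0 (epar c)) pull_epar.
by have [[|n]] := germ_neq0 c (proj1 fu) (size_hp f 0).
Qed.

Lemma passes_prefix f s s' : passes f (s ++ s') -> passes f s.
Proof.
rewrite /passes /series_at foldl_cat => E; apply/eqP; apply: contraTT isT => n.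
move: E n; set g := foldl _ _ s; elim: s' g => [|c s' IH] g /=; first by move=> ->; rewrite eqxx.
by move=> E /(unit_blowup c); apply: IH E.
Qed.

Lemma passes_uniq f gam s s' : gen f gam -> size s = size s' ->
  passes f s -> passes f s' -> s = s'.
Proof.
elim: s s' f gam => [|c s IH] [|c' s'] //= f gam fg [ss] fs fs'.
have [gz gn _ _] := fg; have [d [gam' [gz' gE]]] := direction_exists gz gn.
rewrite gE in fg; have [fd du] := gen_step gz' fg.
have /du E : passes f [:: c] by apply: (@passes_prefix f [:: c] s).
have /du E' : passes f [:: c'] by apply: (@passes_prefix f [:: c'] s').
rewrite E E' in fs fs' *; congr cons; exact: IH fd ss fs fs'.
Qed.
End Factor.

(** * Blowing up foliations *)

Section Forms.
Variable R : realType.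
Notation C := (complex R).
Implicit Types (f g h : series2 R) (gam : fps C * fps C) (c : option C) (w z : oneform R) (b :
  bool).

Lemma strict_pairE (e : series2 R) w z m : e != 0 -> w = (e ^+ m * z.1, e ^+ m * z.2) ->
  ~ (divides e z.1 /\ divides e z.2) -> strict_pair e w = z.
Proof.
move=> e0 wE ez.
have := @xgetPex _ (0, 0) [set z | (exists m, w = (e ^+ m * z.1, e ^+ m * z.2)) /\
  ~ (divides e z.1 /\ divides e z.2)] (ex_intro _ z (conj (ex_intro _ m wE) ez)).
rewrite -/(strict_pair e w) => -[[n wn] en]; set z' := strict_pair e w in wn en *.
have aux (a a' : oneform R) k l : e ^+ k * a.1 = e ^+ l * a'.1 -> e ^+ k * a.2 = e ^+ l * a'.2 ->
    ~ (divides e a.1 /\ divides e a.2) -> (k <= l)%N -> a = a'.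
  move=> + + ea kl; rewrite -(subnKC kl) exprD -!mulrA.
  move=> /(mulfI (expf_neq0 _ e0)) E1 /(mulfI (expf_neq0 _ e0)) E2.
  case: (l - k)%N E1 E2 => [|d] E1 E2.
    by case: a a' E1 E2 {ea} => [a1 a2] [a1' a2']; rewrite /= !expr0 !mul1r => -> ->.
  case: ea; rewrite E1 E2 exprS.
  by split; [exists (e ^+ d * a'.1)|exists (e ^+ d * a'.2)]; ring.
have E1 : e ^+ m * z.1 = e ^+ n * z'.1 := congr1 fst (etrans (esym wE) wn).
have E2 : e ^+ m * z.2 = e ^+ n * z'.2 := congr1 snd (etrans (esym wE) wn).
have [mn|/ltnW nm] := leqP n m; first exact: (aux z' z n m (esym E1) (esym E2) en mn).
exact: esym (aux z z' m n E1 E2 ez nm).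
Qed.

(* [b] stands for the axis x = 0 when true and y = 0 when false: [par b]
   parametrizes it, [dirb b] is its direction, [trv b w] vanishes along it iff
   it is invariant, and the order of [lng b w] along it is then its index. *)
Definition par b : fps C * fps C := if b then (0, fps_X) else (fps_X, 0).
Definition typ c := if c is Some _ then true else false.
Definition dirb b : option C := if b then None else Some 0.
Definition trv b w : series2 R := if b then w.2 else w.1.
Definition lng b w : series2 R := if b then w.1 else w.2.

Lemma par_typ c : par (typ c) = epar c. Proof. by case: c. Qed.
Lemma par_z0 b : z0 (par b).
Proof. by have [h1 h2] := pullXe R; case: b. Qed.

Definition is_multw w m := (hp w.1 m != 0 \/ hp w.2 m != 0) /\
  forall i, (i < m)%N -> hp w.1 i = 0 /\ hp w.2 i = 0.
(* The lowest-degree part of [w(x d/dx + y d/dy)], dehomogenized: zero iff the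
   blow-up is dicritical. *)
Definition hpQ w m : {poly C} := hp w.1 m + 'X * hp w.2 m.

Lemma is_multw_ex w : w <> (0, 0) -> exists m, is_multw w m.
Proof.
move=> w0; pose P m := (hp w.1 m != 0) || (hp w.2 m != 0).
have [|m Pm mm] := @ex_minnP P.
  case: w w0 @P => a b w0 P.
  have [a0|/is_mult_ex [m [am _]]] := eqVneq a 0; last by exists m; rewrite /P am.
  have /is_mult_ex [m [bm _]] : b != 0 by apply: contra_not_neq w0 => ->; rewrite a0.
  by exists m; rewrite /P bm orbT.
exists m; split; first exact/orP.
move=> i im; have : ~~ P i by apply/negP => /mm; rewrite leqNgt im.
by rewrite negb_or !negbK => /andP[/eqP -> /eqP ->].
Qed.

Lemma size_hpQ w m : (size (hpQ w m) <= m.+2)%N.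
Proof.
apply: leq_trans (size_polyD _ _) _; rewrite geq_max (leq_trans (size_hp _ _)) ?leqnSn //=.
by apply: leq_trans (size_polyMleq _ _) _; rewrite size_polyX add2n ltnS; apply: size_hp.
Qed.

Lemma germD m (P Q : {poly C}) c : germ m (P + Q) c = germ m P c + germ m Q c.
Proof.
apply: fpsP => n; rewrite [RHS]coefsD; case: c => [z|] /=.
  by rewrite comp_polyD coefD.
by rewrite coefD; case: ifP => // _; rewrite addr0.
Qed.
Lemma germ_X_some m (P : {poly C}) (z : C) :
  germ m.+1 ('X * P) (Some z) = (fps_X + fps_const z) * germ m P (Some z).
Proof. by have := germ_mul_some m P 0 z; rewrite subr0 subr0. Qed.
Lemma germ_X_none m (P : {poly C}) : (size P <= m.+1)%N ->
  germ m.+1 ('X * P) None = germ m P None.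
Proof. by move=> /(germ_mul_none 0); rewrite subr0 rmorph0 mul0r subr0 mul1r. Qed.
Lemma germ_S m (P : {poly C}) : (size P <= m.+1)%N ->
  germ m.+1 P None = fps_X * germ m P None.
Proof.
move=> sP; apply: fpsP => n; rewrite [RHS]coefsXM /=; case: n => [|n].
  by rewrite subn0 nth_default.
by rewrite ltnS subSS.
Qed.

(** The pullback of w divided by [exc c ^+ m]; in the dicritical case one more power remains to be
    removed. *)
Definition chart_quot w m c : oneform R :=
  if c is Some z then (bl w.1 m c + bl w.2 m c * (varY R + const2 z), bl w.2 m c * varX R)
  else (bl w.1 m c * varY R, bl w.1 m c * varX R + bl w.2 m c).

Lemma pullback_chart w m c : (forall i, (i < m)%N -> hp w.1 i = 0 /\ hp w.2 i = 0) ->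
  pullback w (chart c).1 (chart c).2 =
  (exc c ^+ m * (chart_quot w m c).1, exc c ^+ m * (chart_quot w m c).2).
Proof.
move=> lo; have E1 := subst2_blowup c (fun i im => proj1 (lo i im)).
have E2 := subst2_blowup c (fun i im => proj2 (lo i im)).
rewrite /pullback E1 E2 /chart_quot; move: (bl w.1 m c) (bl w.2 m c) => b1 b2 {E1 E2 lo}.
case: c => [z|] /=; congr pair.
- rewrite dxM dxX dxD dxY dxC; move: (varX R) (varY R) (const2 z) => x y k; ring.
- rewrite dyM dyX dyD dyY dyC; move: (varX R) (varY R) (const2 z) => x y k; ring.
- rewrite dxM dxX dxY; move: (varX R) (varY R) => x y; ring.
- rewrite dyM dyX dyY; move: (varX R) (varY R) => x y; ring.
Qed.

Lemma pull_lng_quot w m c :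
  pull (lng (typ c) (chart_quot w m c)) (epar c) = germ m.+1 (hpQ w m) c.
Proof.
have h := z0_epar c; rewrite /hpQ germD; case: c h => [a|] h.
  change (pull (bl w.1 m (Some a) + bl w.2 m (Some a) * (varY R + const2 a)) (epar (Some a)) =
    germ m.+1 (hp w.1 m) (Some a) + germ m.+1 ('X * hp w.2 m) (Some a)).
  rewrite (pullD _ _ h) (pullM _ _ h) (pullD (varY R) _ h) (pullC _ h) (pullY h).
  rewrite (pull_epar w.1 m (Some a)) (pull_epar w.2 m (Some a)) germ_X_some.
  by rewrite [X in _ + X = _]mulrC.
change (pull (bl w.1 m None * varX R + bl w.2 m None) (epar None) =
    germ m.+1 (hp w.1 m) None + germ m.+1 ('X * hp w.2 m) None).
rewrite (pullD _ _ h) (pullM _ _ h) (pullX h).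
rewrite (pull_epar w.1 m None) (pull_epar w.2 m None).
by rewrite (germ_X_none (size_hp _ _)) (germ_S (size_hp _ _)) [X in X + _ = _]mulrC.
Qed.

Definition blown w c M :=
  (pullback w (chart c).1 (chart c).2).1 = exc c ^+ M * (form_blowup w c).1 /\
  (pullback w (chart c).1 (chart c).2).2 = exc c ^+ M * (form_blowup w c).2.

(** The coefficient along the exceptional line restricts there to [hpQ], a form of degree m + 1
    whose order at c is the index; hence indices of sum nu + 1. *)
Lemma blowup_nondicritical w m c : is_multw w m -> hpQ w m != 0 ->
  [/\ blown w c m,
      pull (trv (typ c) (form_blowup w c)) (epar c) = 0 &
      pull (lng (typ c) (form_blowup w c)) (epar c) = germ m.+1 (hpQ w m) c].
Proof.
move=> [_ lo] Q0; have E := pullback_chart c lo.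
have h := z0_epar c; have zl := pull_lng_quot w m c.
have zt : pull (trv (typ c) (chart_quot w m c)) (epar c) = 0.
  case: (c) h => [a|] h.
    by apply: etrans (pullM _ (varX R) h) _; rewrite (pullX h) mulr0.
  by apply: etrans (pullM _ (varY R) h) _; rewrite (pullY h) mulr0.
have wE : form_blowup w c = chart_quot w m c.
  apply: strict_pairE E _; first exact: exc_neq0.
  move=> [/exc_dvd d1 /exc_dvd d2].
  have [n _] := germ_neq0 c Q0 (size_hpQ w m); rewrite -zl => /eqP; apply.
  by case: (typ c); rewrite /lng ?d1 ?d2 coefs0.
rewrite wE; split; [|exact: zt|exact: zl].
by rewrite /blown wE E; split; reflexivity.
Qed.

(** When [hpQ] vanishes, one more power of [exc c] factors out, and the transversal coefficient
    restricts, up to sign, to [hp w.2 m], of degree m - 1 as a form since hp w.1 m = - X hp w.2 m.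
    Its zeros are the tangencies with the exceptional line. *)
Lemma blowup_dicritical w m c : is_multw w m -> hpQ w m = 0 ->
  [/\ blown w c m.+1,
      pull (trv (typ c) (form_blowup w c)) (epar c) != 0,
      ord (pull (trv (typ c) (form_blowup w c)) (epar c)) = ord (germ m.-1 (hp w.2 m) c),
      (0 < m)%N & hp w.2 m != 0 /\ (size (hp w.2 m) <= m)%N].
Proof.
move=> [nz lo] Q0; have E := pullback_chart c lo.
have h := z0_epar c; have zl := pull_lng_quot w m c.
have h1E : hp w.1 m = - ('X * hp w.2 m) by apply/eqP; rewrite -addr_eq0; apply/eqP.
have h20 : hp w.2 m != 0.
  by case: nz => // n1; apply: contraNneq n1 => E2; rewrite h1E E2 mulr0 oppr0.
have sh : (size (hp w.2 m) <= m)%N.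
  by have := size_hp w.1 m; rewrite h1E size_polyN mulrC size_mulX.
have m0 : (0 < m)%N by apply: leq_trans sh; rewrite lt0n size_poly_eq0.
have g0 k c' : germ k (0 : {poly C}) c' = 0.
  apply: fpsP => n; rewrite coefs0; case: c' => [a|] /=; first by rewrite comp_poly0 coef0.
  by rewrite coef0; case: ifP.
rewrite Q0 g0 in zl; have /exc_dvd [r rE] := zl.
pose z' : oneform R := if c is Some _ then (r, bl w.2 m c) else (bl w.1 m c, r).
have zE1 : (chart_quot w m c).1 = exc c * z'.1.
  by rewrite /z'; case: (c) rE => [a|] rE; [rewrite [RHS]mulrC; exact: rE|exact: mulrC].
have zE2 : (chart_quot w m c).2 = exc c * z'.2.
  by rewrite /z'; case: (c) rE => [a|] rE; [exact: mulrC|rewrite [RHS]mulrC; exact: rE].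
have E' : pullback w (chart c).1 (chart c).2 = (exc c ^+ m.+1 * z'.1, exc c ^+ m.+1 * z'.2).
  have M1 (a b : series2 R) : a = exc c * b -> exc c ^+ m * a = exc c ^+ m.+1 * b.
    by move->; rewrite mulrA -exprSr.
  by rewrite E (M1 _ _ zE1) (M1 _ _ zE2).
have [gz gE] : pull (trv (typ c) z') (epar c) != 0 /\
    ord (pull (trv (typ c) z') (epar c)) = ord (germ m.-1 (hp w.2 m) c).
  have [n _ gn] := germ_neq0 c h20 (leq_trans sh (leqSpred m)).
  have gn0 : germ m.-1 (hp w.2 m) c != 0 by apply: contraNneq gn => ->; rewrite coefs0.
  have -> : pull (trv (typ c) z') (epar c) =
      if c is Some _ then germ m.-1 (hp w.2 m) c else - germ m.-1 (hp w.2 m) c.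
    rewrite /z'; case: (c) => [a|]; first exact: (pull_epar w.2 m (Some a)).
    apply: etrans (pull_epar w.1 m None) _; rewrite h1E.
    apply/eqP; rewrite -addr_eq0; apply/eqP.
    rewrite -(germ_X_none (m := m.-1)) ?prednK // -germD addNr; exact: g0.
  by case: (c) gn0 => [a|] gn0 //; rewrite oppr_eq0 ordN.
have wE : form_blowup w c = z'.
  apply: strict_pairE E' _; first exact: exc_neq0.
  by move=> [/exc_dvd d1 /exc_dvd d2]; move/eqP: gz; apply; case: (typ c).
rewrite wE; split; [|exact: gz|exact: gE|exact: m0|by split].
by rewrite /blown wE E'; split; reflexivity.
Qed.

Lemma pull_pullback w c gam : z0 gam ->
  pull (pullback w (chart c).1 (chart c).2).1 gam =
    pull w.1 (pd c gam) * pull (dx (chart c).1) gam + pull w.2 (pd c gam) * pull (dx (chart c).2)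
      gam /\
  pull (pullback w (chart c).1 (chart c).2).2 gam =
    pull w.1 (pd c gam) * pull (dy (chart c).1) gam + pull w.2 (pd c gam) * pull (dy (chart c).2)
      gam.
Proof.
move=> h; have [u0 v0] := chart00 c; rewrite !(pdE c h).
have P f g k l : pull (subst2 f (chart c).1 (chart c).2 * g + subst2 k (chart c).1 (chart c).2 * l)
  gam =
    pull f (pull (chart c).1 gam, pull (chart c).2 gam) * pull g gam +
    pull k (pull (chart c).1 gam, pull (chart c).2 gam) * pull l gam.
  rewrite (pullD _ _ h) (pullM _ g h) (pullM _ l h).
  by rewrite (pull_subst2 f h u0 v0) (pull_subst2 k h u0 v0).
split; exact: P.
Qed.

Lemma blown_pull w c M gam : z0 gam -> blown w c M ->
  excv c gam ^+ M * pull (form_blowup w c).1 gam =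
    pull w.1 (pd c gam) * pull (dx (chart c).1) gam + pull w.2 (pd c gam) * pull (dx (chart c).2)
      gam /\
  excv c gam ^+ M * pull (form_blowup w c).2 gam =
    pull w.1 (pd c gam) * pull (dy (chart c).1) gam + pull w.2 (pd c gam) * pull (dy (chart c).2)
      gam.
Proof.
move=> h [E1 E2]; have [P1 P2] := pull_pullback w c h.
have X f : excv c gam ^+ M * pull f gam = pull (exc c ^+ M * f) gam.
  by rewrite (pullM _ f h) (pullXn _ _ h) (pull_exc c h).
by rewrite -P1 -P2 !X E1 E2.
Qed.

Lemma pd_par b : pd (dirb b) (par b) = par b.
Proof. by case: b => /=; rewrite ?rmorph0 ?addr0 ?mulr0 ?mul0r. Qed.
Lemma excv_par b : excv (dirb b) (par b) = fps_X. Proof. by case: b. Qed.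

(** The axis is its own strict transform in the direction [dirb b]. Blowing it down adds M to a
    tangency order, but only M - 1 to an index, because of the derivative of the chart. *)
Lemma pull_form_axis w b M : blown w (dirb b) M ->
  pull (trv b w) (par b) = fps_X ^+ M * pull (trv b (form_blowup w (dirb b))) (par b) /\
  fps_X * pull (lng b w) (par b) = fps_X ^+ M * pull (lng b (form_blowup w (dirb b))) (par b).
Proof.
have h := par_z0 b => /(blown_pull h); rewrite pd_par excv_par.
move: (form_blowup w (dirb b)) => w' [E1 E2].
have lin (x y e a a' : fps C) : a = 0 -> a' = e -> x * a' + y * a = x * e.
  by move=> -> ->; rewrite mulr0 addr0.
have linr (x y e a a' : fps C) : a = 0 -> a' = e -> x * a + y * a' = y * e.
  by move=> -> ->; rewrite mulr0 add0r.
case: b h E1 E2 => h E1 E2.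
  have u1 : pull (dx (chart (dirb true)).1) (par true) = fps_X.
    have -> : dx (chart (dirb true)).1 = varY R by rewrite /= dxM dxX dxY mul1r mulr0 addr0.
    exact: pullY h.
  have u2 : pull (dx (chart (dirb true)).2) (par true) = 0 :> fps C.
    by rewrite /= dxY; exact: pull_z h.
  have v1 : pull (dy (chart (dirb true)).1) (par true) = 0 :> fps C.
    have -> : dy (chart (dirb true)).1 = varX R by rewrite /= dyM dyX dyY mul0r mulr1 add0r.
    exact: pullX h.
  have v2 : pull (dy (chart (dirb true)).2) (par true) = 1 :> fps C.
    by rewrite /= dyY; exact: pull1 h.
  split; first by move: E2; rewrite (linr _ _ _ _ _ v1 v2) mulr1 => /esym.
  by move: E1; rewrite (lin _ _ _ _ _ u2 u1) [RHS]mulrC => /esym.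
have Yz : pull (varY R + const2 0) (par false) = 0 :> fps C.
  rewrite (pullD _ _ h) (pullC _ h) (pullY h) rmorph0; exact: addr0.
have u1 : pull (dx (chart (dirb false)).1) (par false) = 1 :> fps C.
  by rewrite /= dxX; exact: pull1 h.
have u2 : pull (dx (chart (dirb false)).2) (par false) = 0 :> fps C.
  have -> : dx (chart (dirb false)).2 = varY R + const2 0.
    rewrite /= dxM dxX dxD dxY dxC [0 + 0]addr0 mulr0 mul1r; exact: addr0.
  exact: Yz.
have v1 : pull (dy (chart (dirb false)).1) (par false) = 0 :> fps C.
  by rewrite /= dyX; exact: pull_z h.
have v2 : pull (dy (chart (dirb false)).2) (par false) = fps_X.
  have -> : dy (chart (dirb false)).2 = varX R.
    by rewrite /= dyM dyX dyD dyY dyC [1 + 0]addr0 mulr1 mul0r add0r.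
  exact: pullX h.
split; first by move: E1; rewrite (lin _ _ _ _ _ u2 u1) mulr1 => /esym.
by move: E2; rewrite (linr _ _ _ _ _ v1 v2) [RHS]mulrC => /esym.
Qed.

(** The pullback of w to the parameter line vanishes: [gam] is an integral curve. *)
Definition inv w gam := pull w.1 gam * fps_deriv gam.1 + pull w.2 gam * fps_deriv gam.2 = 0.

Lemma inv_step w c gam M : z0 gam -> excv c gam != 0 -> blown w c M ->
  inv w (pd c gam) <-> inv (form_blowup w c) gam.
Proof.
move=> h e0 /(blown_pull h) [E1 E2].
have D1 := pull_deriv (chart c).1 h; have D2 := pull_deriv (chart c).2 h.
have I : pull w.1 (pd c gam) * fps_deriv (pd c gam).1 + pull w.2 (pd c gam) * fps_deriv (pd c
  gam).2 =
    excv c gam ^+ M * (pull (form_blowup w c).1 gam * fps_deriv gam.1 + pull (form_blowup w c).2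
      gam * fps_deriv gam.2).
  have P1 : fps_deriv (pd c gam).1 = fps_deriv (pull (chart c).1 gam) by rewrite {1}(pdE c h).
  have P2 : fps_deriv (pd c gam).2 = fps_deriv (pull (chart c).2 gam) by rewrite {1}(pdE c h).
  rewrite P1 P2 D1 D2 [RHS]mulrDr [X in _ = X + _]mulrA [X in _ = _ + X]mulrA E1 E2.
  move: (pull w.1 _) (pull w.2 _) (pull (dx (chart c).1) gam) (pull (dy (chart c).1) gam) (pull (dx
    (chart c).2) gam) (pull (dy (chart c).2) gam) (fps_deriv gam.1) (fps_deriv gam.2) => a b p q r
    s u v.
  by ring.
rewrite /inv I; split=> [/eqP|->]; last by rewrite mulr0.
by rewrite mulf_eq0 (negPf (expf_neq0 _ e0)) => /eqP.
Qed.

(* [w = (mu1 / mu0) df] along [gam], so that [ord mu1 - ord mu0] is the GSV-index. *)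
Definition rel w f gam (mu0 mu1 : fps C) :=
  mu0 * pull w.1 gam = mu1 * pull (dx f) gam /\ mu0 * pull w.2 gam = mu1 * pull (dy f) gam.

(** Differentiate the factorization of f in the chart into [exc c ^+ m] and the strict transform:
    the term with the differential of the first factor vanishes along [gam]. *)
Lemma pull_d_blowup c f m gam : z0 gam -> is_mult f m -> pull (series_blowup f c) gam = 0 ->
  excv c gam ^+ m * pull (dx (series_blowup f c)) gam =
    pull (dx f) (pd c gam) * pull (dx (chart c).1) gam + pull (dy f) (pd c gam) * pull (dx (chart
      c).2) gam /\
  excv c gam ^+ m * pull (dy (series_blowup f c)) gam =
    pull (dx f) (pd c gam) * pull (dy (chart c).1) gam + pull (dy f) (pd c gam) * pull (dy (chart
      c).2) gam.
Proof.
move=> h fm f0; have [P1 P2] := pull_pullback (dx f, dy f) c h.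
have [u0 v0] := chart00 c.
have sE := subst2_blowup c (proj2 fm); rewrite -(series_blowupE c fm) in sE.
have X g k : pull (k * series_blowup f c + exc c ^+ m * g) gam = excv c gam ^+ m * pull g gam.
  rewrite (pullD _ _ h) (pullM k _ h) f0 mulr0 add0r (pullM _ g h) (pullXn _ _ h).
  by rewrite (pull_exc c h).
split.
  rewrite -(X _ (dx (exc c ^+ m)) ) -dxM -sE (subst2_dx _ u0 v0); exact: P1.
rewrite -(X _ (dy (exc c ^+ m)) ) -dyM -sE (subst2_dy _ u0 v0); exact: P2.
Qed.

Lemma rel_step w c f m gam M mu0 mu1 : z0 gam -> is_mult f m -> blown w c M ->
  pull (series_blowup f c) gam = 0 -> rel w f (pd c gam) mu0 mu1 ->
  rel (form_blowup w c) (series_blowup f c) gam (mu0 * excv c gam ^+ M) (mu1 * excv c gam ^+ m).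
Proof.
move=> h fm /(blown_pull h) [E1 E2] f0 [r1 r2].
have [D1 D2] := pull_d_blowup h fm f0; split.
  by rewrite -mulrA E1 -[RHS]mulrA D1 [LHS]mulrDr [RHS]mulrDr !mulrA r1 r2.
by rewrite -mulrA E2 -[RHS]mulrA D2 [LHS]mulrDr [RHS]mulrDr !mulrA r1 r2.
Qed.
End Forms.

(** * Branches at reduced singularities *)

Section Leaves.
Variable R : realType.
Notation C := (complex R).
Implicit Types (f g h u v r : series2 R) (gam : fps C * fps C) (w : oneform R) (B : curve R).

Lemma fps_deriv_X : fps_deriv fps_X = 1 :> fps C.
Proof. by have := fderivXn C 1; rewrite expr1 expr0 mulr1n. Qed.

Lemma z0_graph (p : fps C) : coefs p 0 = 0 -> z0 (fps_X : fps C, p).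
Proof. by move=> p0; have [_ [h _]] := pullXe R; split. Qed.

(** The quotient t of r - r(x, 0) by y has no constant term, as r has order at least 2; so the
    difference gains one order over p - q. *)
Lemma pull_congr_graph k r (p q : fps C) : vg2 2 r -> coefs p 0 = 0 -> coefs q 0 = 0 ->
  vg k (p - q) -> vg k.+1 (pull r (fps_X, p) - pull r (fps_X, q)).
Proof.
move=> r2 p0 q0 pq; have hp := z0_graph p0; have hq := z0_graph q0.
pose t : series2 R := Fps (fun j => coefs r j.+1).
have rE : r = fps_const (coefs r 0) + varY R * t.
  apply: fpsP => -[|j]; rewrite coefsD coefsC coefsXM /= ?addr0 ?add0r //.
have t1 : vg2 1 t.
  by move=> i j ij; rewrite /coef2 /=; apply: r2; rewrite addnS ltnS.
have E s : coefs s 0 = 0 -> pull r (fps_X, s) = comp1 fps_X (coefs r 0) + s * pull t (fps_X, s).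
  move=> s0; have h := z0_graph s0.
  by rewrite {1}rE (pullD _ _ h) (pull_fps_const _ h) (pullM _ _ h) (pullY h).
have -> : pull r (fps_X, p) - pull r (fps_X, q) =
    (p - q) * pull t (fps_X, p) + q * (pull t (fps_X, p) - pull t (fps_X, q)).
  rewrite (E _ p0) (E _ q0).
  by move: (comp1 _ _) (pull t (fps_X, p)) (pull t (fps_X, q)) => a b c; ring.
apply: vgD.
  by rewrite -addn1; apply: vgM => //; apply: vg1; rewrite pull_coef0; apply: t1.
rewrite -add1n; apply: vgM; first exact: vg1.
by apply: pull_congr => //=; rewrite subrr; apply: vgz.
Qed.

(** Tangency of y = p(x) to al y dx + be x dy + ... reads (al + be n) p_n = - H_n, where H collects
    the terms of higher order; non-resonance lets one solve for p_n when n > 1. *)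
Lemma ode_branch w (al be : C) :
  coef2 w.1 0 0 = 0 -> coef2 w.1 1 0 = 0 -> coef2 w.1 0 1 = al ->
  coef2 w.2 0 0 = 0 -> coef2 w.2 1 0 = be -> coef2 w.2 0 1 = 0 ->
  (forall n, (1 < n)%N -> al + be *+ n != 0) ->
  exists p : fps C, vg 2 p /\ inv w (fps_X, p).
Proof.
move=> a00 a10 a01 b00 b10 b01 nr.
pose r1 := w.1 - const2 al * varY R; pose r2 := w.2 - const2 be * varX R.
have r1v : vg2 2 r1.
  move=> [|[|i]] [|[|j]] //= _; rewrite coef2B coef2CM coef2Y /= ?a00 ?a10 ?a01;
  by rewrite ?mulr1 ?mulr0 ?subrr.
have r2v : vg2 2 r2.
  move=> [|[|i]] [|[|j]] //= _; rewrite coef2B coef2CM coef2X /= ?b00 ?b10 ?b01;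
  by rewrite ?mulr1 ?mulr0 ?subrr.
(* Degrees 0 and 1, where al + be n may vanish, are set to zero: the solution is sought tangent to y
   = 0. *)
pose cut (p : fps C) : fps C := Fps (fun n => if (n < 2)%N then 0 else coefs p n).
have cut2 p : vg 2 (cut p) by move=> n n2; rewrite /= n2.
have cut0 p : coefs (cut p) 0 = 0 by [].
pose H (p : fps C) : fps C := pull r1 (fps_X, cut p) + pull r2 (fps_X, cut p) * fps_deriv (cut p).
pose Phi (p : fps C) : fps C := Fps (fun n => if (n < 2)%N then 0 else - (coefs (H p) n / (al + be
  *+ n))).
have [|p pE] := @fps_fixpoint _ Phi.
  move=> k p q pq.
  case: k pq => [|k] pq; first by apply: vg1; rewrite coefsB /= subrr.
  have cpq : vg k.+1 (cut p - cut q).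
    move=> n nk; have := pq n nk; rewrite !coefsB /=; case: ifP => // _; by rewrite subrr.
  have Hpq : vg k.+2 (H p - H q).
    have -> : H p - H q = (pull r1 (fps_X, cut p) - pull r1 (fps_X, cut q)) +
       ((pull r2 (fps_X, cut p) - pull r2 (fps_X, cut q)) * fps_deriv (cut p) +
        pull r2 (fps_X, cut q) * fps_deriv (cut p - cut q)).
      have -> : fps_deriv (cut p - cut q) = fps_deriv (cut p) - fps_deriv (cut q).
        by apply: fpsP => n; rewrite [RHS]coefsB !coefs_deriv coefsB mulrnBl.
      rewrite /H; move: (pull r1 _) (pull r2 _) (pull r1 _) (pull r2 _) (fps_deriv _) (fps_deriv _)
        => a b c d e f.
      by ring.
    apply: vgD; first exact: pull_congr_graph.
    apply: vgD.
      by rewrite -[k.+2]addn0; apply: vgM => //; apply: pull_congr_graph.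
    rewrite -[k.+2]add2n; apply: vgM; last exact: vg_deriv.
    by have := pull_vg (z0_graph (cut0 q)) (@vgXn _ 1) (vg_le (leqnSn 1) (cut2 q)) r2v; rewrite
      mul1n.
  move=> n nk; rewrite coefsB /=; case: ifP => _; first by rewrite subrr.
  have := Hpq n nk; rewrite coefsB => /eqP; rewrite subr_eq0 => /eqP ->.
  by rewrite subrr.
have pcut : cut p = p.
  by apply: fpsP => n /=; case: ifP => // n2; rewrite -pE /= n2.
have p2 : vg 2 p by rewrite -pcut.
exists p; split=> //.
have h : z0 (fps_X : fps C, p) by apply: z0_graph; rewrite -pcut.
rewrite /inv fps_deriv_X mulr1 -[(fps_X, p).2]/p.
have E1 : pull w.1 (fps_X, p) = fps_const al * p + pull r1 (fps_X, p).
  by rewrite (pullB _ _ h) (pullM _ _ h) (pullC _ h) (pullY h) /= addrC subrK.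
have E2 : pull w.2 (fps_X, p) = fps_const be * fps_X + pull r2 (fps_X, p).
  by rewrite (pullB _ _ h) (pullM _ _ h) (pullC _ h) (pullX h) /= addrC subrK.
have -> : pull w.1 (fps_X, p) + pull w.2 (fps_X, p) * fps_deriv p =
   fps_const al * p + fps_const be * (fps_X * fps_deriv p) + H p.
  rewrite /H pcut E1 E2.
  have rg (a b c d x e q : fps C) : c * q + a + (d * x + b) * e = c * q + d * (x * e) + (a + b * e)
    by ring.
  exact: rg.
have H2 : vg 2 (H p).
  rewrite /H pcut; have p1 : vg 1 p by apply: vg_le p2.
  have V r : vg2 2 r -> vg 2 (pull r (fps_X, p)).
    by move=> rv; have := pull_vg h (@vgXn _ 1) p1 rv; rewrite mul1n.
  by apply: vgD; [exact: V|rewrite -[2%N]addn0; apply: vgM; [exact: V|exact: vg0]].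
apply: fpsP => n; rewrite [LHS]coefsD [X in X + _]coefsD [X in X + _ + _]coefsCM [X in _ + X +
  _]coefsCM coefsXM coefs0.
have [n2|n2] := ltnP n 2.
  rewrite (H2 _ n2) addr0; case: n n2 => [|[|//]] _ /=.
    by rewrite (p2 0%N) // !mulr0 addr0.
  by rewrite coefs_deriv (p2 1%N) // mul0rn !mulr0 addr0.
case: n n2 => [//|n] n2 /=.
have := congr1 (fun q => coefs q n.+1) pE; rewrite /= ltnNge n2 /= => pn.
rewrite coefs_deriv -pn; have := nr _ n2; move: (coefs (H p) n.+1) => c d0.
rewrite mulrnAr -mulrnAl -mulrDl mulrN mulrCA (divff d0) mulr1; exact: addNr.
Qed.

Lemma inv_pullback w u v gam : z0 gam -> coef2 u 0 0 = 0 -> coef2 v 0 0 = 0 ->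
  inv (pullback w u v) gam -> inv w (pull u gam, pull v gam).
Proof.
move=> h u0 v0; rewrite /inv.
have P f g k l : pull (subst2 f u v * g + subst2 k u v * l) gam =
    pull f (pull u gam, pull v gam) * pull g gam + pull k (pull u gam, pull v gam) * pull l gam.
  rewrite (pullD _ _ h) (pullM _ g h) (pullM _ l h).
  by rewrite (pull_subst2 f h u0 v0) (pull_subst2 k h u0 v0).
have D1 := pull_deriv u h; have D2 := pull_deriv v h.
rewrite [pull (pullback _ _ _).1 _]P [pull (pullback _ _ _).2 _]P.
rewrite -[(_, _).1 in X in _ -> X]/(pull u gam) -[(pull u gam, pull v gam).2]/(pull v gam) D1 D2.
move: (pull w.1 _) (pull w.2 _) (pull (dx u) gam) (pull (dy u) gam) (pull (dx v) gam) (pull (dy v)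
  gam) (fps_deriv gam.1) (fps_deriv gam.2) => a b p q s t x y E.
by rewrite -[RHS]E; ring.
Qed.

Definition lam_ok (lam : C) := lam != 0 /\ (forall r : rat, 0 < r -> lam != ratr r).
(** The determinant of the linear part of the vector field w.2 d/dx - w.1 d/dy, which is tangent to
    the foliation. *)
Definition detw w := coef2 w.1 1 0 * coef2 w.2 0 1 - coef2 w.1 0 1 * coef2 w.2 1 0.

Lemma coef2_linear_part f :
  coef2 (linear_part f) 1 0 = coef2 f 1 0 /\ coef2 (linear_part f) 0 1 = coef2 f 0 1.
Proof.
by rewrite /linear_part !coef2D !coef2CM !coef2X !coef2Y /= !mulr1 !mulr0 addr0 add0r.
Qed.

Lemma lambda_coords w lam : has_linear_part w (varY R, - const2 lam * varX R) ->
  exists u v h, [/\ formal_coordinates u v, h \is a GRing.unit &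
   let z := pullback w u v in
   [/\ coef2 (h * z.1) 1 0 = 0, coef2 (h * z.1) 0 1 = 1,
       coef2 (h * z.2) 1 0 = - lam & coef2 (h * z.2) 0 1 = 0]].
Proof.
move=> [_ [u [v [h [uv hu]]]]]; set z := pullback w u v => /= E.
have E1 : linear_part (h * z.1) = varY R := congr1 fst E.
have E2 : linear_part (h * z.2) = - const2 lam * varX R := congr1 snd E.
exists u, v, h; split=> //.
have [<- <-] := coef2_linear_part (h * z.1); have [<- <-] := coef2_linear_part (h * z.2).
rewrite E1 E2 mulNr !coef2N !coef2CM !coef2X !coef2Y /=.
by rewrite mulr1 mulr0 oppr0.
Qed.

Lemma coef2_pullback w u v : singular w -> coef2 u 0 0 = 0 -> coef2 v 0 0 = 0 ->
  let z := pullback w u v in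
  [/\ coef2 z.1 0 0 = 0, coef2 z.2 0 0 = 0,
   forall i j, (i + j = 1)%N -> coef2 z.1 i j =
     (coef2 w.1 1 0 * coef2 u i j + coef2 w.1 0 1 * coef2 v i j) * coef2 u 1 0 +
     (coef2 w.2 1 0 * coef2 u i j + coef2 w.2 0 1 * coef2 v i j) * coef2 v 1 0 &
   forall i j, (i + j = 1)%N -> coef2 z.2 i j =
     (coef2 w.1 1 0 * coef2 u i j + coef2 w.1 0 1 * coef2 v i j) * coef2 u 0 1 +
     (coef2 w.2 1 0 * coef2 u i j + coef2 w.2 0 1 * coef2 v i j) * coef2 v 0 1].
Proof.
move=> [s1 s2] u0 v0 /=.
have P0 f g : coef2 f 0 0 = 0 -> coef2 (subst2 f u v * g) 0 0 = 0.
  by move=> f0; rewrite coef2M00 subst2_coef00 f0 mul0r.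
have P1 f g i j : coef2 f 0 0 = 0 -> (i + j = 1)%N -> coef2 (subst2 f u v * g) i j =
    (coef2 f 1 0 * coef2 u i j + coef2 f 0 1 * coef2 v i j) * coef2 g 0 0.
  move=> f0 ij; rewrite -(subst2_coef1 f ij u0 v0).
  case: i j ij => [|[|i]] [|[|j]] //= _; rewrite ?coef2M10 ?coef2M01 subst2_coef00 f0 mul0r add0r
    //.
split=> [||i j ij|i j ij].
- by rewrite coef2D !P0 // addr0.
- by rewrite coef2D !P0 // addr0.
- by rewrite coef2D (P1 _ _ _ _ s1 ij) (P1 _ _ _ _ s2 ij) !coef2_deriv_x !mulr1n.
- by rewrite coef2D (P1 _ _ _ _ s1 ij) (P1 _ _ _ _ s2 ij) !coef2_deriv_y !mulr1n.
Qed.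

(* The ratio of the eigenvalues is a coordinate-free invariant of the linear part. *)
Lemma lambda_coefs w lam : lam != 0 -> has_linear_part w (varY R, - const2 lam * varX R) ->
  detw w != 0 /\ (coef2 w.1 0 1 - coef2 w.2 1 0) ^+ 2 * lam = (1 + lam) ^+ 2 * detw w.
Proof.
move=> l0 wl; have ws : singular w by case: wl.
have [u [v [h [[u0 v0 tr] hu]]]] := lambda_coords wl.
have := coef2_pullback ws u0 v0; set z := pullback w u v => -[z10 z20 z1 z2] /= [].
rewrite !coef2M10 !coef2M01 z10 z20 !mulr0 !addr0 !z1 // !z2 //.
move: (coef2 h 0 0) => h0.
rewrite /detw; move: tr; rewrite /transverse.
move: (coef2 u 1 0) (coef2 u 0 1) (coef2 v 1 0) (coef2 v 0 1) => u1 u2 v1 v2 tr.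
move: (coef2 w.1 1 0) (coef2 w.1 0 1) (coef2 w.2 1 0) (coef2 w.2 0 1) => a b c d E1 E2 E3 E4.
have D : lam = (h0 * (u1 * v2 - u2 * v1)) ^+ 2 * (a * d - b * c).
  rewrite -[LHS](opprK lam) -E3 -[LHS]mul1r -E2.
  have E5 : (h0 * ((a * u1 + b * v1) * u1 + (c * u1 + d * v1) * v1)) *
     (h0 * ((a * u2 + b * v2) * u2 + (c * u2 + d * v2) * v2)) = 0 by rewrite E1 mul0r.
  rewrite -[RHS](subr0) -[X in _ = _ - X]E5; ring.
have T : 1 + lam = h0 * (u1 * v2 - u2 * v1) * (b - c).
  rewrite -E2 -[lam]opprK -E3; ring.
split; last by rewrite {1}D T; ring.
by apply: contraNneq l0 => d0; rewrite D d0 mulr0.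
Qed.

(** In the coordinates of the linear part, [ode_branch] gives a solution tangent to each axis; the
    resonances n lam = 1 and lam = n are excluded because lam is not a positive rational. The change
    of coordinates keeps the tangents independent. *)
Lemma lambda_branches w lam : lam_ok lam -> has_linear_part w (varY R, - const2 lam * varX R) ->
  exists gam1 gam2, [/\ z0 gam1, z0 gam2, inv w gam1, inv w gam2 &
    coefs gam1.1 1 * coefs gam2.2 1 - coefs gam1.2 1 * coefs gam2.1 1 != 0].
Proof.
move=> [l0 lq] wl; have ws : singular w by case: wl.
have [u [v [h [[u0 v0 tr] hu]]]] := lambda_coords wl.
have := coef2_pullback ws u0 v0; set z := pullback w u v => -[z10 z20 _ _] /= [E1 E2 E3 E4].
have Z1 : coef2 (h * z.1) 0 0 = 0 by rewrite coef2M00 z10 mulr0.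
have Z2 : coef2 (h * z.2) 0 0 = 0 by rewrite coef2M00 z20 mulr0.
have n1 n : (1 < n)%N -> 1 + (- lam) *+ n != 0.
  move=> n1; rewrite mulNrn subr_eq0; apply/eqP => E.
  have n0 : (n%:R : C) != 0 by rewrite pnatr_eq0 -lt0n (ltn_trans _ n1).
  have /eqP : lam = ratr (n%:R^-1 : rat).
    rewrite fmorphV /= ratr_nat; apply: (mulIf n0); by rewrite mulVf // mulr_natr -E.
  by apply/negP/lq; rewrite invr_gt0 ltr0n (ltn_trans _ n1).
have n2 n : (1 < n)%N -> - lam + 1 *+ n != 0.
  move=> n1'; rewrite addrC subr_eq0 eq_sym -(ratr_nat C n); apply: lq.
  by rewrite ltr0n (ltn_trans _ n1').
have [p [p2 pI]] := @ode_branch (h * z.1, h * z.2) 1 (- lam) Z1 E1 E2 Z2 E3 E4 n1.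
have [q [q2 qI]] := @ode_branch (swap (h * z.2), swap (h * z.1)) (- lam) 1 Z2 E4 E3 Z1 E2 E1 n2.
have hp : z0 (fps_X : fps C, p) by apply: z0_graph; apply: p2.
have hq : z0 (q, fps_X : fps C) by have [H1 H2] := z0_graph (q2 0%N isT).
have H gam : z0 gam -> inv (h * z.1, h * z.2) gam -> inv z gam.
  move=> hg; rewrite /inv (pullM _ _ hg) (pullM _ _ hg) -!mulrA -mulrDr => /eqP.
  by rewrite mulf_eq0 (negPf (pull_unit _ hu)) => /eqP.
exists (pull u (fps_X, p), pull v (fps_X, p)), (pull u (q, fps_X), pull v (q, fps_X)); split.
- exact: pull_z0.
- exact: pull_z0.
- by apply: inv_pullback => //; apply: H.
- apply: inv_pullback => //; apply: H => //.
  by move: qI; rewrite /inv !pull_swap /= addrC.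
have X1 : coefs (fps_X : fps C) 1 = 1 by have := coefsXn C 1 1; rewrite expr1 eqxx.
have Ep g : coefs (pull g (fps_X, p)) 1 = coef2 g 1 0.
  by rewrite (pull_coef1 g hp) [coefs (_, _).1 1]X1 [coefs (_, _).2 1](p2 1%N isT) mulr1 mulr0
    addr0.
have Eq g : coefs (pull g (q, fps_X)) 1 = coef2 g 0 1.
  by rewrite (pull_coef1 g hq) [coefs (_, _).1 1](q2 1%N isT) [coefs (_, _).2 1]X1 mulr1 mulr0
    add0r.
change (coefs (pull u (fps_X, p)) 1 * coefs (pull v (q, fps_X)) 1 -
  coefs (pull v (fps_X, p)) 1 * coefs (pull u (q, fps_X)) 1 != 0).
have rg (a b c d a' b' c' d' : C) : a = a' -> b = b' -> c = c' -> d = d' ->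
    a' * b' - d' * c' != 0 -> a * b - c * d != 0.
  by move=> -> -> -> ->; rewrite [d' * c']mulrC.
exact: (rg _ _ _ _ _ _ _ _ (Ep u) (Eq v) (Ep v) (Eq u) tr).
Qed.

(** The formal Cauchy problem p' = - (w.1 / w.2)(x, p), p(0) = 0, where integration gains one
    order. *)
Lemma regular_branch_x w : coef2 w.2 0 0 != 0 ->
  exists p : fps C, coefs p 0 = 0 /\ inv w (fps_X, p).
Proof.
move=> w20; have w2u : w.2 \is a GRing.unit by rewrite series2_unitE.
pose cut (p : fps C) : fps C := p - fps_const (coefs p 0).
have cut0 p : coefs (cut p) 0 = 0 by rewrite coefsB coefsC /= subrr.
pose r : series2 R := - (w.1 / w.2).
pose Phi (p : fps C) : fps C := Fps (fun n => if n is m.+1 then coefs (pull r (fps_X, cut p)) m /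
  n%:R else 0).
have [|p pE] := @fps_fixpoint _ Phi.
  move=> k p q pq [|n] nk; first by rewrite coefsB /= subrr.
  case: k pq nk => [//|k] pq nk.
  rewrite coefsB /= -mulrBl -coefsB (_ : coefs _ n = 0) ?mul0r //.
  have: vg k.+1 (pull r (fps_X, cut p) - pull r (fps_X, cut q)); last by apply.
  apply: pull_congr; [exact: z0_graph|exact: z0_graph|by rewrite subrr; apply: vgz|].
  have -> : (fps_X : fps C, cut p).2 - (fps_X : fps C, cut q).2 = p - q.
    have E : coefs p 0 = coefs q 0 by apply/eqP; rewrite -subr_eq0 -coefsB pq.
    have rg (a b c : fps C) : a - c - (b - c) = a - b by ring.
    rewrite /= /cut E; exact: rg.
  exact: pq.
have p0 : coefs p 0 = 0 by rewrite -pE.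
have pc : cut p = p by rewrite /cut p0 rmorph0 subr0.
have h := z0_graph p0; exists p; split=> //.
have dp : fps_deriv p = pull r (fps_X, p).
  apply: fpsP => n; rewrite coefs_deriv -[in LHS]pE [coefs (Phi p) _]/= pc -[LHS]mulr_natr.
  by rewrite mulfVK // pnatr_eq0.
rewrite /inv fps_deriv_X mulr1 -[(fps_X, p).2]/p dp -(pullM _ _ h) /r mulrN mulrC -mulrA mulVr //
  mulr1.
by rewrite (pullN _ h) subrr.
Qed.

Lemma regular_branch w : ~ singular w -> exists gam, [/\ z0 gam, inv w gam &
  coefs gam.1 1 != 0 \/ coefs gam.2 1 != 0].
Proof.
move=> ns; have X1 : coefs (fps_X : fps C) 1 != 0.
  by have := coefsXn C 1 1; rewrite expr1 eqxx => ->; apply: oner_neq0.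
have [w20|w2n] := eqVneq (coef2 w.2 0 0) 0; last first.
  have [p [p0 pI]] := regular_branch_x w2n.
  by exists (fps_X, p); split; [exact: z0_graph|exact: pI|left; exact: X1].
have w1n : coef2 w.1 0 0 != 0 by apply/eqP => w10; apply: ns; split.
have [p [p0 pI]] := @regular_branch_x (swap w.2, swap w.1) w1n.
exists (p, fps_X); split; [by have [H1 H2] := z0_graph p0|by move: pI; rewrite /inv !pull_swap /=
  addrC|right; exact: X1].
Qed.

(** Reparametrized by its first coordinate, the arc becomes a graph (t, phi(t)), on which y - phi(x)
    vanishes. *)
Lemma smooth_series gam : z0 gam -> coefs gam.1 1 != 0 -> exists2 f, pull f gam = 0 & coef2 f 0 1 =
  1.
Proof.
case: gam => p q [/= p0 q0] p1.
have op : is_ord p 1 by split=> // -[].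
have [t t0 tp] := root_of_series op isT.
pose phi := comp1 t q; exists (varY R - fps_const phi); last first.
  by rewrite coef2B coef2Y coef2_fps_const /= subr0.
have phi0 : coefs phi 0 = 0 by rewrite comp1_coef0.
have h := z0_graph phi0.
have hpq : z0 (p, q) by split.
have E : pull (varY R - fps_const phi) (fps_X, phi) = 0.
  have cX : comp1 fps_X phi = phi.
    apply: fpsP => n; rewrite [LHS]comp1_coefs.
    rewrite (sum_ord_single (i := n) (F := fun k => coefs phi k * coefs (fps_X ^+ k) n)) //.
      by rewrite coefsXn eqxx mulr1.
    by move=> k _ kn; rewrite coefsXn eq_sym (negPf kn) mulr0.
  have A1 : pull (varY R) (fps_X, phi) = phi := pullY h.
  have A2 : pull (fps_const phi : series2 R) (fps_X, phi) = phi := etrans (pull_fps_const phi h) cX.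
  by rewrite (pullB _ _ h) A1 A2 subrr.
apply/eqP; apply: contraTT isT => ne.
have tn : t != 0.
  apply/eqP => tz; move: tp; rewrite tz (comp1E (coefs0 _ 0)) -/(comp1 _ _) => tp.
  have := congr1 (fun s => coefs s 1) tp; rewrite expr1 comp1_coefs big_ord_recl expr0 coefs1 mulr0
    add0r.
  rewrite big_ord_recl big_ord0 expr1 coefs0 mulr0 addr0 => /esym/eqP.
  by have := coefsXn C 1 1; rewrite expr1 eqxx => ->; rewrite oner_eq0.
have := comp1_neq0 t0 tn ne; rewrite (comp1_pull _ t0 hpq) /= tp expr1 -/phi E.
by rewrite eqxx.
Qed.

Lemma smooth_eqn B gam : z0 gam -> coefs gam.1 1 != 0 \/ coefs gam.2 1 != 0 ->
  pull (eqn B) gam = 0 -> coef2 (eqn B) 1 0 != 0 \/ coef2 (eqn B) 0 1 != 0.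
Proof.
move=> h g1 Bg.
have gn : nz gam.
  by case: g1 => H; [left|right]; apply: contraNneq H => ->; rewrite coefs0.
have [f [fg fl]] : exists f, pull f gam = 0 /\ (coef2 f 1 0 != 0 \/ coef2 f 0 1 != 0).
  case: gam h g1 Bg gn => p q h [H|H] Bg gn.
    have [f fg f1] := smooth_series h H; exists f; split=> //; right; rewrite f1; exact: oner_neq0.
  have [h1 h2] := h; have [f fg f1] := @smooth_series (q, p) (conj h2 h1) H.
  exists (swap f); rewrite pull_swap; split=> //; left; rewrite coef2_swap f1; exact: oner_neq0.
have [k kE] := (pull_ker_curve h gn Bg f).1 fg.
move: fl; rewrite kE coef2M10 coef2M01 eqn00 !mulr0 !addr0.
by rewrite !mulf_eq0 !negb_or => -[/andP[_ ?]|/andP[_ ?]]; [left|right].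
Qed.

Lemma lead_deriv (p : fps C) n : is_ord p n -> (0 < n)%N -> vg n.-1 (fps_deriv p) /\
  coefs (fps_deriv p) n.-1 = coefs p n *+ n.
Proof.
by move=> [pn pv]; case: n pn pv => [//|n] pn pv _; split; [exact: vg_deriv|exact: coefs_deriv].
Qed.

(* Writing [w = f2 A df1 + f1 A' df2], a third branch would force the ratio of
   eigenvalues to be the quotient of its contact orders with [f1] and [f2]. *)
Lemma lambda_third w lam f1 f2 gam : lam_ok lam ->
  has_linear_part w (varY R, - const2 lam * varX R) ->
  coef2 f1 0 0 = 0 -> coef2 f2 0 0 = 0 -> transverse f1 f2 ->
  invariant_curve w f1 -> invariant_curve w f2 -> z0 gam -> inv w gam ->
  pull f1 gam = 0 \/ pull f2 gam = 0.
Proof.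
move=> [l0 lq] wl f10 f20 tr [h1 E1] [h2 E2] h gI.
have [det0 inve] := lambda_coefs l0 wl; have [s1 s2] : singular w by case: wl.
have [->|P0] := eqVneq (pull f1 gam) 0; first by left.
have [->|Q0] := eqVneq (pull f2 gam) 0; first by right.
exfalso; set P := pull f1 gam in P0; set Q := pull f2 gam in Q0.
(* Cramer's rule recovers w from the two invariance relations: J w = f2 h2 df1 - f1 h1 df2. *)
pose J := dx f1 * dy f2 - dy f1 * dx f2.
have W1 : J * w.1 = f2 * h2 * dx f1 - f1 * h1 * dx f2.
  rewrite [f2 * h2]mulrC [f1 * h1]mulrC -E1 -E2 /wedge_d /J.
  move: (dx f1) (dx f2) (dy f1) (dy f2) w.1 w.2 => a b c d e f; ring.
have W2 : J * w.2 = f2 * h2 * dy f1 - f1 * h1 * dy f2.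
  rewrite [f2 * h2]mulrC [f1 * h1]mulrC -E1 -E2 /wedge_d /J.
  move: (dx f1) (dx f2) (dy f1) (dy f2) w.1 w.2 => a b c d e f; ring.
(* As w vanishes on the velocity of [gam], a relation between the logarithmic derivatives of P and Q
   remains. *)
have K : Q * pull h2 gam * fps_deriv P = P * pull h1 gam * fps_deriv Q.
  rewrite /P /Q (pull_deriv f1 h) (pull_deriv f2 h).
  have X (k l m o : series2 R) : pull (f2 * k * l - f1 * m * o) gam =
     Q * pull k gam * pull l gam - P * pull m gam * pull o gam.
    by rewrite (pullB _ _ h) (pullM _ l h) (pullM _ k h) (pullM _ o h) (pullM _ m h).
  have pW1 : pull J gam * pull w.1 gam = Q * pull h2 gam * pull (dx f1) gam - P * pull h1 gam *
    pull (dx f2) gam.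
    by rewrite -(pullM _ w.1 h) W1 X.
  have pW2 : pull J gam * pull w.2 gam = Q * pull h2 gam * pull (dy f1) gam - P * pull h1 gam *
    pull (dy f2) gam.
    by rewrite -(pullM _ w.2 h) W2 X.
  apply/eqP; rewrite -subr_eq0; apply/eqP.
  transitivity (pull J gam * (pull w.1 gam * fps_deriv gam.1 + pull w.2 gam * fps_deriv gam.2)).
    rewrite [RHS]mulrDr [X in _ = X + _]mulrA [X in _ = _ + X]mulrA pW1 pW2 -/P -/Q.
    have rg (p q a b c d e f x y : fps C) : q * b * (c * x + e * y) - p * a * (d * x + f * y) =
        (q * b * c - p * a * d) * x + (q * b * e - p * a * f) * y by ring.
    exact: rg.
  by rewrite gI mulr0.
have oP := is_ord_ex P0; have oQ := is_ord_ex Q0.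
have a0 : (0 < ord P)%N by apply: ord_gt0 => //; rewrite pull_coef0.
have b0 : (0 < ord Q)%N by apply: ord_gt0 => //; rewrite pull_coef0.
move: a0 b0 oP oQ; set a := ord P; set b := ord Q => a0 b0 oP oQ.
have [dPv dP] := lead_deriv oP a0; have [dQv dQ] := lead_deriv oQ b0.
have [Pa Pv] := oP; have [Qb Qv] := oQ.
set c1 := coef2 h1 0 0; set c2 := coef2 h2 0 0.
have rr : c2 *+ a = c1 *+ b.
  have L := congr1 (fun k => coefs k (a + b).-1) K.
  have L1 : coefs (Q * pull h2 gam * fps_deriv P) (a + b).-1 = coefs Q b * c2 * (coefs P a *+ a).
    have -> : (a + b).-1 = (b + 0 + a.-1)%N by lia.
    rewrite (vg_lead _ dPv) ?dP; last by apply: vgM.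
    by rewrite (vg_lead Qv) // pull_coef0.
  have L2 : coefs (P * pull h1 gam * fps_deriv Q) (a + b).-1 = coefs P a * c1 * (coefs Q b *+ b).
    have -> : (a + b).-1 = (a + 0 + b.-1)%N by lia.
    rewrite (vg_lead _ dQv) ?dQ; last by apply: vgM.
    by rewrite (vg_lead Pv) // pull_coef0.
  move: L; rewrite L1 L2 => L.
  apply: (mulIf (mulf_neq0 Pa Qb)); move: L; rewrite [LHS]mulrnAr [RHS]mulrnAr => L.
  rewrite [LHS]mulrnAl [RHS]mulrnAl; move: (coefs P a) (coefs Q b) L => x y L.
  have -> : c2 * (x * y) = y * c2 * x by ring.
  have -> : c1 * (x * y) = x * c1 * y by ring.
  exact: L.
have J0 : coef2 f1 1 0 * coef2 f2 0 1 - coef2 f1 0 1 * coef2 f2 1 0 != 0 := tr.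
have Jc : coef2 J 0 0 = coef2 f1 1 0 * coef2 f2 0 1 - coef2 f1 0 1 * coef2 f2 1 0.
  by rewrite coef2B !coef2M00 !coef2_deriv_x !coef2_deriv_y.
have lin i j (e e1 e2 : series2 R) : (i + j = 1)%N -> coef2 e 0 0 = 0 ->
    J * e = f2 * h2 * e1 - f1 * h1 * e2 ->
    coef2 J 0 0 * coef2 e i j = coef2 f2 i j * c2 * coef2 e1 0 0 - coef2 f1 i j * c1 * coef2 e2 0 0.
  move=> ij e0 E; have := congr1 (fun k => coef2 k i j) E.
  case: i j ij => [|[|i]] [|[|j]] //= _; rewrite coef2B ?coef2M10 ?coef2M01 ?coef2M00 e0 f10 f20;
  by rewrite !mul0r ?mulr0 ?add0r ?addr0.
have lx := coef2_deriv_x; have ly := coef2_deriv_y.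
have A10 := lin 1%N 0%N _ _ _ erefl s1 W1; have A01 := lin 0%N 1%N _ _ _ erefl s1 W1.
have B10 := lin 1%N 0%N _ _ _ erefl s2 W2; have B01 := lin 0%N 1%N _ _ _ erefl s2 W2.
rewrite !lx !mulr1n Jc in A10 A01; rewrite !ly !mulr1n Jc in B10 B01.
move: A10 A01 B10 B01 J0 det0 inve {Jc lin lx ly}; rewrite /detw.
move: (coef2 f1 1 0) (coef2 f1 0 1) (coef2 f2 1 0) (coef2 f2 0 1) => p1 q1 p2 q2.
move: (coef2 w.1 1 0) (coef2 w.1 0 1) (coef2 w.2 1 0) (coef2 w.2 0 1) => e1 e2 e3 e4.
set j := p1 * q2 - q1 * p2 => A10 A01 B10 B01 J0 det0 inve.
(* Up to sign, c1 and c2 are the eigenvalues, by their sum and product. As c1 b = c2 a for the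
   contact orders a and b, the invariant of [lambda_coefs] forces lam to be a / b or b / a. *)
have T : e2 - e3 = c1 + c2.
  by apply: (mulfI J0); rewrite mulrBr A01 B10 /j; ring.
have D : e1 * e4 - e2 * e3 = c1 * c2.
  apply: (mulfI (mulf_neq0 J0 J0)).
  transitivity ((j * e1) * (j * e4) - (j * e2) * (j * e3)); first by ring.
  by rewrite A10 A01 B10 B01 /j; ring.
rewrite T D in inve; rewrite D in det0.
have an : (a%:R : C) != 0 by rewrite pnatr_eq0 -lt0n.
have bn : (b%:R : C) != 0 by rewrite pnatr_eq0 -lt0n.
have [c10 c20] : c1 != 0 /\ c2 != 0 by apply/andP; rewrite -negb_or -mulf_eq0.
have rr' : c2 * a%:R = c1 * b%:R by rewrite !mulr_natr.
have F : (a%:R * lam - b%:R) * (b%:R * lam - a%:R) = 0.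
  apply: (mulfI (mulf_neq0 (expf_neq0 2 c10) (expf_neq0 1 bn))).
  apply: (mulfI c20); rewrite mulr0.
  have X1 : c1 * b%:R - c2 * a%:R = 0 by rewrite rr' subrr.
  have X2 : (c1 + c2) ^+ 2 * lam - (1 + lam) ^+ 2 * (c1 * c2) = 0 by rewrite inve subrr.
  have X3 : c2 = c1 * b%:R / a%:R by rewrite -rr' mulfK.
  have X4 : (b%:R * lam - a%:R) * (a%:R * lam - b%:R) * c1 ^+ 2 = 0.
    have Y := X2; rewrite X3 in Y; have Z := congr1 (fun k => k * a%:R ^+ 2) Y.
    rewrite mul0r in Z; rewrite -oppr0 -[in RHS]Z.
    by field.
  transitivity (((b%:R * lam - a%:R) * (a%:R * lam - b%:R) * c1 ^+ 2) * (c2 * b%:R)); first by ring.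
  by rewrite X4 mul0r mulr0.
have rat_ne k l : (0 < k)%N -> (0 < l)%N -> (k%:R * lam - l%:R : C) != 0.
  move=> k0 l0'; have kn : (k%:R : C) != 0 by rewrite pnatr_eq0 -lt0n.
  apply/eqP => E; have /eqP : lam = ratr (l%:R / k%:R : rat).
    rewrite fmorph_div /= !ratr_nat; apply: (mulfI kn); rewrite mulrCA divff // mulr1.
    by apply/eqP; rewrite -subr_eq0; apply/eqP.
  by apply/negP/lq; rewrite divr_gt0 // ltr0n.
by move/eqP: F; rewrite mulf_eq0 (negPf (rat_ne _ _ a0 b0)) (negPf (rat_ne _ _ b0 a0)).
Qed.
End Leaves.

(** * Infinitely near points *)

Section Axes.
Variable R : realType.
Notation C := (complex R).
Notation pt := (infnear R).
Implicit Types (s q : pt) (c : option C) (b : bool).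

Definition ax b s : option pt := if b then (axes s).1 else (axes s).2.

Lemma axes_from_rcons q d s c : axes_from q d (rcons s c) =
  if c is Some z then (Some (q ++ s), if z == 0 then (axes_from q d s).2 else None)
  else ((axes_from q d s).1, Some (q ++ s)).
Proof.
elim: s q d => [|c0 s IH] q d /=; first by rewrite cats0; case: c.
by rewrite IH cat_rcons.
Qed.

Lemma ax_nil b : ax b [::] = None. Proof. by case: b. Qed.

Lemma ax_rcons b s c :
  ax b (rcons s c) = if typ c == b then Some s else if c == dirb R b then ax b s else None.
Proof. by rewrite /ax /axes axes_from_rcons; case: c b => [z|] []. Qed.

Lemma ax_new c s : ax (typ c) (rcons s c) = Some s.
Proof. by rewrite ax_rcons eqxx. Qed.

Lemma typ_dirb b : typ (dirb R b) = ~~ b. Proof. by case: b. Qed.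
Lemma ax_dirb b s : ax b (rcons s (dirb R b)) = ax b s.
Proof. by rewrite ax_rcons typ_dirb eqxx; case: b. Qed.
Lemma ax_dirbN b s : ax (~~ b) (rcons s (dirb R b)) = Some s.
Proof. by rewrite -{1}typ_dirb ax_new. Qed.

Lemma ax_prefix b s q : ax b s = Some q -> exists c t, s = rcons q c ++ t.
Proof.
elim/last_ind: s => [|s c IH]; first by rewrite ax_nil.
rewrite ax_rcons; case: eqP => _; first by case=> <-; exists c, [::]; rewrite cats0.
case: eqP => // _ /IH [c' [t ->]]; exists c', (rcons t c); by rewrite rcons_cat.
Qed.
Lemma ax_size b s q : ax b s = Some q -> (size q < size s)%N.
Proof. by move/ax_prefix => [c [t ->]]; rewrite size_cat size_rcons leq_addr. Qed.

Lemma ax_neq b s q : ax b s = Some q -> ax (~~ b) s <> Some q.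
Proof.
elim/last_ind: s => [|s c _]; first by rewrite !ax_nil.
rewrite !ax_rcons; have [<-|tb] := eqVneq (typ c) b.
  rewrite (_ : (typ c == ~~ typ c) = false); last by case: (typ c).
  by case=> <-; case: ifP => // _ /ax_size; rewrite ltnn.
rewrite (_ : (typ c == ~~ b) = true); last by case: (typ c) b tb => [] [].
by case: ifP => // _ /ax_size qs [E]; move: qs; rewrite E ltnn.
Qed.

Lemma ax_follow c q k : ax (typ c) (rcons q c ++ nseq k (dirb R (typ c))) = Some q.
Proof.
elim: k => [|k IH]; first by rewrite cats0 ax_new.
by rewrite -addn1 nseqD catA cats1 ax_dirb.
Qed.

(** After leaving q in a direction c, a point stays on the component of q only as long as it follows
    the strict transform of that component. *)
Lemma on_componentP q s : on_component q s ->
  exists c k, s = rcons q c ++ nseq k (dirb R (typ c)).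
Proof.
have H b : ax b s = Some q -> exists c k, typ c = b /\ s = rcons q c ++ nseq k (dirb R (typ c)).
  elim/last_ind: s => [|s c IH]; first by rewrite ax_nil.
  rewrite ax_rcons; case: eqP => [<-|_].
    by case=> <-; exists c, 0%N; rewrite cats0.
  case: eqP => // -> /IH [c' [k [tc ->]]]; exists c', k.+1; split=> //.
  by rewrite -tc -[k.+1]addn1 nseqD catA cats1.
by case=> [/(H true)|/(H false)] [c [k [_ E]]]; exists c, k.
Qed.

Lemma on_componentE q s : on_component q s <-> exists b, ax b s = Some q.
Proof. by split=> [[E|E]|[[] E]]; [exists true|exists false|left|right]. Qed.

Lemma ax_corner s : corner s <-> forall b, ax b s <> None.
Proof. by split=> [[h1 h2] []//|h]; split; [apply: (h true)|apply: (h false)]. Qed.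
End Axes.

(** * Leaves and corners of the tree of centers *)

Section TreeLeaves.
Variable R : realType.
Notation C := (complex R).
Notation pt := (infnear R).
Variable T : {fset pt}.
Hypothesis T_closed : prefix_closed T.
Implicit Types (s q : pt) (c : option C) (b : bool).

Lemma T_prefix s t : s ++ t \in T -> s \in T.
Proof.
elim/last_ind: t => [|t c IH]; first by rewrite cats0.
by rewrite -rcons_cat => /T_closed /IH.
Qed.

Lemma leaf_child s c : s \in T -> rcons s c \in T \/ leaf T (rcons s c).
Proof.
move=> sT; have [?|nT] := boolP (rcons s c \in T); [by left|right; split=> //].
by right; exists s, c.
Qed.

(** Descending induction: sizes are bounded on the finite set T, and a child of a center is a center
    or a leaf. *)
Lemma tree_ind (P : pt -> Prop) : (forall s, leaf T s -> P s) ->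
  (forall s, s \in T -> (forall c, P (rcons s c)) -> P s) ->
  forall s, s \in T \/ leaf T s -> P s.
Proof.
move=> base step s; pose M := (\max_(t <- T) size t)%N.
have bd t : t \in T -> (size t <= M)%N by move=> tT; rewrite /M (big_rem _ tT) /= leq_maxl.
have [n] := ubnP (M.+1 - size s); elim: n s => // n IH s sn [sT|]; last exact: base.
apply: step => // c; apply: IH; last exact: leaf_child.
by rewrite size_rcons; have := bd s sT; lia.
Qed.

Lemma leaf_proper s t : leaf T (s ++ t) -> t != [::] -> s \in T.
Proof.
case=> _ [E|[q [c [E qT]]]]; first by case: s t E => [|? ?] [|? ?].
case/lastP: t E => // t c'; rewrite -rcons_cat => /rcons_inj [E _] _.
by apply: T_prefix (t) _; rewrite E.
Qed.

Lemma leaf_incomparable s t : leaf T s -> leaf T (s ++ t) -> t = [::].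
Proof.
by move=> [sT _] /leaf_proper; case: t => // c t /(_ isT); rewrite (negPf sT).
Qed.

Lemma follow_uniq s c k k' : leaf T (s ++ nseq k c) -> leaf T (s ++ nseq k' c) -> k = k'.
Proof.
wlog kk : k k' / (k <= k')%N.
  by move=> H; case: (leqP k k') => [|/ltnW] kk l l'; [|symmetry]; apply: H kk _ _.
move=> l; rewrite -{1}(subnKC kk) nseqD catA => /(leaf_incomparable l) /(congr1 size).
by rewrite size_nseq /= => /eqP; rewrite subn_eq0 => kk'; apply/eqP; rewrite eqn_leq kk.
Qed.

Lemma passes_leaf_uniq (B : curve R) s s' : leaf T s -> leaf T s' ->
  passes (eqn B) s -> passes (eqn B) s' -> s = s'.
Proof.
wlog ss : s s' / (size s <= size s')%N.
  by move=> H; case: (leqP (size s) (size s')) => [|/ltnW] kk l l' p p'; [|symmetry]; apply: H kk _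
    _ _ _.
move=> ls ls' ps ps'; have st : size s = size (take (size s) s') by rewrite size_takel.
have pt' : passes (eqn B) (take (size s) s').
  by apply: (@passes_prefix _ _ _ (drop (size s) s')); rewrite cat_take_drop.
have E := passes_uniq (genB B) st ps pt'.
move: ls'; rewrite -{1}(cat_take_drop (size s) s') -E => /(leaf_incomparable ls) D.
by rewrite -(cat_take_drop (size s) s') -E D cats0.
Qed.

Lemma leaf_corner_valence q (K : seq (option C)) (k : option C -> nat) : q \in T ->
  uniq K -> None \in K -> Some 0 \in K -> {subset [seq last None s | s <- T] <= K} ->
  (forall c, leaf T (rcons q c ++ nseq (k c) (dirb R (typ c)))) ->
  valence T q = (\sum_(c <- K) [forall b, ax b (rcons q c ++ nseq (k c) (dirb R (typ c))) !=
    None])%N.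
Proof.
move=> qT uK NK ZK TK lk; set l := fun c => rcons q c ++ nseq (k c) (dirb R (typ c)).
have axt c : ax (typ c) (l c) = Some q by apply: ax_follow.
have cornE c : [forall b, ax b (l c) != None] = (ax (~~ typ c) (l c) != None).
  apply/forallP/idP => [H|H b]; first exact: H.
  by have [->|bt] := eqVneq b (typ c); [rewrite axt|rewrite (_ : b = ~~ typ c) //; case: (b) (typ
    c) bt => [] []].
(* The other axis at [l c] was created by the last blow-up along the component, if any; otherwise it
   comes from an axis at q. *)
have lax c : ax (~~ typ c) (l c) = if k c is j.+1 then Some (rcons q c ++ nseq j (dirb R (typ c)))
    else if c == dirb R (~~ typ c) then ax (~~ typ c) q else None.
  rewrite /l; case: (k c) => [|j]; last by rewrite -addn1 nseqD catA cats1 ax_dirbN.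
  by rewrite cats0 ax_rcons; case: (typ c).
pose nm c := odflt [::] (ax (~~ typ c) (l c)).
pose K1 := [seq c <- K | ax (~~ typ c) (l c) != None].
have -> : (\sum_(c <- K) [forall b, ax b (l c) != None])%N = size (map nm K1).
  rewrite size_map size_filter -sum1_count [RHS]big_mkcond; apply: eq_bigr => c _.
  by rewrite cornE /=; case: (ax _ _ == _).
rewrite /valence; set V := [fset q' in T | _]%fset.
suff /perm_size : perm_eq (enum_fset V) (map nm K1) by [].
apply: uniq_perm; first exact: fset_uniq.
  rewrite map_inj_in_uniq ?filter_uniq // => c c'; rewrite !mem_filter => /andP[H _] /andP[H' _].
  rewrite /nm; case E: (ax _ _) H => [x|//] _; case E': (ax _ _) H' => [x'|//] _ /= xx.
  subst x'; move: E E'; rewrite !lax.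
  (* Names of the first kind extend [rcons q c] and so determine c; those of the second kind are
     shorter than q, and differ for the two axes of q. *)
  have inj (t t' : pt) : rcons q c ++ t = rcons q c' ++ t' -> c = c'.
    by rewrite !cat_rcons => /eqP; rewrite eqseq_cat // eqxx /= eqseq_cons => /andP[/eqP].
  have sz (t : pt) c0 b : ax b q = Some (rcons q c0 ++ t) -> False.
    by move/ax_size; rewrite size_cat size_rcons ltnNge leqW // leq_addr.
  case: (k c) => [|j]; case: (k c') => [|j'].
  - case: eqP => // -> ; case: eqP => // -> ; rewrite !typ_dirb !negbK.
    case: (typ c) (typ c') => [] [] // E E'; by case: (ax_neq E).
  - by case: eqP => // _ E [E']; case: (@sz _ c' _ (etrans E (congr1 Some (esym E')))).
  - by case: eqP => // _ [E'] E; case: (@sz _ c _ (etrans E (congr1 Some (esym E')))).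
  - by move=> [<-] [/esym]; apply: inj.
move=> q'; rewrite !inE /=; apply/idP/mapP => [/andP[q'T /andP[q'q /asboolP [s [ls qs q's]]]]|[c]].
  have [c [k' sE]] := on_componentP qs.
  have kk : k' = k c by apply: follow_uniq (lk c); rewrite -sE.
  have sl : s = l c by rewrite sE kk.
  have axq : ax (~~ typ c) (l c) = Some q'.
    have [b] := (on_componentE _ _).1 q's; rewrite sl.
    have [->|bt] := eqVneq b (typ c); last by rewrite (_ : b = ~~ typ c) //; case: (b) (typ c) bt
      => [] [].
    by rewrite axt => -[E]; rewrite E eqxx in q'q.
  exists c; last by rewrite /nm axq.
  rewrite mem_filter axq /=; move: axq; rewrite lax; case E: (k c) => [|j].
    by case: eqP => // ->; case: (typ c).
  move=> _; apply: TK; apply/mapP; exists (rcons q c); last by rewrite last_rcons.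
  by apply: (@leaf_proper _ (nseq j.+1 (dirb R (typ c)))) => //; rewrite -E; apply: lk.
rewrite mem_filter => /andP[H cK] ->; rewrite /nm.
case E: (ax _ _) H => [x|//] _ /=.
have xq : x != q.
  by apply/eqP => xq; apply: (ax_neq (axt c)); rewrite E xq.
rewrite xq andTb; apply/andP; split; last first.
  apply/asboolP; exists (l c); split; [exact: lk| |]; apply/on_componentE.
    by exists (typ c).
  by exists (~~ typ c).
have [c1 [t lE]] := ax_prefix E.
by apply: (@leaf_proper _ (c1 :: t)) => //; rewrite -cat_rcons -lE; apply: lk.
Qed.
End TreeLeaves.

Lemma Posz_sum (I : Type) (r : seq I) (F : I -> nat) :
  (\sum_(i <- r) F i)%N%:Z = \sum_(i <- r) (F i)%:Z.
Proof. by elim: r => [|i r IH]; rewrite ?big_nil ?big_cons // PoszD IH. Qed.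

(** * The multiplicity of a balanced divisor at the centers *)

Section Tree.
Variable R : realType.
Notation C := (complex R).
Notation pt := (infnear R).
Implicit Types (s q : pt) (c : option C) (b : bool) (B : curve R) (f g : series2 R) (gam : fps C *
  fps C).

Definition smult f : nat := xget 0%N [set m | is_mult f m].
Lemma smultP f : f != 0 -> is_mult f (smult f).
Proof. by move=> /is_mult_ex [m fm]; exact: (xgetPex _ (ex_intro _ m fm)). Qed.
Definition wmult (z : oneform R) : nat := xget 0%N [set m | is_multw z m].
Lemma wmultP z : z <> (0, 0) -> is_multw z (wmult z).
Proof. by move=> /is_multw_ex [m fm]; exact: (xgetPex _ (ex_intro _ m fm)). Qed.

Lemma inv_excE c (z : oneform R) :
  invariant_curve z (exc c) <-> pull (trv (typ c) z) (epar c) = 0.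
Proof.
rewrite -exc_dvd /invariant_curve /wedge_d; case: c => [x|] /=.
  rewrite dxX dyX mulr1 mulr0 sub0r.
  by split=> -[h E]; exists (- h); rewrite mulNr -E ?opprK.
by rewrite dxY dyY mulr1 mulr0 subr0.
Qed.

Variables (w : oneform R) (T : {fset pt}).
Hypothesis wn0 : w <> (0, 0).
Notation W s := (form_at w s).
Notation FB B s := (series_at (eqn B) s).
Notation par b := (par R b).
Notation dirb b := (dirb R b).

Lemma form_at_rcons s c : W (rcons s c) = form_blowup (W s) c.
Proof. exact: foldl_rcons. Qed.
Lemma series_at_rcons f s c : series_at f (rcons s c) = series_blowup (series_at f s) c.
Proof. exact: foldl_rcons. Qed.

Definition nondic s := hpQ (W s) (wmult (W s)) != 0.

Lemma W_neq0 s : W s <> (0, 0).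
Proof.
elim/last_ind: s => [//|s c IH]; rewrite form_at_rcons => E.
have mw := wmultP IH; have h := z0_epar c.
have [Q0|Q0] := eqVneq (hpQ (W s) (wmult (W s))) 0.
  have [_ + _ _ _] := blowup_dicritical c mw Q0; rewrite E.
  by case: (typ c); rewrite /trv /= (pull_z h) eqxx.
have [_ _ gE] := blowup_nondicritical c mw Q0; have [n _] := germ_neq0 c Q0 (size_hpQ _ _).
by rewrite -gE E; case: (typ c); rewrite /lng /= (pull_z h) coefs0 eqxx.
Qed.

Lemma FB_neq0 B s : FB B s != 0. Proof. exact/series_at_neq0/eqn_neq0. Qed.

Lemma blownW s c : blown (W s) c (wmult (W s) + ~~ nondic s).
Proof.
have mw := wmultP (@W_neq0 s); rewrite /nondic; have [Q0|Q0] := eqVneq (hpQ _ _) 0.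
  by have [h _ _ _ _] := blowup_dicritical c mw Q0; rewrite addn1.
by have [h _ _] := blowup_nondicritical c mw Q0; rewrite addn0.
Qed.

Definition inva b s := pull (trv b (W s)) (par b) == 0.
Definition einv b s := (ax b s != None) && inva b s.

Lemma inva_new s c : inva (typ c) (rcons s c) = nondic s.
Proof.
have mw := wmultP (@W_neq0 s); rewrite /inva /nondic form_at_rcons par_typ.
have [Q0|Q0] := eqVneq (hpQ _ _) 0.
  by have [_ /negPf -> _ _ _] := blowup_dicritical c mw Q0.
by have [_ -> _] := blowup_nondicritical c mw Q0; rewrite eqxx.
Qed.

Lemma dicriticalE s : dicritical w s <-> ~~ nondic s.
Proof.
split=> [[c]|nd]; last exists None.
  by rewrite inv_excE -par_typ => /eqP; rewrite -/(inva _ _) inva_new.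
by rewrite inv_excE -par_typ; apply/eqP; rewrite -/(inva _ _) inva_new.
Qed.

Lemma inva_dirb b s : inva b (rcons s (dirb b)) = inva b s.
Proof.
rewrite /inva form_at_rcons; have [E _] := pull_form_axis (blownW s (dirb b)).
by rewrite E mulf_eq0 (negPf (expf_neq0 _ (fpsX_neq0 _))).
Qed.

(** Invariance of a component is decided at its creation and kept by its strict transforms. *)
Lemma inva_nondic b s q : ax b s = Some q -> inva b s = nondic q.
Proof.
elim/last_ind: s => [|s c IH]; first by rewrite ax_nil.
rewrite ax_rcons; case: eqP => [<-|_]; first by case=> <-; rewrite inva_new.
by case: eqP => // -> /IH <-; rewrite inva_dirb.
Qed.

Lemma einv_new s c : einv (typ c) (rcons s c) = nondic s.
Proof. by rewrite /einv ax_new inva_new. Qed.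
Lemma einv_old s c : einv (~~ typ c) (rcons s c) = (c == dirb (~~ typ c)) && einv (~~ typ c) s.
Proof.
rewrite /einv ax_rcons (_ : (typ c == ~~ typ c) = false); last by case: (typ c).
by have [->|//] := eqVneq c (dirb _); rewrite typ_dirb negbK inva_dirb.
Qed.

Lemma pull_series_axis b f : f != 0 ->
  pull f (par b) = fps_X ^+ smult f * pull (series_blowup f (dirb b)) (par b).
Proof.
move=> f0; have fm := smultP f0; rewrite -{1}(pd_par R b) (pull_pd _ (par_z0 R b) fm).
by rewrite excv_par (series_blowupE _ fm).
Qed.

Lemma FB_par_neq0 B b s : ax b s <> None -> pull (FB B s) (par b) != 0.
Proof.
elim/last_ind: s => [|s c IH]; first by rewrite ax_nil.
rewrite ax_rcons series_at_rcons; case: eqP => [<- _|_].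
  by rewrite par_typ; apply/series_blowup_axis/FB_neq0.
case: eqP => // -> /IH; rewrite (pull_series_axis b (FB_neq0 B s)) mulf_eq0 negb_or.
by case/andP.
Qed.

Variables (d : curve R -> int) (bs : seq (curve R)).
Hypothesis ubs : uniq bs.
Hypothesis bsP : forall B, d B != 0 -> B \in bs.
Hypothesis d_sep : forall B, d B != 0 -> separatrix w B.

(* For the strict transform of the divisor [d] at [s]: its intersection number
   with the axis [b], its multiplicity, and the degree of its part through [s]. *)
Definition FD b s : int := \sum_(B <- bs) d B * (ord (pull (FB B s) (par b)))%:Z.
Definition NN s : int := \sum_(B <- bs) d B * (smult (FB B s))%:Z.
Definition LL s : int := \sum_(B <- bs) d B * (`[< passes (eqn B) s >])%:Z.

(** An axis has multiplicity 1, so on blowing up each branch loses its own multiplicity in its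
    contact with the axis. *)
Lemma FD_step b s : ax b s <> None -> FD b s = FD b (rcons s (dirb b)) + NN s.
Proof.
move=> a0; rewrite /FD /NN -big_split; apply: eq_bigr => B _.
have n0 : pull (series_blowup (FB B s) (dirb b)) (par b) != 0.
  by rewrite -series_at_rcons; apply: FB_par_neq0; rewrite ax_dirb.
rewrite (pull_series_axis b (FB_neq0 B s)) (ordM (expf_neq0 _ (fpsX_neq0 _)) n0) ordXn.
by rewrite -series_at_rcons PoszD mulrDr addrC.
Qed.

(** The tangent cone of a branch is a form of degree its multiplicity, whose zeros count the
    intersections of the strict transform with the exceptional line. *)
Lemma NN_sum s : exists K0 : seq (option C), forall K, uniq K -> {subset K0 <= K} ->
  \sum_(c <- K) FD (typ c) (rcons s c) = NN s.
Proof.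
have /choice [K0 K0P] : forall B, exists K0 : seq (option C), forall K, uniq K -> {subset K0 <= K}
  ->
    (\sum_(c <- K) ord (pull (FB B (rcons s c)) (epar c)))%N = smult (FB B s).
  move=> B; have fm := smultP (FB_neq0 B s); have [hm _] := fm.
  have [K0 K0P] := germ_sum hm (size_hp _ _); exists K0 => K uK KK; rewrite -[RHS](K0P K uK KK).
  by apply: eq_bigr => c _; rewrite series_at_rcons (series_blowupE _ fm) pull_epar.
exists (flatten (map K0 bs)) => K uK KK; rewrite /FD /NN; apply: etrans (exchange_big _ _ _ _ _ _)
  _.
apply: eq_big_seq => B Bbs; rewrite -big_distrr /=; congr (_ * _).
rewrite -(K0P B K uK) => [|c cK].
  by rewrite Posz_sum; apply: eq_bigr => c _; rewrite par_typ.
by apply: KK; apply/flattenP; exists (K0 B) => //; apply: map_f.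
Qed.

(** The axes x = 0 and y = 0 cross the exceptional line at the directions [None] and [Some 0]. *)
Lemma sum_old s (K : seq (option C)) : uniq K -> None \in K -> Some 0 \in K ->
  \sum_(c <- K) (einv (~~ typ c) (rcons s c))%:Z = (einv true s)%:Z + (einv false s)%:Z.
Proof.
move=> uK NK ZK; transitivity (\sum_(c <- K) ((c == None)%:Z * (einv true s)%:Z +
    (c == Some 0)%:Z * (einv false s)%:Z)).
  apply: eq_bigr => c _; rewrite einv_old; case: c => [z|] /=.
    by rewrite mul0r add0r; case: (_ == _); rewrite ?mul1r ?mul0r.
  by rewrite mul1r mul0r addr0.
have S (x : option C) (e : int) : x \in K -> \sum_(c <- K) (c == x)%:Z * e = e.
  by move=> xK; rewrite (bigD1_seq x) //= eqxx mul1r big1 ?addr0 // => c /negPf ->; rewrite mul0r.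
rewrite big_split; congr (_ + _); exact: S.
Qed.

Hypothesis T_closed : prefix_closed T.
Hypothesis d_dic : forall q, q \in Dic w T ->
  \sum_(B <- bs) d B * (`[< Curv w T q B >])%:Z = 2 - (valence T q)%:Z.

(* [stI] computes the index of the foliation along an invariant component and
   [stJ] its tangency with a dicritical one, where [k] reaches the point of the
   component that is not blown up any more. *)
Definition stI b s := einv b s -> pull (lng b (W s)) (par b) != 0 /\
  (ord (pull (lng b (W s)) (par b)))%:Z = FD b s + (einv (~~ b) s)%:Z.
Definition cornb s : bool := [forall b, ax b s != None].
Definition stJ b s := ax b s <> None -> ~~ inva b s ->
  exists k, leaf T (s ++ nseq k (dirb b)) /\
    (ord (pull (trv b (W s)) (par b)))%:Z = FD b s - LL (s ++ nseq k (dirb b)) +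
      (einv (~~ b) s)%:Z - (cornb (s ++ nseq k (dirb b)))%:Z.
(** The multiplicity for which [stI] and [stJ] at s follow from the same statements one blow-up
    further along the axis. *)
Definition stA s := NN s = (wmult (W s))%:Z + 1 - (einv true s)%:Z - (einv false s)%:Z.

Lemma einv_sum b s : (einv true s)%:Z + (einv false s)%:Z = (einv b s)%:Z + (einv (~~ b) s)%:Z.
Proof. by case: b; [reflexivity|exact: addrC]. Qed.

(** Downstairs the index gains nu - 1, or nu at a dicritical point, and the intersection number
    gains [NN s]; upstairs the other axis is the new component, counted exactly when invariant.
    [stA] balances these changes. *)
Lemma step_I b s : stA s -> stI b (rcons s (dirb b)) -> stI b s.
Proof.
move=> A I e; have a0 : ax b s <> None by apply/eqP; case/andP: e.
have e' : einv b (rcons s (dirb b)).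
  by have := einv_old s (dirb b); rewrite typ_dirb negbK eqxx e.
have [n0 I'] := I e'; have [_ E] := pull_form_axis (blownW s (dirb b)).
rewrite -form_at_rcons in E.
have n1 : pull (lng b (W s)) (par b) != 0.
  have := mulf_neq0 (expf_neq0 (wmult (W s) + ~~ nondic s) (fpsX_neq0 C)) n0; rewrite -E.
  by rewrite mulf_eq0 negb_or => /andP[].
split=> //; have := congr1 (fun p => (ord p)%:Z) E.
rewrite (ordM (fpsX_neq0 C) n1) (ordM (expf_neq0 _ (fpsX_neq0 C)) n0) ord_fpsX ordXn.
rewrite !PoszD I' (FD_step a0) A.
have := einv_new s (dirb b); rewrite typ_dirb => ->.
have ar (o m F e1 e2 e3 n n' : int) : e2 + e3 = 1 + e1 -> n + n' = 1 ->
    1 + o = m + n' + (F + n) -> o = F + (m + 1 - e2 - e3) + e1 by clear; lia.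
apply: ar; last by case: (nondic s).
by rewrite (einv_sum b s) e.
Qed.

Lemma step_J b s : stA s -> stJ b (rcons s (dirb b)) -> stJ b s.
Proof.
move=> A J a0 ni; have [||k [lk J']] := J; rewrite ?ax_dirb ?inva_dirb //.
exists k.+1; rewrite cat_rcons in lk J'; split; first exact: lk.
have [E _] := pull_form_axis (blownW s (dirb b)); rewrite -form_at_rcons in E.
have n0 : pull (trv b (W (rcons s (dirb b)))) (par b) != 0.
  by rewrite -/(inva _ _) inva_dirb.
rewrite E (ordM (expf_neq0 _ (fpsX_neq0 C)) n0) ordXn !PoszD J' (FD_step a0) A.
have := einv_new s (dirb b); rewrite typ_dirb => ->.
have e0 : einv b s = false by rewrite /einv (negPf ni) andbF.
have ar (m F L e1 e2 e3 n n' k0 : int) : e2 + e3 = e1 -> n + n' = 1 ->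
    m + n' + (F - L + n - k0) = F + (m + 1 - e2 - e3) - L + e1 - k0 by clear; lia.
apply: ar; last by case: (nondic s).
by rewrite (einv_sum b s) e0 add0r.
Qed.

(** A separatrix goes through at most one leaf, so it contributes to one term only, in the direction
    [cB B], and does so when it belongs to [Curv w T s]. *)
Lemma sum_LL s (k : option C -> nat) (cB : curve R -> option C) (K : seq (option C)) : s \in T ->
  uniq K -> (forall c, leaf T (rcons s c ++ nseq (k c) (dirb (typ c)))) ->
  (forall B c, passes (eqn B) (rcons s c ++ nseq (k c) (dirb (typ c))) ->
     passes (eqn B) (rcons s (cB B) ++ nseq (k (cB B)) (dirb (typ (cB B))))) ->
  {subset map cB bs <= K} ->
  \sum_(c <- K) LL (rcons s c ++ nseq (k c) (dirb (typ c))) =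
  \sum_(B <- bs) d B * (`[< Curv w T s B >])%:Z.
Proof.
move=> sT uK lk cBP KK; rewrite /LL; apply: etrans (exchange_big _ _ _ _ _ _) _.
apply: eq_big_seq => B Bbs; rewrite -big_distrr /=.
have [->|d0] := eqVneq (d B) 0; first by rewrite !mul0r.
congr (_ * _); pose l c : pt := rcons s c ++ nseq (k c) (dirb (typ c)).
have {}lk c : leaf T (l c) := lk c.
have {}cBP c : passes (eqn B) (l c) -> passes (eqn B) (l (cB B)) := cBP B c.
change (\sum_(i <- K) (`[< passes (eqn B) (l i) >])%:Z = (`[< Curv w T s B >])%:Z).
have linj c c' : l c = l c' -> c = c'.
  by rewrite /l !cat_rcons => /eqP; rewrite eqseq_cat // eqxx /= eqseq_cons => /andP[/eqP].
have CE : Curv w T s B <-> passes (eqn B) (l (cB B)).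
  split=> [[_ [s' [ls' ss' ps']]]|p].
    have [c [k' sE]] := on_componentP ss'; apply: (cBP c).
    by rewrite /l -(follow_uniq (s := rcons s c) (c := dirb (typ c)) (k := k') T_closed _ (lk c))
      // -sE.
  split; first exact: d_sep; exists (l (cB B)); split=> //.
  by apply/on_componentE; exists (typ (cB B)); apply: ax_follow.
rewrite (bigD1_seq (cB B)) //=; last by apply: KK; apply: map_f.
rewrite big1 => [|c cc]; first by rewrite addr0; congr (Posz (nat_of_bool _));
  apply/asboolP/asboolP => /CE.
case: asboolP => // p; move/eqP: cc; case; apply: linj.
exact: passes_leaf_uniq (lk _) (lk _) p (cBP _ p).
Qed.

Lemma step_A s : s \in T -> (forall b c, stI b (rcons s c) /\ stJ b (rcons s c)) -> stA s.
Proof.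
move=> sT ch; have [KN KNP] := NN_sum s; have mw := wmultP (@W_neq0 s).
have [nd|nd] := boolP (nondic s).
  have [KG KGP] := germ_sum nd (size_hpQ (W s) (wmult (W s))).
  pose K := undup [:: None, Some 0 & KN ++ KG].
  have uK : uniq K := undup_uniq _.
  have KP x : x \in [:: None, Some 0 & KN ++ KG] -> x \in K by rewrite mem_undup.
  have NK : None \in K by apply: KP; rewrite inE eqxx.
  have ZK : Some 0 \in K by apply: KP; rewrite !inE eqxx orbT.
  (* The indices along the new invariant component have sum nu + 1 by [germ_sum], and [NN s] plus
     the number of invariant axes at s by [stI]. *)
  have E : \sum_(c <- K) (ord (germ (wmult (W s)).+1 (hpQ (W s) (wmult (W s))) c))%:Z =
     \sum_(c <- K) (FD (typ c) (rcons s c) + (einv (~~ typ c) (rcons s c))%:Z).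
    apply: eq_bigr => c _; have [I _] := ch (typ c) c.
    have [_ <-] := I (etrans (einv_new s c) nd).
    by have [_ _ <-] := blowup_nondicritical c mw nd; rewrite form_at_rcons par_typ.
  move: E; rewrite big_split /= KNP //; last by move=> x xN; apply: KP; rewrite !inE mem_cat xN
    !orbT.
  rewrite (sum_old s uK NK ZK) => E.
  have : (\sum_(c <- K) ord (germ (wmult (W s)).+1 (hpQ (W s) (wmult (W s))) c))%N = (wmult (W
    s)).+1.
    by apply: KGP => // x xG; apply: KP; rewrite !inE mem_cat xG !orbT.
  move/(congr1 Posz); rewrite Posz_sum E /stA.
  by rewrite -addn1 PoszD; lia.
have Q0 : hpQ (W s) (wmult (W s)) = 0 by apply/eqP; move: nd; rewrite negbK.
have [_ _ _ m0 [h20 sh]] := blowup_dicritical None mw Q0.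
have sh' : (size (hp (W s).2 (wmult (W s))) <= (wmult (W s)).-1.+1)%N by rewrite (prednK m0).
have [KG KGP] := germ_sum h20 sh'.
have /choice [k kP] : forall c, exists k, leaf T (rcons s c ++ nseq k (dirb (typ c))) /\
    (ord (germ (wmult (W s)).-1 (hp (W s).2 (wmult (W s))) c))%:Z =
      FD (typ c) (rcons s c) - LL (rcons s c ++ nseq k (dirb (typ c))) +
      (einv (~~ typ c) (rcons s c))%:Z - (cornb (rcons s c ++ nseq k (dirb (typ c))))%:Z.
  move=> c; have [_ J] := ch (typ c) c; have [||k [lk JE]] := J; rewrite ?ax_new ?inva_new //.
  exists k; split=> //; rewrite -JE.
  by have [_ _ <- _ _] := blowup_dicritical c mw Q0; rewrite form_at_rcons par_typ.
have lk c := proj1 (kP c).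
have /choice [cB cBP] : forall B, exists c0, forall c, passes (eqn B) (rcons s c ++ nseq (k c)
  (dirb (typ c))) ->
    passes (eqn B) (rcons s c0 ++ nseq (k c0) (dirb (typ c0))).
  move=> B; have [[c0 p]|n] := pselect (exists c, passes (eqn B) (rcons s c ++ nseq (k c) (dirb
    (typ c)))).
    by exists c0.
  by exists None => c p; case: n; exists c.
pose K := undup [:: None, Some 0 & KN ++ KG ++ map cB bs ++ [seq last None s | s <- T]].
have uK : uniq K := undup_uniq _.
have KP x : x \in [:: None, Some 0 & KN ++ KG ++ map cB bs ++ [seq last None s | s <- T]] -> x \in
  K.
  by rewrite mem_undup.
have NK : None \in K by apply: KP; rewrite inE eqxx.
have ZK : Some 0 \in K by apply: KP; rewrite !inE eqxx orbT.
have E : \sum_(c <- K) (ord (germ (wmult (W s)).-1 (hp (W s).2 (wmult (W s))) c))%:Z =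
   \sum_(c <- K) FD (typ c) (rcons s c) - \sum_(c <- K) LL (rcons s c ++ nseq (k c) (dirb (typ c)))
     +
   \sum_(c <- K) (einv (~~ typ c) (rcons s c))%:Z -
   \sum_(c <- K) (cornb (rcons s c ++ nseq (k c) (dirb (typ c))))%:Z.
  rewrite -sumrB -big_split /= -sumrB; apply: eq_bigr => c _; exact: proj2 (kP c).
have sD : s \in Dic w T by rewrite !inE sT; apply/asboolP/dicriticalE.
rewrite (sum_LL sT uK lk (fun B c => cBP B c)) in E; last first.
  by move=> x xB; apply: KP; rewrite !inE !mem_cat xB !orbT.
rewrite (d_dic sD) KNP // in E; last by move=> x xN; apply: KP; rewrite !inE !mem_cat xN !orbT.
rewrite (sum_old s uK NK ZK) in E.
have V : \sum_(c <- K) (cornb (rcons s c ++ nseq (k c) (dirb (typ c))))%:Z = (valence T s)%:Z.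
  rewrite (leaf_corner_valence T_closed sT uK NK ZK _ lk) ?Posz_sum //.
  by move=> x xT; apply: KP; rewrite !inE !mem_cat xT !orbT.
rewrite V in E.
have : (\sum_(c <- K) ord (germ (wmult (W s)).-1 (hp (W s).2 (wmult (W s))) c))%N = (wmult (W
  s)).-1.
  by apply: KGP => // x xG; apply: KP; rewrite !inE !mem_cat xG !orbT.
move/(congr1 Posz); rewrite Posz_sum E /stA.
have -> : (wmult (W s))%:Z = (wmult (W s)).-1%:Z + 1 by rewrite -{1}(prednK m0) -addn1 PoszD.
(* The tangencies have sum nu - 1. The separatrices crossing the component take away 2 - v and the
   corners v, so the valence cancels. *)
have ar (N v e1 e2 m : int) : N - (2 - v) + (e1 + e2) - v = m -> N = m + 1 + 1 - e1 - e2.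
  by move=> <-; ring.
exact: ar.
Qed.

Hypothesis base : forall s b, leaf T s -> stI b s /\ stJ b s.

Lemma tree_A s : s \in T -> stA s.
Proof.
move=> sT; suff H t : t \in T \/ leaf T t -> forall b, stI b t /\ stJ b t.
  by apply: (step_A sT) => b c; apply: H; apply: leaf_child.
move: t; apply: tree_ind => [t lt b|t tT ch b]; first exact: base.
have A := step_A tT (fun b' c => ch c b'); have [I J] := ch (dirb b) b.
by split; [apply: step_I|apply: step_J].
Qed.
End Tree.

(** * Invariant branches at infinitely near points *)

Section Invariance.
Variable R : realType.
Notation C := (complex R).
Notation pt := (infnear R).
Implicit Types (s q : pt) (c : option C) (b : bool) (B : curve R) (f g : series2 R) (gam : fps C *
  fps C) (w z : oneform R).

Lemma fps_deriv_neq0 (p : fps C) : coefs p 0 = 0 -> p != 0 -> fps_deriv p != 0.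
Proof.
move=> p0 pn; have op := is_ord_ex pn; have n0 := ord_gt0 pn p0.
have [_ E] := lead_deriv op n0; have [c0 _] := op.
apply/eqP => D; move: E; rewrite D coefs0 => /esym/eqP; apply/negP.
by rewrite -mulr_natr mulf_neq0 // pnatr_eq0 -lt0n.
Qed.

Lemma deriv_nz gam : z0 gam -> nz gam -> fps_deriv gam.1 != 0 \/ fps_deriv gam.2 != 0.
Proof. by move=> [h1 h2] [n|n]; [left|right]; apply: fps_deriv_neq0. Qed.

(** Along [gam] both the form and df annihilate the nonzero velocity, hence are proportional. *)
Lemma inv_wedge z f gam : z0 gam -> nz gam -> inv z gam -> pull f gam = 0 ->
  pull (wedge_d z f) gam = 0.
Proof.
move=> h n I f0; have D := pull_deriv f h.
rewrite f0 (_ : fps_deriv (0 : fps C) = 0) in D; last first.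
  by apply: fpsP => k; rewrite coefs_deriv !coefs0 mul0rn.
rewrite /wedge_d (pullB _ _ h) (pullM _ (dy f) h) (pullM _ (dx f) h).
move: I D; rewrite /inv; move: (pull z.1 gam) (pull z.2 gam) (pull (dx f) gam) (pull (dy f) gam) =>
  a b x y I D.
case: (deriv_nz h n) => dn; apply: (mulIf dn); rewrite mul0r.
  transitivity (y * (a * fps_deriv gam.1 + b * fps_deriv gam.2) - b * (x * fps_deriv gam.1 + y *
    fps_deriv gam.2)).
    by move: (fps_deriv gam.1) (fps_deriv gam.2) => u v; ring.
  by rewrite I -D !mulr0 subrr.
transitivity (a * (x * fps_deriv gam.1 + y * fps_deriv gam.2) - x * (a * fps_deriv gam.1 + b *
  fps_deriv gam.2)).
  by move: (fps_deriv gam.1) (fps_deriv gam.2) => u v; ring.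
by rewrite I -D !mulr0 subrr.
Qed.

(** Otherwise f divides both its derivatives, which then have multiplicity at least that of f; in
    characteristic 0 this kills its lowest-degree part. *)
Lemma grad_neq0 B gam : z0 gam -> nz gam -> pull (eqn B) gam = 0 ->
  pull (dx (eqn B)) gam != 0 \/ pull (dy (eqn B)) gam != 0.
Proof.
move=> h n f0; apply: contrapT => /not_orP [/negP/negPn/eqP X /negP/negPn/eqP Y].
have [a aE] := (pull_ker_curve h n f0 _).1 X; have [b bE] := (pull_ker_curve h n f0 _).1 Y.
have [m fm] := is_mult_ex (eqn_neq0 B); have m0 := is_mult_gt0 fm (eqn00 B).
have V e g : e = g * eqn B -> vg2 m e.
  by move=> ->; rewrite -[m]add0n; apply: vg2M (@vg2_0 R g) (is_mult_vg2 fm).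
have [hm _] := fm; case/eqP: hm; apply/polyP => l; rewrite coef_hp coef0.
case: leqP => // lm; apply/eqP; apply: contraT => c0.
case E: (m - l)%N c0 => [|i] c0.
  have lE : l = m by apply/eqP; rewrite eqn_leq lm -subn_eq0 E.
  case: l lE c0 {lm E} => [lE|l lE c0]; first by rewrite -lE in m0.
  have := V _ _ bE 0%N l; rewrite coef2_deriv_y -lE => /(_ (ltnSn _)) /eqP.
  by rewrite -mulr_natr mulf_eq0 (negPf c0) pnatr_eq0.
have il : (i + l < m)%N by rewrite -addSn -E subnK.
have := V _ _ aE i l il; rewrite coef2_deriv_x => /eqP.
by rewrite -mulr_natr mulf_eq0 (negPf c0) pnatr_eq0.
Qed.

Lemma separatrix_inv w B gam : z0 gam -> nz gam -> pull (eqn B) gam = 0 ->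
  separatrix w B <-> inv w gam.
Proof.
move=> h n f0; split=> [S|I]; last exact/(pull_ker_curve h n f0)/(inv_wedge h n I f0).
have := (pull_ker_curve h n f0 _).2 S; rewrite /wedge_d (pullB _ _ h) (pullM _ (dy _) h) (pullM _
  (dx _) h).
have D := pull_deriv (eqn B) h; rewrite f0 (_ : fps_deriv (0 : fps C) = 0) in D; last first.
  by apply: fpsP => k; rewrite coefs_deriv !coefs0 mul0rn.
have gn := grad_neq0 h n f0; rewrite /inv.
move: (pull w.1 gam) (pull w.2 gam) (pull (dx _) gam) (pull (dy _) gam) gn D => a b x y gn D E.
case: gn => gn; apply: (mulIf gn); rewrite mul0r.
  transitivity (a * (x * fps_deriv gam.1 + y * fps_deriv gam.2) - (a * y - b * x) * fps_deriv
    gam.2).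
    by move: (fps_deriv gam.1) (fps_deriv gam.2) => u v; ring.
  by rewrite E -D mulr0 mul0r subrr.
transitivity (b * (x * fps_deriv gam.1 + y * fps_deriv gam.2) + (a * y - b * x) * fps_deriv gam.1).
  by move: (fps_deriv gam.1) (fps_deriv gam.2) => u v; ring.
by rewrite E -D mulr0 mul0r addr0.
Qed.

Lemma push_rcons s c gam : push (rcons s c) gam = push s (pd c gam).
Proof. exact: foldr_rcons. Qed.

Lemma nz_push s gam : nz (push s gam) -> nz gam.
Proof.
elim: s => //= c s IH /pd_nz_excv e; apply: IH.
by move: e; case: (c) => [x|]; [left|right].
Qed.

Lemma inv_push w s gam : w <> (0, 0) -> z0 gam -> nz (push s gam) ->
  inv w (push s gam) <-> inv (form_at w s) gam.
Proof.
move=> w0; elim/last_ind: s gam => [//|s c IH] gam h; rewrite push_rcons => n.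
rewrite form_at_rcons -(inv_step h _ (blownW w0 s c)); last exact: pd_nz_excv (nz_push n).
exact: IH (pd_z0 c h) n.
Qed.

(** The constant term of a proportionality: at a regular point it fixes the tangent of the strict
    transform. *)
Lemma separatrix_at w s B : w <> (0, 0) -> separatrix w B -> passes (eqn B) s ->
  coef2 (form_at w s).1 0 0 * coef2 (series_at (eqn B) s) 0 1 =
  coef2 (form_at w s).2 0 0 * coef2 (series_at (eqn B) s) 1 0.
Proof.
move=> w0 S p; have [gam [h n g0]] := branch_exists (FB_neq0 B s) p.
have [r0 rn] := root_push (eqn_neq0 B) h n g0.
have := (separatrix_inv w (push_z0 s h) rn r0).1 S => /(inv_push w0 h rn) I.
have := congr1 (fun p => coefs p 0) (inv_wedge h n I g0).
rewrite pull_coef0 coefs0 /wedge_d coef2B !coef2M00 coef2_deriv_x coef2_deriv_y !mulr1n.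
by move/eqP; rewrite subr_eq0 => /eqP.
Qed.

Definition axc b gam : fps C := if b then gam.1 else gam.2.
Definition off_axes s gam := forall b, ax b s <> None -> axc b gam != 0.

Lemma excv_axc c gam : excv c gam = axc (typ c) gam. Proof. by case: c. Qed.
Lemma axc_pd c gam : axc (typ c) (pd c gam) = excv c gam. Proof. by case: c. Qed.

(** The other coordinate downstairs is the exceptional equation times y, where y is again the
    equation of the axis in the direction of that axis, and a unit elsewhere. *)
Lemma axc_pdN c gam : z0 gam -> exists2 y, axc (~~ typ c) (pd c gam) = excv c gam * y &
  if c == dirb R (~~ typ c) then y = axc (~~ typ c) gam else coefs y 0 != 0.
Proof.
case: gam => p r [/= p0 r0]; case: c => [x|] /=; last by exists p; rewrite // mulrC.
exists (r + fps_const x) => //; rewrite (inj_eq (@Some_inj _)).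
have [->|x0] := eqVneq x 0; first by rewrite rmorph0 addr0.
by rewrite coefsD coefsC r0 add0r.
Qed.

(** An invariant branch contained in no exceptional component can be blown down step by step without
    becoming constant, and at the origin its curve is a separatrix. *)
Lemma leaf_branch w s gam : w <> (0, 0) -> z0 gam -> nz gam -> inv (form_at w s) gam ->
  off_axes s gam -> exists B, separatrix w B /\ pull (series_at (eqn B) s) gam = 0.
Proof.
move=> w0; elim/last_ind: s gam => [|s c IH] gam h n I off.
  have [B BP] := branch_curve h n; have b0 : pull (eqn B) gam = 0.
    by apply/BP; exists 1; rewrite mul1r.
  by exists B; split=> //; apply/(separatrix_inv w h n b0).
have e0 : excv c gam != 0 by rewrite excv_axc; apply: off; rewrite ax_new.
have [||B [S b0]] := IH (pd c gam) (pd_z0 c h) (pd_nz e0).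
- by apply/(inv_step h e0 (blownW w0 s c)); rewrite -form_at_rcons.
- move=> b a0; have [->|bt] := eqVneq b (typ c); first by rewrite axc_pd.
  have -> : b = ~~ typ c by case: (b) (typ c) bt => [] [].
  have [y -> Y] := axc_pdN c h; rewrite mulf_neq0 //; move: Y.
  have [cd ->|_ y0] := eqVneq c (dirb R (~~ typ c)); last first.
    by apply: contraNneq y0 => ->; rewrite coefs0.
  apply: off; rewrite ax_rcons -cd eqxx; case: eqP => // _.
  by move: a0; rewrite (_ : b = ~~ typ c) //; case: (b) (typ c) bt => [] [].
exists B; split; [exact: S|]; have fm := smultP (FB_neq0 B s).
move: b0; rewrite (pull_pd c h fm) -(series_blowupE c fm) => /eqP.
by rewrite mulf_eq0 (negPf (expf_neq0 _ e0)) series_at_rcons => /eqP.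
Qed.

Lemma axis_root b f gam : z0 gam -> nz gam -> axc b gam = 0 -> pull f gam = 0 ->
  pull f (par R b) = 0.
Proof.
move=> h n a0 f0; pose c : option C := if b then Some 0 else None.
have tc : typ c = b by rewrite /c; case: (b).
have := axis_comp (c := c) f h; rewrite excv_axc tc => /(_ a0).
rewrite f0 -par_typ tc => E; apply/eqP; apply: contraT => p0.
have := comp1_neq0 _ _ p0; move/(_ (if c is Some _ then gam.2 else gam.1)).
rewrite -E eqxx => H; apply: H; rewrite /c; first by case: (b); case: h.
by move: a0 n; case: (b) => /= a0 []; rewrite ?a0 ?eqxx.
Qed.

Lemma axis_branch b z gam : z0 gam -> nz gam -> inv z gam -> axc b gam = 0 ->
  pull (trv b z) (par R b) = 0.
Proof.
move=> h n I a0; apply: (axis_root h n a0).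
have D0 : fps_deriv (0 : fps C) = 0 by apply: fpsP => k; rewrite coefs_deriv !coefs0 mul0rn.
have dn := deriv_nz h n; move: I; rewrite /inv.
case: b a0 => /= a0; move: dn; rewrite a0 D0 eqxx.
  by case=> // dn; rewrite mulr0 add0r => /eqP; rewrite mulf_eq0 (negPf dn) orbF => /eqP.
by case=> // dn; rewrite mulr0 addr0 => /eqP; rewrite mulf_eq0 (negPf dn) orbF => /eqP.
Qed.

Lemma coefs_pull_par b f n : coefs (pull f (par R b)) n = if b then coef2 f 0 n else coef2 f n 0.
Proof. by case: b; [exact: pull_axis1|exact: pull_axis2]. Qed.

(** For f vanishing at 0, this is nonzero exactly when f is transverse to the axis b. *)
Definition tr1 b f : C := if b then coef2 f 0 1 else coef2 f 1 0.

Lemma ord_par1 b f : coef2 f 0 0 = 0 -> tr1 b f != 0 ->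
  pull f (par R b) != 0 /\ ord (pull f (par R b)) = 1%N.
Proof.
move=> f0 f1; have o : is_ord (pull f (par R b)) 1.
  split=> [|[|//] _]; rewrite coefs_pull_par; last by case: (b).
  by move: f1; rewrite /tr1; case: (b).
by split; [exact: is_ord_neq0 o|exact: ordE].
Qed.
Lemma ord_pull0 f gam : coef2 f 0 0 != 0 -> ord (pull f gam) = 0%N.
Proof. by move=> f0; apply: ord_eq0; rewrite pull_coef0. Qed.
End Invariance.

(** * The index formula on a resolved tree without saddle-nodes *)

Section Resolved.
Variable R : realType.
Notation C := (complex R).
Notation pt := (infnear R).
Implicit Types (s q : pt) (c : option C) (b : bool) (B : curve R) (f g : series2 R) (gam : fps C *
  fps C).
Variables (w : oneform R) (T : {fset pt}).
Hypothesis wn0 : w <> (0, 0).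
Hypothesis wT : resolves w T.
Hypothesis T0 : T != fset0.
Hypothesis no_sn : forall s, leaf T s -> ~ saddle_node (form_at w s).
Notation W s := (form_at w s).
Notation FB B s := (series_at (eqn B) s).
Notation par b := (par R b).
Notation dirb b := (dirb R b).

Let T_closed : prefix_closed T. Proof. by case: wT. Qed.

Lemma leaf_singular s : leaf T s -> singular (W s) -> exists lam, lam_ok lam /\
  has_linear_part (W s) (varY R, - const2 lam * varX R).
Proof.
move=> ls sg; have [_ /(_ s ls sg) [[lam L H]|/(no_sn ls)//] _] := wT.
by exists lam.
Qed.

Lemma leaf_curve s B : leaf T s -> separatrix w B -> passes (eqn B) s ->
  [/\ coef2 (FB B s) 1 0 != 0 \/ coef2 (FB B s) 0 1 != 0,
      forall b, ax b s <> None -> tr1 b (FB B s) != 0,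
      ~ corner s & forall B', separatrix w B' -> passes (eqn B') s -> B' = B].
Proof.
move=> ls S p; have [_ _ /(_ T0 s B ls S p) [l0 t1 t2 nc u]] := wT; split=> //.
  apply: contrapT => /not_orP [/negP/negPn/eqP X /negP/negPn/eqP Y]; move/eqP: l0; apply.
  by rewrite /linear_part X Y !rmorph0 !mul0r addr0.
case=> a; [move: (t1 a)|move: (t2 a)]; rewrite /transverse.
  by rewrite !coef2X /= mulr0 mulr1 sub0r oppr_eq0.
by rewrite !coef2Y /= mulr1 mulr0 subr0.
Qed.

Lemma tangent_eqn s B gam : z0 gam -> pull (FB B s) gam = 0 ->
  coef2 (FB B s) 1 0 * coefs gam.1 1 + coef2 (FB B s) 0 1 * coefs gam.2 1 = 0.
Proof. by move=> h E; rewrite -(pull_coef1 _ h) E coefs0. Qed.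

Lemma root_passes s B gam : pull (FB B s) gam = 0 -> passes (eqn B) s.
Proof. by move=> E; rewrite /passes -(pull_coef0 gam) E coefs0. Qed.

Lemma leaf_two_branches s : leaf T s -> singular (W s) -> exists g1 g2 : fps C * fps C,
  [/\ z0 g1 /\ z0 g2, nz g1 /\ nz g2, inv (W s) g1, inv (W s) g2 &
      coefs g1.1 1 * coefs g2.2 1 - coefs g1.2 1 * coefs g2.1 1 != 0].
Proof.
move=> ls sg; have [lam [L H]] := leaf_singular ls sg.
have [g1 [g2 [h1 h2 I1 I2 tr]]] := lambda_branches L H.
exists g1, g2; split=> //; split.
  have [E|?] := eqVneq g1.1 0; last by left.
  by right; apply: contraNneq tr => E2; rewrite E E2 !coefs0 !mul0r subrr.
have [E|?] := eqVneq g2.1 0; last by left.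
by right; apply: contraNneq tr => E2; rewrite E E2 !coefs0 !mulr0 subrr.
Qed.

Lemma transverse_off b (g1 g2 : fps C * fps C) :
  coefs g1.1 1 * coefs g2.2 1 - coefs g1.2 1 * coefs g2.1 1 != 0 ->
  axc b g1 != 0 \/ axc b g2 != 0.
Proof.
move=> tr; apply: contrapT => /not_orP [/negP/negPn/eqP X /negP/negPn/eqP Y]; move/eqP: tr; apply.
by move: X Y; case: b => /= -> ->; rewrite coefs0 ?mul0r ?mulr0 subrr.
Qed.

Lemma off_axesI s b gam : axc b gam != 0 -> (ax (~~ b) s <> None -> axc (~~ b) gam != 0) ->
  off_axes s gam.
Proof.
move=> a1 a2 b' a'; have [->|bb] := eqVneq b' b; first exact: a1.
have E : b' = ~~ b by case: (b') (b) bb => [] [].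
by rewrite E; apply: a2; rewrite -E.
Qed.

Lemma corner_no_curve s b B : leaf T s -> separatrix w B -> passes (eqn B) s ->
  ax b s <> None -> ax (~~ b) s <> None -> False.
Proof.
move=> ls S p a1 a2; have [_ _ nc _] := leaf_curve ls S p; apply: nc; apply/ax_corner => b'.
by have [->|bb] := eqVneq b' b; [|rewrite (_ : b' = ~~ b) //; case: (b') (b) bb => [] []].
Qed.

Lemma off_axis s b gam : z0 gam -> nz gam -> inv (W s) gam -> ~~ inva w b s -> axc b gam != 0.
Proof. by move=> h n I; apply: contra => /eqP a; apply/eqP; apply: axis_branch h n I a. Qed.

(** Otherwise the two branches of the reduced singularity lie off the axis. Without a second
    component, both are separatrices through one leaf, which must coincide although their tangents
    differ. With a second component, one of them also lies off it, and is a separatrix through a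
    corner. *)
Lemma singular_axis_inv s b : leaf T s -> singular (W s) -> ax b s <> None -> inva w b s.
Proof.
move=> ls sg a0; apply: contraT => ni.
have [g1 [g2 [[h1 h2] [n1 n2] I1 I2 tr]]] := leaf_two_branches ls sg.
have o1 := off_axis h1 n1 I1 ni; have o2 := off_axis h2 n2 I2 ni.
have [aN|aN] := eqVneq (ax (~~ b) s) None.
  have [B1 [S1 r1]] := leaf_branch wn0 h1 n1 I1 (off_axesI o1 (fun H => False_ind _ (H aN))).
  have [B2 [S2 r2]] := leaf_branch wn0 h2 n2 I2 (off_axesI o2 (fun H => False_ind _ (H aN))).
  have [ll _ _ /(_ B2 S2 (root_passes r2)) E] := leaf_curve ls S1 (root_passes r1).
  rewrite E in r2; have t1 := tangent_eqn h1 r1; have t2 := tangent_eqn h2 r2.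
  move: ll tr t1 t2; move: (coef2 _ 1 0) (coef2 _ 0 1) (coefs g1.1 1) (coefs g1.2 1) (coefs g2.1 1)
    (coefs g2.2 1).
  move=> p q a b' c e ll tr t1 t2.
  have p0 : p = 0.
    apply: (mulIf tr); rewrite mul0r.
    transitivity (e * (p * a + q * b') - b' * (p * c + q * e)); first by ring.
    by rewrite t1 t2 !mulr0 subrr.
  have q0 : q = 0.
    apply: (mulIf tr); rewrite mul0r.
    transitivity (a * (p * c + q * e) - c * (p * a + q * b')); first by ring.
    by rewrite t1 t2 !mulr0 subrr.
  by move: ll; rewrite p0 q0 eqxx => -[].
have aN' : ax (~~ b) s <> None by apply/eqP.
by case: (transverse_off (~~ b) tr) => o;
  [have [B [S r]] := leaf_branch wn0 h1 n1 I1 (off_axesI o1 (fun _ => o))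
  |have [B [S r]] := leaf_branch wn0 h2 n2 I2 (off_axesI o2 (fun _ => o))];
  case: (corner_no_curve ls S (root_passes r) a0 aN').
Qed.

Lemma singular_axis (z : oneform R) b : detw z != 0 -> pull (trv b z) (par b) = 0 ->
  tr1 b (lng b z) != 0 /\ tr1 (~~ b) (trv b z) != 0.
Proof.
rewrite /detw => dt E; have := congr1 (fun p => coefs p 1) E; rewrite coefs0 coefs_pull_par.
move: dt; case: b {E} => /= dt E; move: dt; rewrite E ?mul0r ?mulr0 sub0r oppr_eq0;
by rewrite mulf_eq0 negb_or => /andP[-> ->].
Qed.

Lemma regular_axis (z : oneform R) b : ~ singular z -> coef2 (trv b z) 0 0 = 0 ->
  coef2 (lng b z) 0 0 != 0.
Proof. by case: b => /= ns E; apply/eqP => E'; apply: ns. Qed.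

Lemma inva_coef0 b s : inva w b s -> coef2 (trv b (W s)) 0 0 = 0.
Proof. by move/eqP => E; rewrite -(pull_coef0 (par b)) E coefs0. Qed.

(** At a regular point of an invariant component the only possible tangent is that of the component,
    whereas a separatrix is transverse to it. *)
Lemma regular_inv_no_curve s b B : leaf T s -> ~ singular (W s) -> einv w b s ->
  separatrix w B -> passes (eqn B) s -> False.
Proof.
move=> ls ns /andP[/eqP a0 /inva_coef0 t0] S p; have l0 := regular_axis ns t0.
have [_ /(_ b a0) tr _ _] := leaf_curve ls S p.
have := separatrix_at wn0 S p; move/eqP: tr; move: l0 t0; case: (b) => /= l0 t0 tr E; apply: tr.
  by apply: (mulfI l0); rewrite E t0 mul0r mulr0.
by apply: (mulfI l0); rewrite -E t0 mul0r mulr0.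
Qed.

Variables (d : curve R -> int) (bs : seq (curve R)).
Hypothesis ubs : uniq bs.
Hypothesis bsP : forall B, d B != 0 -> B \in bs.
Hypothesis d_sep : forall B, d B != 0 -> separatrix w B.
Hypothesis d_isol : forall B, Isol w T B -> d B = 1.
Hypothesis d_dic : forall q, q \in Dic w T ->
  \sum_(B <- bs) d B * (`[< Curv w T q B >])%:Z = 2 - (valence T q)%:Z.

Lemma FD_leaf s b : leaf T s -> ax b s <> None -> FD d bs b s = LL d bs s.
Proof.
move=> ls a0; apply: eq_bigr => B _; have [->|d0] := eqVneq (d B) 0; first by rewrite !mul0r.
congr (_ * _); case: asboolP => p; last by rewrite ord_pull0 //; apply/eqP.
have [_ /(_ b a0) tr _ _] := leaf_curve ls (d_sep d0) p.
by have [_ ->] := ord_par1 p tr.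
Qed.

Lemma LL_none s : (forall B, separatrix w B -> passes (eqn B) s -> False) -> LL d bs s = 0.
Proof.
move=> H; rewrite /LL big1 // => B _; have [->|d0] := eqVneq (d B) 0; first by rewrite mul0r.
by case: asboolP => p; [case: (H B (d_sep d0) p)|rewrite mulr0].
Qed.

Lemma LL_one s B : leaf T s -> separatrix w B -> passes (eqn B) s -> d B = 1 -> LL d bs s = 1.
Proof.
move=> ls S p d1; rewrite /LL (bigD1_seq B) //=; last by apply: bsP; rewrite d1.
rewrite d1 mul1r; case: asboolP => // _; rewrite big1 ?addr0 // => B' BB.
have [->|d0] := eqVneq (d B') 0; first by rewrite mul0r.
case: asboolP => p'; last by rewrite mulr0.
by have [_ _ _ /(_ B' (d_sep d0) p') E] := leaf_curve ls S p; rewrite E eqxx in BB.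
Qed.

(** A dicritical component through the leaf would be a second component there, and no separatrix
    passes through a corner. *)
Lemma leaf_isolated s b B : leaf T s -> separatrix w B -> passes (eqn B) s ->
  einv w b s -> d B = 1.
Proof.
move=> ls S p /andP[/eqP a0 iv]; apply: d_isol; split=> // q.
rewrite !inE => /andP[_ /asboolP /(dicriticalE wn0) nd] [_ [s' [ls' qs' ps']]].
have E := passes_leaf_uniq T_closed ls' ls ps' p; rewrite E in qs'.
have [b' ab'] := (on_componentE _ _).1 qs'; have ivE := inva_nondic wn0 ab'.
have [bb|bb] := eqVneq b' b; first by rewrite -bb ivE (negPf nd) in iv.
apply: (corner_no_curve ls S p a0); rewrite (_ : ~~ b = b') ?ab' //.
by case: (b') (b) bb => [] [].
Qed.

(** At a singular leaf the index is 1, accounted for either by a second invariant component or by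
    the isolated separatrix; at a regular one it is 0, and there is neither. *)
Lemma base_I s b : leaf T s -> stI w d bs b s.
Proof.
move=> ls e; have /andP[/eqP a0 iv] := e; rewrite (FD_leaf ls a0).
have [sg|ns] := pselect (singular (W s)).
  have [lam [[l0 L] H]] := leaf_singular ls sg; have [det _] := lambda_coefs l0 H.
  have [tl _] := singular_axis det (eqP iv).
  have lz : coef2 (lng b (W s)) 0 0 = 0 by case: sg; case: (b).
  have [pn ->] := ord_par1 lz tl; split=> //.
  have [aN|/eqP aN] := eqVneq (ax (~~ b) s) None; last first.
    rewrite LL_none => [|B S p]; last exact: corner_no_curve ls S p a0 aN.
    by rewrite /einv (singular_axis_inv ls sg aN) andbT; move/eqP: aN => ->.
  rewrite /einv aN /= addr0.
  have [g1 [g2 [[h1 h2] [n1 n2] I1 I2 tr]]] := leaf_two_branches ls sg.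
  have [B [S p]] : exists B, separatrix w B /\ passes (eqn B) s.
    by case: (transverse_off b tr) => o;
      [have [B [S r]] := leaf_branch wn0 h1 n1 I1 (off_axesI o (fun H => False_ind _ (H aN)))
      |have [B [S r]] := leaf_branch wn0 h2 n2 I2 (off_axesI o (fun H => False_ind _ (H aN)))];
      exists B; split=> //; exact: root_passes r.
  by rewrite (LL_one ls S p) // (leaf_isolated ls S p e).
have t0 := inva_coef0 iv; have l0 := regular_axis ns t0.
split.
  by apply: contraNneq l0 => E; rewrite -(pull_coef0 (par b)) E coefs0.
rewrite (ord_pull0 _ l0) LL_none => [|B S p]; last exact: regular_inv_no_curve ls ns e S p.
suff -> : einv w (~~ b) s = false by [].
apply/negP => /andP[_ /inva_coef0 E]; move/eqP: l0; apply; move: E; by case: (b).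
Qed.

(** The leaf is regular, and the tangency order is 0 because a branch tangent to the component would
    be a separatrix tangent to it. At a corner the other component is invariant, or else a
    separatrix would pass there. *)
Lemma base_J s b : leaf T s -> stJ w T d bs b s.
Proof.
move=> ls a0 ni; exists 0%N; rewrite cats0; split=> //; rewrite (FD_leaf ls a0).
have ns : ~ singular (W s).
  by move=> sg; move: ni; rewrite (singular_axis_inv ls sg a0).
have [g [h I g1]] := regular_branch ns.
have n : nz g by case: g1 => g1; [left|right]; apply: contraNneq g1 => ->; rewrite coefs0.
have ob := off_axis h n I ni.
have t0 : coef2 (trv b (W s)) 0 0 != 0.
  apply/eqP => t0; have l0 := regular_axis ns t0.
  have I0 : coef2 (lng b (W s)) 0 0 * coefs (axc b g) 1 = 0.
    have := congr1 (fun p => coefs p 0) I; rewrite coefsD !coefsM0 !pull_coef0 !coefs_deriv !mulr1n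
      coefs0.
    by move: t0; case: (b) => /= ->; rewrite mul0r ?addr0 ?add0r.
  have c0 : coefs (axc b g) 1 = 0 by apply/eqP; move/eqP: I0; rewrite mulf_eq0 (negPf l0).
  have c1 : coefs (axc (~~ b) g) 1 != 0 by move: c0 g1; case: (b) => /= ->; rewrite eqxx => -[].
  have oN : axc (~~ b) g != 0 by apply: contraNneq c1 => ->; rewrite coefs0.
  have [B [S r]] := leaf_branch wn0 h n I (off_axesI ob (fun _ => oN)).
  have [_ /(_ b a0) tr _ _] := leaf_curve ls S (root_passes r).
  have := tangent_eqn h r; move/eqP: tr; move: c0 c1; case: (b) => /= -> c1 tr.
    by rewrite mulr0 add0r => /eqP; rewrite mulf_eq0 (negPf c1) orbF => /eqP.
  by rewrite mulr0 addr0 => /eqP; rewrite mulf_eq0 (negPf c1) orbF => /eqP.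
rewrite (ord_pull0 _ t0) subrr add0r.
suff -> : cornb s = einv w (~~ b) s by rewrite subrr.
apply/idP/idP => [/forallP co|/andP[aN _]]; last first.
  apply/forallP => b'; have [->|bb] := eqVneq b' b; first exact/eqP.
  by rewrite (_ : b' = ~~ b) //; case: (b') (b) bb => [] [].
rewrite /einv co /=; apply: contraT => niN.
have oN := off_axis h n I niN.
have [B [S r]] := leaf_branch wn0 h n I (off_axesI ob (fun _ => oN)).
by case: (corner_no_curve ls S (root_passes r) a0); apply/eqP/co.
Qed.

Lemma node_A s : s \in T -> stA w d bs s.
Proof.
by apply: (tree_A wn0 ubs d_sep T_closed d_dic) => {}s b ls; split; [exact: base_I|exact: base_J].
Qed.

(* The intersection number of [gam] with the invariant components through [s]. *)
Definition axv s gam : int := (einv w true s)%:Z * (ord (axc true gam))%:Z +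
  (einv w false s)%:Z * (ord (axc false gam))%:Z.
Lemma axvE b s gam : axv s gam = (einv w b s)%:Z * (ord (axc b gam))%:Z +
  (einv w (~~ b) s)%:Z * (ord (axc (~~ b) gam))%:Z.
Proof. by case: b; [reflexivity|exact: addrC]. Qed.

Lemma axc_neq0 s b B gam : z0 gam -> nz gam -> pull (FB B s) gam = 0 -> ax b s <> None ->
  axc b gam != 0.
Proof.
move=> h n g0 a0; apply: contraTneq (FB_par_neq0 B a0) => a.
by rewrite (axis_root h n a g0) eqxx.
Qed.

Lemma FB_root_uniq s B B' gam : z0 gam -> nz gam -> pull (FB B s) gam = 0 ->
  B' != B -> pull (FB B' s) gam != 0.
Proof.
move=> h n g0; apply: contraNneq => g0'.
have [r rn] := root_push (eqn_neq0 B) h n g0; have [r' _] := root_push (eqn_neq0 B') h n g0'.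
by apply/eqP; apply: eqn_divides; apply/(pull_ker_curve (push_z0 s h) rn r').
Qed.

(** The GSV-formula for the strict transforms at s, the invariant exceptional components counting as
    further branches. All factors are allowed, since blow-ups multiply them. *)
Definition stK B s := forall gam (mu0 mu1 : fps C), z0 gam -> nz gam -> pull (FB B s) gam = 0 ->
  mu0 != 0 -> mu1 != 0 -> rel (W s) (FB B s) gam mu0 mu1 ->
  (ord mu1)%:Z - (ord mu0)%:Z =
  \sum_(B' <- bs | B' != B) d B' * (ord (pull (FB B' s) gam))%:Z + axv s gam.

(** At a regular leaf the factors have equal orders and there is no other branch or invariant
    component. At a singular one there is exactly one component, and one coefficient of w is its
    equation times that of df, up to units. *)
Lemma leaf_K B s : d B = 1 -> leaf T s -> stK B s.
Proof.
move=> d1 ls gam mu0 mu1 h n g0 m0 m1 [r1 r2].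
have S : separatrix w B by apply: d_sep; rewrite d1.
have p := root_passes g0; have [ll tr nc u] := leaf_curve ls S p.
rewrite big1 ?add0r => [|B' BB]; last first.
  have [->|d0] := eqVneq (d B') 0; first by rewrite mul0r.
  rewrite ord_pull0 ?mulr0 //; apply/eqP => p'.
  by rewrite (u B' (d_sep d0) p') eqxx in BB.
have [sg|ns] := pselect (singular (W s)); last first.
  have e0 b : einv w b s = false.
    by apply/negP => e; case: (regular_inv_no_curve ls ns e S p).
  rewrite /axv !e0 !mul0r addr0; have E := separatrix_at wn0 S p.
  suff H (z f : series2 R) : mu0 * pull z gam = mu1 * pull f gam -> coef2 z 0 0 != 0 -> coef2 f 0 0
    != 0 ->
      (ord mu1)%:Z - (ord mu0)%:Z = 0.
    case: ll => l.
      apply: (H _ _ r1); last by rewrite coef2_deriv_x mulr1n.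
      apply/eqP => w1; apply: ns; split=> //; apply: (mulIf l); by rewrite -E w1 !mul0r.
    apply: (H _ _ r2); last by rewrite coef2_deriv_y mulr1n.
    apply/eqP => w2; apply: ns; split=> //; apply: (mulIf l); by rewrite E w2 !mul0r.
  move=> E1 z0' f0'.
  have zn : pull z gam != 0 by apply: contraNneq z0' => Z; rewrite -(pull_coef0 gam) Z coefs0.
  have fn : pull f gam != 0 by apply: contraNneq f0' => Z; rewrite -(pull_coef0 gam) Z coefs0.
  have := congr1 (@ord _) E1; rewrite (ordM m0 zn) (ordM m1 fn) !ord_pull0 // !addn0 => ->.
  exact: subrr.
have [b a0] : exists b, ax b s <> None.
  have [_ [E|[q [c [sE _]]]]] := ls.
    move: ls; rewrite E => -[nT _]; have /fset0Pn [t tT] := T0.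
    by have := T_prefix T_closed (s := [::]) (t := t) tT; rewrite (negPf nT).
  by exists (typ c); rewrite sE ax_new.
have iv := singular_axis_inv ls sg a0.
have aN : ax (~~ b) s = None.
  by apply: contrapT => aN; apply: corner_no_curve ls S p a0 aN.
have eb : einv w b s by rewrite /einv iv andbT; apply/eqP.
have eN : einv w (~~ b) s = false by rewrite /einv aN.
rewrite (axvE b) eb eN mul1r mul0r addr0.
have [lam [[l0 L] H]] := leaf_singular ls sg; have [det _] := lambda_coefs l0 H.
have [_ tt] := singular_axis det (eqP iv); have tb := tr b a0.
have an := axc_neq0 h n g0 a0.
have [z zE] : exists z, trv b (W s) = z * (if b then varX R else varY R).
  move: iv; rewrite /inva; case: (b) => /eqP iv.
    exact: (exc_dvd (Some 0) _).2 iv.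
  exact: (exc_dvd None _).2 iv.
have z00 : coef2 z 0 0 != 0.
  apply: contraNneq tt; rewrite zE /tr1; case: (b) => /= z0'.
    by rewrite coef2M10 z0' !coef2X /= mul0r mulr0 addr0.
  by rewrite coef2M01 z0' !coef2Y /= mul0r mulr0 addr0.
have zn : pull z gam != 0 by apply: contraNneq z00 => Z; rewrite -(pull_coef0 gam) Z coefs0.
pose f := if b then dy (FB B s) else dx (FB B s).
have f00 : coef2 f 0 0 != 0.
  by rewrite /f; move: tb; rewrite /tr1; case: (b); rewrite ?coef2_deriv_x ?coef2_deriv_y mulr1n.
have fn : pull f gam != 0 by apply: contraNneq f00 => Z; rewrite -(pull_coef0 gam) Z coefs0.
have E : mu0 * (pull z gam * axc b gam) = mu1 * pull f gam.
  have -> : pull z gam * axc b gam = pull (trv b (W s)) gam.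
    by rewrite zE (pullM _ _ h); case: (b); rewrite ?(pullX h) ?(pullY h).
  by rewrite /f; case: (b); [exact: r2|exact: r1].
have := congr1 (@ord _) E; rewrite (ordM m0 (mulf_neq0 zn an)) (ordM zn an) (ordM m1 fn).
rewrite (ord_pull0 _ z00) (ord_pull0 _ f00) add0n addn0 => <-.
by rewrite PoszD addrC addKr.
Qed.

(** Let e be the exceptional equation along the branch. The factors gain powers of e given by the
    multiplicities of w (plus 1 if dicritical) and of B, the other branches lose their
    multiplicities times ord e, and [stA] is the identity that remains. *)
Lemma step_K B s : d B = 1 -> s \in T -> (forall c, stK B (rcons s c)) -> stK B s.
Proof.
move=> d1 sT ch gam mu0 mu1 h n g0 m0 m1 r.
have [c [gam' [h' gE]]] := direction_exists h n; subst gam.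
have e0 := pd_nz_excv n; set e := excv c gam' in e0.
have n' : nz gam' by move: e0; rewrite /e; case: (c) => [x|]; [left|right].
have fm B' := smultP (FB_neq0 B' s).
have pE B' : pull (FB B' s) (pd c gam') = e ^+ smult (FB B' s) * pull (FB B' (rcons s c)) gam'.
  by rewrite (pull_pd c h' (fm B')) -(series_blowupE c (fm B')) series_at_rcons.
have g0' : pull (FB B (rcons s c)) gam' = 0.
  by move: g0; rewrite pE => /eqP; rewrite mulf_eq0 (negPf (expf_neq0 _ e0)) => /eqP.
have r' : rel (W (rcons s c)) (FB B (rcons s c)) gam'
    (mu0 * e ^+ (wmult (W s) + ~~ nondic w s)) (mu1 * e ^+ smult (FB B s)).
  rewrite form_at_rcons series_at_rcons; apply: (rel_step h' (fm B) (blownW wn0 s c) _ r).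
  by rewrite -series_at_rcons.
have ex k : e ^+ k != 0 by apply: expf_neq0.
have := ch c gam' _ _ h' n' g0' (mulf_neq0 m0 (ex _)) (mulf_neq0 m1 (ex _)) r'.
rewrite (ordM m0 (ex _)) (ordM m1 (ex _)) !(ordX _ e0) !PoszD !PoszM.
have sE : \sum_(B' <- bs | B' != B) d B' * (ord (pull (FB B' s) (pd c gam')))%:Z =
    \sum_(B' <- bs | B' != B) d B' * (ord (pull (FB B' (rcons s c)) gam'))%:Z +
    (ord e)%:Z * (NN d bs s - (smult (FB B s))%:Z).
  have -> : NN d bs s - (smult (FB B s))%:Z = \sum_(B' <- bs | B' != B) d B' * (smult (FB B' s))%:Z.
    rewrite /NN (bigD1_seq B) //=; last by apply: bsP; rewrite d1.
    have ar (x y : int) : x + y - x = y by ring.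
    by rewrite d1 mul1r ar.
  rewrite mulr_sumr -big_split; apply: eq_bigr => B' BB.
  have fn := FB_root_uniq h' n' g0' BB.
  rewrite pE (ordM (ex _) fn) (ordX _ e0) PoszD PoszM mulrDr addrC; congr (_ + _).
  have ar (x y z : int) : x * (y * z) = z * (x * y) by ring.
  exact: ar.
(* Each invariant axis at s loses the order of e, and the new component contributes it when
   invariant. *)
have aE : axv s (pd c gam') + (nondic w s)%:Z * (ord e)%:Z =
    axv (rcons s c) gam' + ((einv w true s)%:Z + (einv w false s)%:Z) * (ord e)%:Z.
  rewrite (axvE (typ c) s) (axvE (typ c) (rcons s c)) (einv_new wn0) (einv_sum w (typ c)) axc_pd
    -excv_axc -/e.
  have ar (x o y z k u : int) : y = z + u * o -> x * o + y + k * o = k * o + z + (x + u) * o.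
    by move=> ->; ring.
  apply: ar.
  rewrite (einv_old wn0); have [es|] := boolP (einv w (~~ typ c) s); last first.
    by move=> _; rewrite andbF !mul0r addr0.
  have an : axc (~~ typ c) (pd c gam') != 0.
    by apply: (axc_neq0 h n g0); apply/eqP; case/andP: es.
  have [y yE Y] := axc_pdN c h'; rewrite yE -/e in an *.
  have yn : y != 0 by apply: contraNneq an => ->; rewrite mulr0.
  rewrite andbT (ordM e0 yn) PoszD mul1r; move: Y; case: (c == _) => [->|y0].
    by rewrite !mul1r addrC.
  by rewrite (ord_eq0 y0) mul0r mul1r addr0 add0r.
have NE := node_A sT; rewrite /stA in NE; rewrite NE in sE.
move=> E0; rewrite PoszD in E0; rewrite [X in _ = X + _]sE.
have ar (v u k o m a a' S A A' x1 x2 : int) : a + a' = 1 -> A + a * o = A' + (x1 + x2) * o ->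
    v + k * o - (u + (m + a') * o) = S + A' -> v - u = S + o * (m + 1 - x1 - x2 - k) + A.
  move=> E1 E2 E3; have -> : v - u = v + k * o - (u + (m + a') * o) + (m + a' - k) * o by ring.
  have -> : A = A + a * o - a * o by ring.
  rewrite E2 E3; have -> : a' = 1 - a by rewrite -E1; ring.
  ring.
by apply: ar aE E0; case: (nondic w s).
Qed.

Lemma tree_K B s : d B = 1 -> s \in T \/ leaf T s -> stK B s.
Proof.
move=> d1; move: s; apply: tree_ind => [t lt|t tT ch]; first exact: leaf_K.
exact: step_K.
Qed.
End Resolved.

(** * Polar excess and GSV-index *)

Section Polar.
Variable R : realType.
Notation C := (complex R).
Implicit Types (p q e : fps C) (f g h k : series2 R) (gam : fps C * fps C) (B : curve R) (w z :
  oneform R).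

(* [n] is the order of [a * p + b * q] for generic [(a : b)]. *)
Definition is_mo p q n := [/\ vg n p, vg n q & coefs p n != 0 \/ coefs q n != 0].

Lemma is_mo_ex p q : p != 0 \/ q != 0 -> exists n, is_mo p q n.
Proof.
have H p' q' : p' != 0 -> q' != 0 -> (ord p' <= ord q')%N -> is_mo p' q' (ord p').
  move=> p0 q0 pq; have [pn pv] := is_ord_ex p0; split=> //; last by left.
  exact: vg_le pq (ord_vg q0).
have [->|p0] := eqVneq p 0.
  case=> // q0; exists (ord q); have [qn qv] := is_ord_ex q0.
  by split=> //; [exact: vgz|right].
have [->|q0] := eqVneq q 0.
  move=> _; exists (ord p); have [pn pv] := is_ord_ex p0.
  by split=> //; [exact: vgz|left].
move=> _; case: (leqP (ord p) (ord q)) => [|/ltnW] pq; first by exists (ord p); apply: H.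
by exists (ord q); have [h1 h2 h3] := H _ _ q0 p0 pq; split=> //; case: h3; [right|left].
Qed.

Lemma is_mo_uniq p q m n : is_mo p q m -> is_mo p q n -> m = n.
Proof.
move=> [pm qm m0] [pn qn n0]; case: (ltngtP m n) => // mn.
  by case: m0; rewrite ?(pn _ mn) ?(qn _ mn) eqxx.
by case: n0; rewrite ?(pm _ mn) ?(qm _ mn) eqxx.
Qed.

Lemma is_moM e p q n : e != 0 -> is_mo p q n -> is_mo (e * p) (e * q) (ord e + n).
Proof.
move=> e0 [pn qn n0]; have [en ev] := is_ord_ex e0.
by split; [exact: vgM|exact: vgM|]; rewrite !vg_lead //; case: n0 => ?; [left|right]; rewrite
  mulf_neq0.
Qed.

Lemma seq_avoid (s : seq C) : exists t : C, t \notin s.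
Proof.
pose r : seq C := [seq (i%:R : C) | i <- iota 0 (size s).+1].
have ur : uniq r by rewrite map_inj_uniq ?iota_uniq // => i j /eqP; rewrite eqr_nat => /eqP.
have [/allP sr|/allPn [t _ ts]] := boolP (all (mem s) r); last by exists t.
by have := uniq_leq_size ur sr; rewrite size_map size_iota ltnn.
Qed.

Lemma generic_point (S : seq (C * C)) : (0, 0) \notin S -> exists a b : C,
  (a, b) != (0, 0) /\ forall x, x \in S -> a * x.2 != b * x.1.
Proof.
move=> S0; have [t tS] := seq_avoid [seq x.2 / x.1 | x <- S].
exists 1, t; split; first by rewrite xpair_eqE oner_eq0.
move=> [x y] pS; rewrite mul1r; apply/eqP => /= yE; move/negP: tS; apply.
apply/mapP; exists (x, y) => //=; rewrite yE mulfK //.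
apply: contraNneq S0 => x0; by rewrite -[(0, 0)](_ : (x, y) = _) // yE x0 mulr0.
Qed.

Lemma pull_lin gam (a b : C) f g : z0 gam ->
  pull (const2 a * f + const2 b * g) gam = fps_const a * pull f gam + fps_const b * pull g gam.
Proof.
by move=> h; rewrite (pullD _ _ h) (pullM _ f h) (pullM _ g h) (pullC a h) (pullC b h).
Qed.

(** The order n fails only at the point where the leading coefficients cancel; two generic values
    agree because some point avoids both exceptional sets. *)
Lemma polarE w h B n :
  is_mo (pull w.1 (puiseux B)) (pull w.2 (puiseux B)) n ->
  polar w h B = n%:Z - (ord (pull h (puiseux B)))%:Z.
Proof.
have [gz _ _ _] := genB B; set gam := puiseux B in gz *; move=> mo.
have [pn qn n0] := mo; set p := pull w.1 gam in pn qn n0 *; set q := pull w.2 gam in pn qn n0 *.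
have pE (a b : C) : pull (const2 a * w.1 + const2 b * w.2) gam = fps_const a * p + fps_const b * q.
  exact: pull_lin.
have gE : generically (fun a b =>
    (ord (pull (const2 a * w.1 + const2 b * w.2) gam))%:Z - (ord (pull h gam))%:Z =
    n%:Z - (ord (pull h gam))%:Z).
  exists [:: (coefs q n, - coefs p n)].
    rewrite inE eq_sym xpair_eqE oppr_eq0 negb_and; by case: n0 => ->; rewrite ?orbT.
  move=> a b _ /(_ _ (mem_head _ _)) /= ab; congr (Posz _ - _); apply: ordE; rewrite pE; split.
    rewrite coefsD !coefsCM; apply: contraNneq ab => E.
    by rewrite mulrN eq_sym -subr_eq0 opprK addrC E.
  by move=> m mn; rewrite coefsD !coefsCM (pn _ mn) (qn _ mn) !mulr0 addr0.
apply: xget_unique => // m [S S0 SP]; have [S' S0' SP'] := gE.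
have [|a [b [ab abS]]] := @generic_point (S ++ S'); first by rewrite mem_cat negb_or S0.
rewrite -(SP a b ab) ?(SP' a b ab) // => x xS; apply: abS; by rewrite mem_cat xS ?orbT.
Qed.

Lemma rel_mo w f gam mu0 mu1 m n : mu0 != 0 -> mu1 != 0 -> rel w f gam mu0 mu1 ->
  is_mo (pull w.1 gam) (pull w.2 gam) m -> is_mo (pull (dx f) gam) (pull (dy f) gam) n ->
  (ord mu1)%:Z - (ord mu0)%:Z = m%:Z - n%:Z.
Proof.
move=> m0 m1 [r1 r2] /(is_moM m0); rewrite r1 r2 => M /(is_moM m1) /(is_mo_uniq M).
move/(congr1 Posz); rewrite !PoszD => E.
have ar (a b c d' : int) : a + b = c + d' -> c - a = b - d' by lia.
exact: ar.
Qed.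

Lemma rel_uniq w B gam mu0 mu1 nu0 nu1 : z0 gam -> nz gam -> pull (eqn B) gam = 0 ->
  mu0 != 0 -> mu1 != 0 -> nu0 != 0 -> nu1 != 0 ->
  rel w (eqn B) gam mu0 mu1 -> rel w (eqn B) gam nu0 nu1 ->
  (ord mu1)%:Z - (ord mu0)%:Z = (ord nu1)%:Z - (ord nu0)%:Z.
Proof.
move=> h n f0 m0 m1 n0 n1 [r1 r2] [s1 s2].
suff E : nu0 * mu1 = mu0 * nu1.
  have := congr1 (fun p => (ord p)%:Z) E; rewrite (ordM n0 m1) (ordM m0 n1) !PoszD => E'.
  have ar (a b c d' : int) : a + b = c + d' -> b - c = d' - a by lia.
  exact: ar.
case: (grad_neq0 h n f0) => gn; apply: (mulIf gn).
  by rewrite -mulrA -r1 mulrCA s1 mulrA.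
by rewrite -mulrA -r2 mulrCA s2 mulrA.
Qed.

Section Separatrix.
Variables (w : oneform R) (B : curve R).
Hypothesis w_fol : foliation w.
Hypothesis S : separatrix w B.
Let gam := puiseux B.

Lemma puiseux_facts : [/\ z0 gam, nz gam & pull (eqn B) gam = 0].
Proof.
have [h n k _] := genB B; split=> //; apply/k; by exists 1; rewrite mul1r.
Qed.

Lemma coprime_pull h : coprime_elts h (eqn B) -> pull h gam != 0.
Proof.
move=> co; have [_ _ k _] := genB B; apply/eqP => /k dv.
by have /negP := eqn_nonunit B; apply; apply: (co _ dv); exists 1; rewrite mul1r.
Qed.

Lemma foliation_pull : pull w.1 gam != 0 \/ pull w.2 gam != 0.
Proof.
have [_ _ k _] := genB B; apply: contrapT => /not_orP [/negP/negPn/eqP /k X /negP/negPn/eqP /k Y].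
by have /negP := eqn_nonunit B; apply; apply: w_fol.
Qed.

Lemma irr_coprime h : pull h gam != 0 -> coprime_elts h (eqn B).
Proof.
move=> h0 g [a hE] [b fE]; have [h1 _ k _] := genB B; have [_ _ /(_ _ _ fE) [bu|//]] := curve_irr B.
have gE : g = b^-1 * eqn B by rewrite fE mulKr.
have dv : divides (eqn B) h by exists (a * b^-1); rewrite hE gE mulrA.
by move/eqP: h0; case; exact: (k h).2 dv.
Qed.

(** The decomposition defining [GSV1] becomes a proportionality along B, where its last term
    vanishes. *)
Lemma GSV1_rel : exists mu0 mu1 : fps C, [/\ mu0 != 0, mu1 != 0, rel w (eqn B) gam mu0 mu1 &
  GSV1 w B = (ord mu1)%:Z - (ord mu0)%:Z].
Proof.
have [h n f0] := puiseux_facts; set f := eqn B in f0 *.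
have [q qE] := S; rewrite /wedge_d -/f in qE.
have ex : exists n : int, exists g k (eta : oneform R),
    [/\ g * w.1 = k * dx f + f * eta.1, g * w.2 = k * dy f + f * eta.2,
        coprime_elts g f & n = (ord (pull k gam))%:Z - (ord (pull g gam))%:Z].
  (* Invariance allows g to be the partial derivative of f that does not vanish along B, with k the
     matching coefficient of w. *)
  case: (grad_neq0 h n f0) => gn.
    exists ((ord (pull w.1 gam))%:Z - (ord (pull (dx f) gam))%:Z), (dx f), w.1, (0, - q).
    split; [by rewrite mulr0 addr0 mulrC| |exact: irr_coprime|by []].
    rewrite mulrN [f * q]mulrC -qE.
    move: (dx f) (dy f) w.1 w.2 => a b c e; ring.
  exists ((ord (pull w.2 gam))%:Z - (ord (pull (dy f) gam))%:Z), (dy f), w.2, (q, 0).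
  split; [|by rewrite mulr0 addr0 mulrC|exact: irr_coprime|by []].
  rewrite [f * q]mulrC -qE.
  move: (dx f) (dy f) w.1 w.2 => a b c e; ring.
have [g [k [eta [E1 E2 co E]]]] := @xgetPex _ 0 [set n : int | exists g k (eta : oneform R),
    [/\ g * w.1 = k * dx f + f * eta.1, g * w.2 = k * dy f + f * eta.2,
        coprime_elts g f & n = (ord (pull k gam))%:Z - (ord (pull g gam))%:Z]] ex.
have gn := coprime_pull co.
have P a b v : g * a = k * b + f * v -> pull g gam * pull a gam = pull k gam * pull b gam.
  move=> E'; rewrite -(pullM _ a h) E' (pullD _ _ h) (pullM k _ h) (pullM f _ h) f0 mul0r addr0 //.
have r1 := P _ _ _ E1; have r2 := P _ _ _ E2.
exists (pull g gam), (pull k gam); split=> //.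
apply: contraTneq gn => k0; rewrite k0 !mul0r in r1 r2; rewrite negbK.
case: foliation_pull => wn; [move/eqP: r1|move/eqP: r2];
by rewrite mulf_eq0 (negPf wn) orbF.
Qed.

(** Along B, num vanishes and its differential is v df, so the numerator of dF is den v df; dividing
    by den^2 leaves ord v - ord den between the polar orders of dF and df. *)
Lemma GSV1_polar num den v : num = v * eqn B -> pull v gam != 0 -> pull den gam != 0 ->
  GSV1 w B = polar w 1 B
    - polar (den * dx num - num * dx den, den * dy num - num * dy den) (den ^+ 2) B
    + (ord (pull v gam))%:Z - (ord (pull den gam))%:Z.
Proof.
move=> nE vn dn; have [mu0 [mu1 [m0 m1 r ->]]] := GSV1_rel; have [h n f0] := puiseux_facts.
have [m mo] := is_mo_ex foliation_pull; have [l lo] := is_mo_ex (grad_neq0 h n f0).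
rewrite (rel_mo m0 m1 r mo lo) (polarE 1 mo).
have num0 : pull num gam = 0 by rewrite nE (pullM _ _ h) f0 mulr0.
have dxn : pull (dx num) gam = pull v gam * pull (dx (eqn B)) gam.
  by rewrite nE dxM (pullD _ _ h) (pullM (dx v) _ h) f0 mulr0 add0r (pullM v _ h).
have dyn : pull (dy num) gam = pull v gam * pull (dy (eqn B)) gam.
  by rewrite nE dyM (pullD _ _ h) (pullM (dy v) _ h) f0 mulr0 add0r (pullM v _ h).
have P a b : pull (den * a - num * b) gam = pull den gam * pull a gam.
  by rewrite (pullB _ _ h) (pullM den a h) (pullM num b h) num0 mul0r subr0.
have mo' := is_moM dn (is_moM vn lo).
rewrite -dxn -dyn -(P (dx num) (dx den)) -(P (dy num) (dy den)) in mo'.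
rewrite (polarE (w := (den * dx num - num * dx den, den * dy num - num * dy den)) (den ^+ 2) mo').
rewrite (pull1 h) ord1 (pullXn _ _ h) (ordX _ dn) mul2n -addnn !PoszD.
move: (m%:Z) (l%:Z) ((ord (pull den gam))%:Z) ((ord (pull v gam))%:Z) => a b c e; ring.
Qed.
End Separatrix.
End Polar.

(** * Divisors and sums of intersection numbers *)

Section Divisors.
Variable R : realType.
Notation C := (complex R).
Implicit Types (f g h u : series2 R) (B : curve R) (F : mero R) (s bs : seq (curve R)).

(** On the diagonal the quotient is infinite-dimensional and this is a default value, which cancels
    in the sums below. *)
Definition I2 B B' : int := (inter (eqn B) (eqn B'))%:Z.
Lemma I2C B B' : I2 B B' = I2 B' B. Proof. by rewrite /I2 inter_sym. Qed.

Lemma sum_count (s bs : seq (curve R)) (G : curve R -> int) : uniq bs -> {subset s <= bs} ->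
  \sum_(B <- s) G B = \sum_(B <- bs) (count_mem B s)%:Z * G B.
Proof.
move=> ubs; elim: s => [|B s IH] sb; first by rewrite big_nil big1 // => B _; rewrite mul0r.
rewrite big_cons IH => [|x xs]; last by apply: sb; rewrite inE xs orbT.
rewrite [RHS](eq_bigr (fun x => (B == x)%:Z * G x + (count_mem x s)%:Z * G x)) => [|x _]; last
  first.
  by rewrite /= PoszD mulrDl.
rewrite big_split /=; congr (_ + _); rewrite (bigD1_seq B) //=; last by apply: sb; rewrite inE eqxx.
rewrite eqxx mul1r big1 ?addr0 // => x; rewrite eq_sym => /negPf ->; exact: mul0r.
Qed.

Lemma pull_eqn_neq0 B B' : B' != B -> pull (eqn B') (puiseux B) != 0.
Proof.
have [_ _ k _] := genB B; apply: contraNneq => /k /eqn_divides ->; exact: eqxx.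
Qed.

Lemma ord_prod B u s : u \is a GRing.unit -> B \notin s ->
  pull (u * \prod_(B' <- s) eqn B') (puiseux B) != 0 /\
  (ord (pull (u * \prod_(B' <- s) eqn B') (puiseux B)))%:Z = \sum_(B' <- s) I2 B B'.
Proof.
have [h _ _ _] := genB B => uu; elim: s => [_|B' s IH].
  rewrite !big_nil mulr1 ord_pull0 -?series2_unitE //; split=> //; exact: pull_unit.
rewrite inE negb_or eq_sym => /andP[BB /IH [n E]]; rewrite !big_cons mulrCA (pullM _ _ h).
have pn := pull_eqn_neq0 BB; split; first exact: mulf_neq0.
by rewrite (ordM pn n) PoszD E /I2 (inter_gen (genB B) pn).
Qed.

Lemma zeros_poles F : exists s1 s2, [/\ exists2 u, u \is a GRing.unit & num F = u * \prod_(B <- s1)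
  eqn B,
  exists2 u, u \is a GRing.unit & den F = u * \prod_(B <- s2) eqn B,
  forall B, zeros F B = (count_mem B s1)%:Z, forall B, poles F B = (count_mem B s2)%:Z &
  forall B, B \in s1 -> B \notin s2].
Proof.
have [u [s1 [uu E1]]] := factorization (num_neq0 F).
have [v [s2 [vu E2]]] := factorization (den_neq0 F).
exists s1, s2; split; [exists u; [exact: uu|exact: E1]|exists v; [exact: vu|exact: E2]| | |].
- by move=> B; rewrite /zeros E1 multiplicity_prod.
- by move=> B; rewrite /poles E2 multiplicity_prod.
have dv B (t : series2 R) s : B \in s -> divides (eqn B) (t * \prod_(B' <- s) eqn B').
  move=> Bs; rewrite (big_rem B) //=; exists (t * \prod_(B' <- rem B s) eqn B').
  by rewrite -mulrA [X in t * X = _]mulrC.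
move=> B B1; apply/negP => B2; have /negP := eqn_nonunit B; apply.
by apply: (@num_den _ F); [rewrite E1; apply: dv|rewrite E2; apply: dv].
Qed.

Lemma inter_divE (D1 D2 : divisor R) s1 s2 : uniq s1 -> uniq s2 ->
  (forall B, B \notin s1 -> D1 B = 0) -> (forall B, B \notin s2 -> D2 B = 0) ->
  inter_div D1 D2 = \sum_(B <- s1) \sum_(B' <- s2) D1 B * D2 B' * I2 B B'.
Proof.
move=> u1 u2 S1 S2; rewrite /inter_div (@fsbigTE _ _ _ _ [fset p in [seq (B, B') | B <- s1, B' <-
  s2]]%fset).
  rewrite (perm_big [seq (B, B') | B <- s1, B' <- s2]) ?big_allpairs //=.
  apply: uniq_perm => [||p]; rewrite ?fset_uniq ?inE //.
  by apply: allpairs_uniq => // -[? ?] [? ?].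
move=> [B B']; rewrite !inE => /= n.
have [B1|/S1 ->] := boolP (B \in s1); last by rewrite !mul0r.
have [B2|/S2 ->] := boolP (B' \in s2); last by rewrite mulr0 mul0r.
by case/negP: n; apply/allpairsP; exists (B, B').
Qed.

Lemma GSV_seqE w s : GSV_seq w s =
  \sum_(B <- s) (GSV1 w B + I2 B B) - \sum_(B <- s) \sum_(B' <- s) I2 B B'.
Proof.
elim: s => [|B s IH]; first by rewrite !big_nil subr0.
rewrite /= IH -/(I2 B) !big_cons.
have -> : \sum_(B0 <- s) \sum_(B' <- B :: s) I2 B0 B' =
    \sum_(B' <- s) I2 B B' + \sum_(B0 <- s) \sum_(B' <- s) I2 B0 B'.
  rewrite -big_split; apply: eq_bigr => x _; by rewrite big_cons I2C.
rewrite (eq_bigr (fun B' => I2 B B')) //.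
move: (GSV1 w B) (\sum_(_ <- s) (_ + _)) (\sum_(_ <- s) I2 B _) (\sum_(_ <- s) \sum_(_ <- s) _) (I2
  B B) => a b c e x.
ring.
Qed.
End Divisors.

(** * The two separatrices of a reduced singularity *)

Section Linear.
Variable R : realType.
Notation C := (complex R).
Implicit Types (B : curve R) (w : oneform R).

Lemma foliation_neq0 w : foliation w -> w <> (0, 0).
Proof.
move=> co E; have : varX R \is a GRing.unit.
  by apply: co; rewrite E; exists 0; rewrite mul0r.
by rewrite series2_unitE coef2X /= eqxx.
Qed.

(** By Cramer's rule J w = f2 h2 df1 along B. The Jacobian J is a unit by transversality and h2 is
    one because the linear part of w is invertible, so the order of f2 remains. *)
Lemma GSV1_pair w B B' : foliation w -> singular w -> detw w != 0 ->
  separatrix w B -> separatrix w B' -> transverse (eqn B) (eqn B') -> GSV1 w B = I2 B B'.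
Proof.
move=> co [w1 w2] det S S' tr; have [mu0 [mu1 [m0 m1 r ->]]] := GSV1_rel co S.
have [h n f0] := puiseux_facts B; set gam := puiseux B in h n f0 r *.
have BB : B' != B.
  by apply: contraTneq tr => ->; rewrite /transverse mulrC subrr eqxx.
have pn := pull_eqn_neq0 BB; rewrite -/gam in pn.
have [h1 E1] := S; have [h2 E2] := S'.
set f1 := eqn B in E1 f0 r tr *; set f2 := eqn B' in E2 pn tr *.
pose J : series2 R := dx f1 * dy f2 - dy f1 * dx f2.
have J0 : coef2 J 0 0 != 0.
  by rewrite coef2B !coef2M00 !coef2_deriv_x !coef2_deriv_y !mulr1n; exact: tr.
(* Otherwise the linear part of the wedge of w and df2 vanishes, and the invertible linear part of w
   forces df2 to vanish at 0. *)
have h20 : coef2 h2 0 0 != 0.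
  apply/eqP => h0.
  have A := congr1 (fun k => coef2 k 1 0) E2; have A' := congr1 (fun k => coef2 k 0 1) E2.
  rewrite /wedge_d coef2B !coef2M10 w1 w2 h0 eqn00 !mul0r !mulr0 !add0r in A.
  rewrite /wedge_d coef2B !coef2M01 w1 w2 h0 eqn00 !mul0r !mulr0 !add0r in A'.
  rewrite !coef2_deriv_x !coef2_deriv_y !mulr1n in A A'.
  move: A A' tr det; rewrite /transverse /detw.
  move: (coef2 f2 1 0) (coef2 f2 0 1) (coef2 w.1 1 0) (coef2 w.1 0 1) (coef2 w.2 1 0) (coef2 w.2 0
    1).
  move=> p q a b c e /eqP; rewrite subr_eq0 => /eqP A /eqP; rewrite subr_eq0 => /eqP A' tr det.
  have q0 : q = 0.
    apply: (mulfI det); rewrite mulr0.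
    transitivity (e * (a * q) - c * (b * q)); first by ring.
    by rewrite A A'; ring.
  have p0 : p = 0.
    apply: (mulfI det); rewrite mulr0.
    transitivity (a * (e * p) - b * (c * p)); first by ring.
    by rewrite -A -A'; ring.
  by move: tr; rewrite p0 q0 !mulr0 subrr eqxx.
have W1 : J * w.1 = f2 * h2 * dx f1 - f1 * h1 * dx f2.
  rewrite [f2 * h2]mulrC [f1 * h1]mulrC -E1 -E2 /wedge_d /J.
  move: (dx f1) (dx f2) (dy f1) (dy f2) w.1 w.2 => a b c d e f; ring.
have W2 : J * w.2 = f2 * h2 * dy f1 - f1 * h1 * dy f2.
  rewrite [f2 * h2]mulrC [f1 * h1]mulrC -E1 -E2 /wedge_d /J.
  move: (dx f1) (dx f2) (dy f1) (dy f2) w.1 w.2 => a b c d e f; ring.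
have P (a b e k : series2 R) : J * a = e * b - f1 * h1 * k -> pull J gam * pull a gam = pull e gam
  * pull b gam.
  move=> E; rewrite -(pullM J a h) E (pullB _ _ h) (pullM e b h) (pullM _ k h) (pullM f1 _ h) f0.
  by rewrite !mul0r subr0.
have Jn : pull J gam != 0 by apply: contraNneq J0 => E; rewrite -(pull_coef0 gam) E coefs0.
have hn : pull h2 gam != 0 by apply: contraNneq h20 => E; rewrite -(pull_coef0 gam) E coefs0.
have fh : pull (f2 * h2) gam = pull f2 gam * pull h2 gam := pullM f2 h2 h.
have fhn : pull (f2 * h2) gam != 0 by rewrite fh mulf_neq0.
rewrite (rel_uniq h n f0 m0 m1 Jn fhn r (conj (P _ _ _ _ W1) (P _ _ _ _ W2))).
by rewrite fh (ordM pn hn) (ord_pull0 _ J0) (ord_pull0 _ h20) addn0 subr0 /I2 (inter_gen (genB B)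
  pn).
Qed.

Lemma transverse_sym (f g : series2 R) : transverse f g -> transverse g f.
Proof.
rewrite /transverse -oppr_eq0 opprB [X in _ -> X - _ != 0]mulrC [X in _ -> _ - X != 0]mulrC //.
Qed.

Lemma lambda_separatrices w lam : foliation w -> lam_ok lam ->
  has_linear_part w (varY R, - const2 lam * varX R) -> exists B1 B2,
  [/\ separatrix w B1, separatrix w B2, transverse (eqn B1) (eqn B2) &
      forall B, separatrix w B -> B = B1 \/ B = B2].
Proof.
move=> co L H; have w0 := foliation_neq0 co.
have [g1 [g2 [h1 h2 I1 I2' tr]]] := lambda_branches L H.
have n1 : coefs g1.1 1 != 0 \/ coefs g1.2 1 != 0.
  apply: contrapT => /not_orP [/negP/negPn/eqP X /negP/negPn/eqP Y].
  by move/eqP: tr; apply; rewrite X Y !mul0r subrr.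
have n2 : coefs g2.1 1 != 0 \/ coefs g2.2 1 != 0.
  apply: contrapT => /not_orP [/negP/negPn/eqP X /negP/negPn/eqP Y].
  by move/eqP: tr; apply; rewrite X Y !mulr0 subrr.
have nz1 (g : fps C * fps C) : coefs g.1 1 != 0 \/ coefs g.2 1 != 0 -> nz g.
  by case=> H'; [left|right]; apply: contraNneq H' => ->; rewrite coefs0.
have off (g : fps C * fps C) : off_axes [::] g by move=> b; rewrite ax_nil.
have [B1 [S1 r1]] := leaf_branch (s := [::]) w0 h1 (nz1 _ n1) I1 (off g1).
have [B2 [S2 r2]] := leaf_branch (s := [::]) w0 h2 (nz1 _ n2) I2' (off g2).
rewrite /= in r1 r2.
have l1 := smooth_eqn h1 n1 r1; have l2 := smooth_eqn h2 n2 r2.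
have t1 : coef2 (eqn B1) 1 0 * coefs g1.1 1 + coef2 (eqn B1) 0 1 * coefs g1.2 1 = 0.
  by rewrite -(pull_coef1 _ h1) r1 coefs0.
have t2 : coef2 (eqn B2) 1 0 * coefs g2.1 1 + coef2 (eqn B2) 0 1 * coefs g2.2 1 = 0.
  by rewrite -(pull_coef1 _ h2) r2 coefs0.
have T12 : transverse (eqn B1) (eqn B2).
  move: tr l1 l2 t1 t2; rewrite /transverse.
  move: (coefs g1.1 1) (coefs g1.2 1) (coefs g2.1 1) (coefs g2.2 1) => a b c e.
  move: (coef2 _ 1 0) (coef2 _ 0 1) (coef2 (eqn B2) 1 0) (coef2 (eqn B2) 0 1) => p q p' q' tr l1 l2
    t1 t2.
  apply/eqP => D; move/eqP: D; rewrite subr_eq0 => /eqP D.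
  have t3 : p * c + q * e = 0.
    case: l2 => l2; apply: (mulIf l2); rewrite mul0r.
      transitivity (p * (p' * c + q' * e) + e * (q * p' - p * q')); first by ring.
      by rewrite t2 D subrr !mulr0 addr0.
    transitivity (q * (p' * c + q' * e) + c * (p * q' - q * p')); first by ring.
    by rewrite t2 D subrr !mulr0 addr0.
  have p0 : p = 0.
    apply: (mulIf tr); rewrite mul0r.
    transitivity (e * (p * a + q * b) - b * (p * c + q * e)); first by ring.
    by rewrite t1 t3 !mulr0 subrr.
  have q0 : q = 0.
    apply: (mulIf tr); rewrite mul0r.
    transitivity (a * (p * c + q * e) - c * (p * a + q * b)); first by ring.
    by rewrite t1 t3 !mulr0 subrr.
  by move: l1; rewrite p0 q0 eqxx => -[].
exists B1, B2; split=> // B S; have [h n f0] := puiseux_facts B.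
have I := (separatrix_inv w h n f0).1 S; have [_ _ k _] := genB B.
by case: (lambda_third L H (eqn00 B1) (eqn00 B2) T12 S1 S2 h I) => /k /eqn_divides; [left|right].
Qed.
End Linear.

(** * Balanced equations *)

Section Balanced.
Variable R : realType.
Notation C := (complex R).
Notation pt := (infnear R).
Implicit Types (B : curve R) (q s : pt).
Variables (w : oneform R) (F : mero R) (T : {fset pt}) (a : pt -> curve R -> int).
Hypothesis w_fol : foliation w.
Hypothesis w_sing : singular w.
Hypothesis wT : resolves w T.
Hypothesis aP : forall q, q \in Dic w T ->
  \sum_(B \in Curv w T q) a q B = 2 - (valence T q)%:Z.
Hypothesis zpE : forall B, zeros F B - poles F B =
  (`[< Isol w T B >])%:Z + \sum_(q <- Dic w T) (`[< Curv w T q B >])%:Z * a q B.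
Let d B : int := zeros F B - poles F B.
Let wn0 := foliation_neq0 w_fol.
Let T_closed : prefix_closed T. Proof. by case: wT. Qed.

Lemma balanced_separatrix B : d B != 0 -> separatrix w B.
Proof.
rewrite /d zpE => d0; apply: contrapT => nS; move/eqP: d0; apply.
rewrite big1 => [|q _]; last by case: asboolP => [[]//|_]; rewrite mul0r.
by case: asboolP => [[]//|_]; rewrite addr0.
Qed.

Lemma balanced_isolated B : Isol w T B -> d B = 1.
Proof.
move=> I; rewrite /d zpE; case: asboolP => // _; rewrite big_seq big1 ?addr0 // => q qD.
by case: asboolP => [Cq|_]; [case: I => _ /(_ q qD)|rewrite mul0r].
Qed.

(** A separatrix goes through one leaf, and two dicritical components there would make it a corner;
    so a single term of the sum survives. *)
Lemma balanced_dicritical q B : q \in Dic w T -> Curv w T q B -> d B = a q B.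
Proof.
move=> qD Cq; have qT : q \in T by move: qD; rewrite !inE => /andP[].
have T0 : T != fset0 by apply/fset0Pn; exists q.
rewrite /d zpE; case: asboolP => [[_ /(_ q qD)]//|_]; rewrite add0r (bigD1_seq q) ?fset_uniq //=.
case: asboolP => // _; rewrite mul1r big1 ?addr0 // => q' qq.
case: asboolP => [Cq'|_]; last by rewrite mul0r.
have [S [s [ls qs ps]]] := Cq; have [_ [s' [ls' qs' ps']]] := Cq'.
have E := passes_leaf_uniq T_closed ls' ls ps' ps; rewrite E in qs'.
have [b ab] := (on_componentE _ _).1 qs; have [b' ab'] := (on_componentE _ _).1 qs'.
have bb : b' = ~~ b.
  case: (b') (b) ab ab' => [] [] //= -> [E']; by rewrite E' eqxx in qq.
case: (corner_no_curve wT T0 ls S ps (b := b)); first by rewrite ab.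
by rewrite -bb ab'.
Qed.

Lemma balanced_sum bs q : uniq bs -> (forall B, d B != 0 -> B \in bs) -> q \in Dic w T ->
  \sum_(B <- bs) d B * (`[< Curv w T q B >])%:Z = 2 - (valence T q)%:Z.
Proof.
move=> ubs bsP qD; rewrite -(aP qD).
have -> : \sum_(B \in Curv w T q) a q B = \sum_(B <- bs | B \in Curv w T q) a q B.
  rewrite [RHS]bigfs ?set_mem_set // => B BC nB; apply/eqP; apply: contraNT nB => a0.
  by apply: bsP; rewrite (balanced_dicritical qD) //; move: BC; rewrite inE.
rewrite [RHS]big_mkcond; apply: eq_bigr => B _.
case: asboolP => [Cq|nC].
  by rewrite mulr1 (balanced_dicritical qD Cq) (_ : (B \in _) = true) //; apply/mem_set.
by rewrite mulr0 (_ : (B \in _) = false) //; apply/negbTE/negP => /set_mem.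
Qed.

(** When nothing is blown up, [resolves] does not constrain separatrices. The origin is then a
    reduced singularity with two transverse separatrices, both isolated, and each is the only branch
    other than the other. *)
Lemma GSV1_balanced_empty bs B : T = fset0 -> ~ saddle_node w -> uniq bs ->
  (forall B, d B != 0 -> B \in bs) -> separatrix w B ->
  GSV1 w B = \sum_(B' <- bs | B' != B) d B' * I2 B B'.
Proof.
move=> T0 ns ubs bsP S; have [_ red _] := wT.
have lf : leaf T [::] by split; [rewrite T0 inE|left].
have [[lam L H]|/ns//] := red [::] lf w_sing.
have dE B' : d B' = (`[< separatrix w B' >])%:Z.
  rewrite /d zpE big_seq big1 ?addr0 => [|q]; last by rewrite !inE T0 inE.
  congr (Posz (nat_of_bool _)); apply/asboolP/asboolP => [[]//|S']; split=> // q.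
  by rewrite !inE T0 inE.
have d1 B' : separatrix w B' -> d B' = 1 by rewrite dE => S'; case: asboolP.
have [det _] := lambda_coefs (proj1 L) H.
have [B1 [B2 [S1 S2 tr third]]] := lambda_separatrices w_fol L H.
have main C1 C2 : separatrix w C1 -> separatrix w C2 -> transverse (eqn C1) (eqn C2) ->
    (forall B', separatrix w B' -> B' = C1 \/ B' = C2) ->
    GSV1 w C1 = \sum_(B' <- bs | B' != C1) d B' * I2 C1 B'.
  move=> Q1 Q2 Qt Q3; rewrite (GSV1_pair w_fol w_sing det Q1 Q2 Qt).
  have C21 : C2 != C1 by apply: contraTneq Qt => ->; rewrite /transverse mulrC subrr eqxx.
  rewrite big_mkcond (bigD1_seq C2) //=; last by apply: bsP; rewrite d1.
  rewrite C21 d1 // mul1r big1 ?addr0 // => B' B'2; case: ifP => // B'1.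
  rewrite dE; case: asboolP => [/Q3[E|E]|_]; last exact: mul0r.
    by rewrite E eqxx in B'1.
  by rewrite E eqxx in B'2.
case: (third B S) => ->; first exact: main S1 S2 tr third.
apply: main S2 S1 (transverse_sym tr) _ => B' /third[]; [by right|by left].
Qed.

(** [tree_K] at the origin, where no exceptional component contributes. *)
Lemma GSV1_balanced bs B : (forall s, leaf T s -> ~ saddle_node (form_at w s)) -> uniq bs ->
  (forall B, d B != 0 -> B \in bs) -> d B = 1 ->
  GSV1 w B = \sum_(B' <- bs | B' != B) d B' * I2 B B'.
Proof.
move=> no_sn ubs bsP d1; have S : separatrix w B by apply: balanced_separatrix; rewrite d1.
have [T0|T0] := eqVneq T fset0.
  apply: GSV1_balanced_empty => //; apply: (no_sn [::]).
  by split; [rewrite T0 inE|left].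
have [mu0 [mu1 [m0 m1 r ->]]] := GSV1_rel w_fol S; have [h n f0] := puiseux_facts B.
have root : [::] \in T \/ leaf T [::].
  by left; have /fset0Pn [t tT] := T0; apply: (T_prefix T_closed (t := t)).
have K := tree_K wn0 wT T0 no_sn ubs bsP balanced_separatrix balanced_isolated
  (fun q qD => balanced_sum ubs bsP qD) d1 root h n f0 m0 m1 r.
rewrite K /axv /einv !ax_nil /= !mul0r !addr0; apply: eq_bigr => B' BB.
by rewrite /I2 (inter_gen (genB B) (pull_eqn_neq0 BB)).
Qed.
End Balanced.

(** * Summation over the components *)

Section Sums.
Variable R : realType.
Implicit Types (B : curve R).
Variables (w : oneform R) (F : mero R) (u v : series2 R) (s1 s2 bs : seq (curve R)).
Hypothesis w_fol : foliation w.
Hypothesis uu : u \is a GRing.unit.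
Hypothesis vu : v \is a GRing.unit.
Hypothesis numE : num F = u * \prod_(B <- s1) eqn B.
Hypothesis denE : den F = v * \prod_(B <- s2) eqn B.
Hypothesis zE : forall B, zeros F B = (count_mem B s1)%:Z.
Hypothesis pE : forall B, poles F B = (count_mem B s2)%:Z.
Hypothesis s12 : forall B, B \in s1 -> B \notin s2.
Hypothesis ubs : uniq bs.
Hypothesis s1bs : {subset s1 <= bs}.
Hypothesis s2bs : {subset s2 <= bs}.

Lemma zeros_sum (G : curve R -> int) : \sum_(B <- bs) zeros F B * G B = \sum_(B <- s1) G B.
Proof. by rewrite (sum_count G ubs s1bs); apply: eq_bigr => B _; rewrite zE. Qed.
Lemma poles_sum (G : curve R -> int) : \sum_(B <- bs) poles F B * G B = \sum_(B <- s2) G B.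
Proof. by rewrite (sum_count G ubs s2bs); apply: eq_bigr => B _; rewrite pE. Qed.

Lemma zero_in B : zeros F B != 0 -> B \in s1.
Proof. by rewrite zE -has_pred1 has_count lt0n. Qed.
Lemma zeros_out B : B \notin bs -> zeros F B = 0.
Proof. by move=> nB; apply/eqP; apply: contraNT nB => /zero_in /s1bs. Qed.
Lemma poles_out B : B \notin bs -> poles F B = 0.
Proof.
move=> nB; rewrite pE; have : B \notin s2 by apply: contra nB; apply: s2bs.
by move/count_memPn => ->.
Qed.
Lemma poles_zero B : zeros F B != 0 -> poles F B = 0.
Proof. by move/zero_in/s12/count_memPn => E; rewrite pE E. Qed.

(** The sum over the zeros includes B itself, which the default term on the left absorbs. *)
Lemma GSV1_excess B : zeros F B = 1 -> separatrix w B ->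
  GSV1 w B + I2 B B = polar w 1 B - polar (d_num F) (den F ^+ 2) B +
    (\sum_(B' <- bs) zeros F B' * I2 B B' - \sum_(B' <- bs) poles F B' * I2 B B').
Proof.
move=> z1 S; rewrite zeros_sum poles_sum.
have c1 : count_mem B s1 = 1%N by have := zE B; rewrite z1 => -[].
have B2 : B \notin s2 by apply: s12; apply: zero_in; rewrite z1.
pose P := \prod_(B' <- [seq B' <- s1 | B' != B]) eqn B'.
have nE : num F = (u * P) * eqn B.
  by rewrite numE (prod_count B) c1 expr1 -/P mulrCA [LHS]mulrC.
have [|vn vE] := @ord_prod R B u [seq B' <- s1 | B' != B] uu; first by rewrite mem_filter eqxx.
have [dn dE] := ord_prod vu B2; rewrite -denE in dn dE.
have -> := GSV1_polar w_fol S nE vn dn.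
rewrite vE dE -/(d_num F) big_filter [X in _ = _ + (X - _)](bigID (pred1 B)) /=.
have -> : \sum_(i <- s1 | i == B) I2 B i = I2 B B.
  rewrite (eq_bigr (fun=> I2 B B)) => [|x /eqP -> //]; rewrite big_const_seq.
  by rewrite (_ : count _ s1 = 1%N) //= addr0.
move: (polar w 1 B) (polar _ _ B) (\sum_(_ <- _ | _) _) (\sum_(_ <- s2) _) (I2 B B) => a b c e x.
ring.
Qed.

Lemma GSV_excess (S : {fset curve R}) :
  (forall B, B \in S -> zeros F B = 1) -> (forall B, B \in S -> separatrix w B) ->
  GSV w S = Delta w F S + inter_div (div_of S) (zeros F \- div_of S)
            - inter_div (div_of S) (poles F).
Proof.
move=> z1 sep; have Sbs B : B \in S -> B \in bs.
  by move=> BS; apply/s1bs/zero_in; rewrite z1.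
have uS : uniq S := fset_uniq S.
have dS B : B \notin (S : seq _) -> div_of S B = 0 by rewrite /div_of => /negPf ->.
rewrite /GSV GSV_seqE (inter_divE (s1 := S) (s2 := bs)) //; last first.
  move=> B nB; have nS : B \notin (S : seq _) by apply: contra nB; apply: Sbs.
  by rewrite /= zeros_out // dS // subr0.
rewrite (inter_divE (s1 := S) (s2 := bs)) //; last exact: poles_out.
rewrite /Delta -big_split -!sumrB /=; apply: eq_big_seq => B BS.
rewrite (GSV1_excess (z1 B BS) (sep B BS)).
have -> : \sum_(B' <- bs) div_of S B * (zeros F B' - div_of S B') * I2 B B' =
    \sum_(B' <- bs) zeros F B' * I2 B B' - \sum_(B' <- S) I2 B B'.
  rewrite (sum_count _ ubs (s := S)) // -sumrB; apply: eq_bigr => B' _.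
  by rewrite /div_of BS mul1r count_uniq_mem // mulrBl.
have -> : \sum_(B' <- bs) div_of S B * poles F B' * I2 B B' = \sum_(B' <- bs) poles F B' * I2 B B'.
  by apply: eq_bigr => B' _; rewrite /div_of BS mul1r.
have ar (x y z t : int) : x + (y - z) - t = x + (y - t) - z by ring.
exact: ar.
Qed.

Lemma zero_componentsE B : (B \in zero_components F) = (zeros F B != 0).
Proof.
rewrite in_fset_set; first by apply/idP/idP => [/set_mem|H] //; apply/mem_set.
apply: (sub_finite_set (B := [set` bs])); last exact: finite_seq.
by move=> x /= /zero_in /s1bs.
Qed.

(** Summing the indices counts each pair of zeros twice, which is what the GSV-index of a union
    subtracts; only the poles remain. *)
Lemma GSV_zero_components :
  (forall B, B \in zero_components F -> zeros F B = 1) ->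
  (forall B, B \in zero_components F -> GSV1 w B =
     \sum_(B' <- bs | B' != B) (zeros F B' - poles F B') * I2 B B') ->
  GSV w (zero_components F) = - inter_div (zeros F) (poles F).
Proof.
move=> z1 G; set Z := zero_components F in z1 G *; have uZ : uniq Z := fset_uniq Z.
have zZ B : B \notin (Z : seq _) -> zeros F B = 0.
  by rewrite -[_ \notin _]/(~~ (B \in zero_components F)) zero_componentsE negbK => /eqP.
have Zbs B : B \in Z -> B \in bs.
  by move=> BZ; apply/s1bs/zero_in; rewrite -zero_componentsE.
rewrite /GSV GSV_seqE (inter_divE (s1 := Z) (s2 := bs)) //; last exact: poles_out.
rewrite -sumrB -sumrN; apply: eq_big_seq => B BZ.
have zB := z1 B BZ; have pB : poles F B = 0 by apply: poles_zero; rewrite zB.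
rewrite G //; have -> : \sum_(B' <- Z) I2 B B' = \sum_(B' <- bs) zeros F B' * I2 B B'.
  rewrite (sum_count _ ubs (s := Z)) //; apply: eq_bigr => B' _; rewrite count_uniq_mem //.
  by congr (_ * _); case: (boolP (B' \in (Z : seq _))) => [/z1 ->//|/zZ ->].
have -> : \sum_(B' <- bs) zeros F B * poles F B' * I2 B B' = \sum_(B' <- bs) poles F B' * I2 B B'.
  by apply: eq_bigr => B' _; rewrite zB mul1r.
have : \sum_(B' <- bs) (zeros F B' - poles F B') * I2 B B' =
    I2 B B + \sum_(B' <- bs | B' != B) (zeros F B' - poles F B') * I2 B B'.
  by rewrite (bigD1_seq B) ?Zbs //= zB pB subr0 mul1r.
rewrite (eq_bigr (fun B' => zeros F B' * I2 B B' - poles F B' * I2 B B')) => [|x _]; last exact: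
  mulrBl.
rewrite sumrB; move: (\sum_(_ <- bs | _) _) (\sum_(_ <- bs) zeros F _ * _) (\sum_(_ <- bs) poles F
  _ * _) (I2 B B).
move=> a b c x E; have -> : a = b - c - x by rewrite E; ring.
ring.
Qed.
End Sums.

Theorem theorem2 (R : realType) (w : oneform R) (F : mero R)
  (w_fol : foliation w) (w_sing : singular w) (F_bal : balanced w F) :
  (forall S : {fset curve R},
     (forall B, B \in S -> zeros F B = 1) ->
     GSV w S = Delta w F S
               + inter_div (div_of S) (zeros F \- div_of S)
               - inter_div (div_of S) (poles F)) /\
  (generalized_curve w ->
   (forall B, B \in zero_components F -> zeros F B = 1) ->
   GSV w (zero_components F) = - inter_div (zeros F) (poles F)).
Proof.
have [T [wT minT] [a [aP zpE]]] := F_bal.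
have [s1 [s2 [[u uu numE] [v vu denE] zE pE s12]]] := zeros_poles F.
pose bs := undup (s1 ++ s2); have ubs : uniq bs := undup_uniq _.
have s1bs : {subset s1 <= bs} by move=> B B1; rewrite mem_undup mem_cat B1.
have s2bs : {subset s2 <= bs} by move=> B B2; rewrite mem_undup mem_cat B2 orbT.
have d1 B : zeros F B = 1 -> zeros F B - poles F B = 1.
  by move=> z1; rewrite (poles_zero zE pE s12) ?z1 ?subr0.
have sep B : zeros F B = 1 -> separatrix w B.
  by move=> z1; apply: (balanced_separatrix zpE); rewrite d1.
split=> [S z1|[T' [wT' minT'] no_sn] z1].
  by apply: (GSV_excess w_fol uu vu numE denE zE pE s12 ubs s1bs s2bs z1) => B /z1; apply: sep.
(* Two minimal reductions contain each other, so that of [generalized_curve] is that of the balanced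
   equation. *)
have TE : T' = T by apply/eqP; rewrite eqEfsubset minT // minT'.
apply: (GSV_zero_components zE pE s12 ubs s1bs s2bs z1) => B /z1 zB.
apply: (GSV1_balanced w_fol w_sing wT (fun q qD => proj2 (aP q qD)) zpE _ ubs _ (d1 B zB)).
  by move=> s; rewrite -TE; apply: no_sn.
move=> B' d0; rewrite mem_undup mem_cat; apply: contraNT d0; rewrite negb_or => /andP[n1 n2].
by rewrite zE pE (count_memPn n1) (count_memPn n2) subrr.
Qed.
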